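(* Let $X$ be a Banach space over $\mathbb{K}\in\{\mathbb{R},\mathbb{C}\}$ and let $A\subset\mathcal{B}(X)$ be a Banach algebra of operators (a norm-closed subalgebra of $\mathcal{B}(X)$) which is not dense in $\mathcal{B}(X)$ with respect to the weak operator topology. Then at least one of the following two conditions holds: (a) $A$ has a resolving vector functional, i.e. there are non-zero $x\in X^{**}$ and $y\in X^*$ such that $|(x,T^*y)|\le \|T\|_e\,(x,y)$ for all $T\in A$; (b) $\mathbb{K}=\mathbb{R}$ and $A$ contains a non-zero idempotent of finite rank.
   Context: $\mathcal{B}(X)$ is the algebra of all bounded linear operators on $X$ and $\mathcal{K}(X)$ is the ideal of compact operators. The essential norm of $T\in\mathcal{B}(X)$ is $\|T\|_e=\inf\{\|T+K\|:K\in\mathcal{K}(X)\}$. $T^*\in\mathcal{B}(X^* )$ denotes the adjoint operator, and $(x,y)$ for $x\in X^{**}$, $y\in X^*$ denotes the value $x(y)$. An algebra of operators is not assumed to contain the identity operator. For non-zero $x\in X^{**}$, $y\in X^*$, the vector functional $\omega_{x,y}(T)=(x,T^*y)$ is called resolving for $A$ if $|(x,T^*y)|\le\|T\|_e(x,y)$ for all $T\in A$ (in particular the right-hand side is required to be real and non-negative). *)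

(* Defs.v *)
From HB Require Import structures.
From mathcomp Require Import all_boot all_order all_algebra.
From mathcomp Require Import all_classical reals topology normedtype.
From mathcomp Require Import complex.
Set Implicit Arguments.
Unset Strict Implicit.
Unset Printing Implicit Defensive.
Import Order.TTheory GRing.Theory Num.Theory.
Import numFieldTopology.Exports numFieldNormedType.Exports.
Local Open Scope classical_set_scope.
Local Open Scope ring_scope.

Variant scalar_kind := real_scalars | complex_scalars.

Definition scalar_field (R : realType) (k : scalar_kind) : numFieldType :=
  match k with
  | real_scalars => R
  | complex_scalars => R[i]
  end.

(* As everywhere in MathComp, norms take their values in the scalar field.  In
   [R[i]] one has [x <= y] iff [y - x] is real and non-negative, so the
   supremum (infimum) of a bounded set of real numbers, taken in [R[i]], is its
   usual supremum (infimum); the next two lemmas say that it exists. *)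
Lemma scalar_supremumP (R : realType) k (A : set (scalar_field R k)) :
  A !=set0 -> (forall a, A a -> 0 <= a) -> ubound A !=set0 ->
  supremums A (supremum 0 A).
Proof.
move=> A0 A_ge0 uA; rewrite /supremum ifF; last first.
  by apply/negbTE/set0P.
suff [s ss] : supremums A !=set0 by case: xgetP => [//|/(_ s)].
case: k A A0 A_ge0 uA => /= A A0 A_ge0 [u uA].
  have hA : has_sup A by split=> //; exists u.
  exists (sup A); split; first exact: sup_upper_bound.
  by move=> v vA; apply: ge_sup.
have Areal a : A a -> exists2 r, a = r%:C%C & 0 <= r.
  move=> /A_ge0; case: a => a b; rewrite lecE /= => /andP[/eqP -> a0].
  by exists a.
pose B := [set r | A r%:C%C].
have Bu r : B r -> r <= complex.Re u.
  by move=> /uA; rewrite lecE /= => /andP[].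
have hB : has_sup B.
  split; last by exists (complex.Re u).
  by case: A0 => a Aa; have [r ar _] := Areal _ Aa; exists r; rewrite /B /= -ar.
exists (sup B)%:C%C; split.
  move=> a Aa; have [r ar _] := Areal _ Aa; rewrite ar lecR.
  by apply: sup_upper_bound => //; rewrite /B /= -ar.
move=> v vA; have vB r : B r -> r%:C%C <= v by move=> Br; apply: vA.
have [r0 Br0] := hB.1.
have := vB _ Br0; rewrite lecE /= => /andP[/eqP v0 _].
rewrite lecE /= v0 eqxx /=; apply: ge_sup; first exact: hB.1.
by move=> r /vB; rewrite lecE /= => /andP[].
Qed.

Lemma scalar_infimumP (R : realType) k (A : set (scalar_field R k)) :
  A !=set0 -> (forall a, A a -> 0 <= a) -> infimums A (infimum 0 A).
Proof.
move=> A0 A_ge0; rewrite /infimum ifF; last first.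
  by apply/negbTE/set0P.
suff [s ss] : infimums A !=set0 by case: xgetP => [//|/(_ s)].
pose L := [set l | lbound A l /\ 0 <= l].
have [] := @scalar_supremumP R k L.
- by exists 0.
- by move=> l [].
- by case: A0 => a Aa; exists a => l [lA _]; apply: lA.
move=> sL Ls; exists (supremum 0 L); split.
  by move=> a Aa; apply: Ls => l [lA _]; apply: lA.
move=> l lA; have lr : l \is Num.real.
  case: A0 => a Aa; have := lA _ Aa; rewrite -subr_ge0 => /ger0_real.
  by move=> h; rewrite -[l](subKr a) rpredB// ger0_real// A_ge0.
have [l0|/ltW l0] := real_leP (real0 _) lr; first by apply: sL.
by apply: (le_trans l0); apply: sL; split.
Qed.

Definition bounded_linear (K : numFieldType) (X Y : normedModType K) :
    {pred X -> Y} :=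
  mem [set f : X -> Y |
    linear f /\ exists M : K, forall x, `|f x| <= M * `|x|].

Section bounded_op.
Context (K : numFieldType) (X Y : normedModType K).

Record bounded_op := BoundedOp {
  bounded_op_fun :> X -> Y;
  bounded_opP : bounded_op_fun \in @bounded_linear K X Y }.

HB.instance Definition _ := [isSub for bounded_op_fun].
HB.instance Definition _ := [Choice of bounded_op by <:].

Lemma bounded_linear_submod : submod_closed (@bounded_linear K X Y).
Proof.
split.
  rewrite inE; split.
    by move=> a u v /=; rewrite /= scaler0 addr0.
  by exists 0 => x; rewrite normr0 mul0r.
move=> a f g /set_mem [lf [Mf fM]] /set_mem [lg [Mg gM]]; rewrite inE; split.
  move=> b u v; rewrite !fctE lf lg !scalerDr !scalerA (mulrC a b).
  by rewrite addrACA.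
exists (`|a| * Mf + Mg) => x; rewrite !fctE (le_trans (ler_normD _ _))//.
by rewrite normrZ mulrDl -mulrA lerD// ler_wpM2l.
Qed.

HB.instance Definition _ :=
  GRing.isSubmodClosed.Build K (X -> Y) (@bounded_linear K X Y)
    bounded_linear_submod.
HB.instance Definition _ := [SubChoice_isSubLmodule of bounded_op by <:].

HB.instance Definition _ (T : bounded_op) :=
  GRing.isLinear.Build K X Y _ T (set_mem (bounded_opP T)).1.

Lemma bounded_op_bound (T : bounded_op) :
  exists2 M : K, 0 <= M & forall x, `|T x| <= M * `|x|.
Proof.
have [_ [M TM]] := set_mem (bounded_opP T).
exists `|M| => // x; rewrite -[`|x|]normr_id -normrM.
by rewrite ger0_norm// (le_trans _ (TM x)).
Qed.

Lemma bounded_op_ext (S T : bounded_op) : S =1 T -> S = T.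
Proof. by move=> ST; apply/val_inj/funext. Qed.

End bounded_op.

Definition op_norm (K : numFieldType) (X Y : normedModType K)
    (T : bounded_op X Y) : K :=
  supremum 0 [set `|T x| | x in [set x | `|x| <= 1]].

Section bounded_op_norm.
Context (R : realType) (k : scalar_kind).
Local Notation K := (scalar_field R k).
Context (X Y : normedModType K).
Implicit Types S T : bounded_op X Y.

Let op_norm_supremums T :
  supremums [set `|T x| | x in [set x | `|x| <= 1]] (op_norm T).
Proof.
apply: scalar_supremumP.
- by exists `|T 0|, 0 => //=; rewrite normr0.
- by move=> _ [x _ <-].
have [M M0 TM] := bounded_op_bound T; exists M => _ [x x1 <-].
by rewrite (le_trans (TM x))// ler_piMr.
Qed.

Lemma op_norm_ge0 T : 0 <= op_norm T.
Proof.
have [+ _] := op_norm_supremums T => /(_ `|T 0|).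
rewrite linear0 normr0; apply; exists 0; first by rewrite /= normr0.
by rewrite linear0 normr0.
Qed.

Lemma le_op_norm T x : `|T x| <= op_norm T * `|x|.
Proof.
have [->|x0] := eqVneq x 0; first by rewrite linear0 !normr0 mulr0.
have nx : 0 < `|x| by rewrite normr_gt0.
have [+ _] := op_norm_supremums T => /(_ `|T (`|x|^-1 *: x)|).
rewrite linearZ normrZ normfV normr_id mulrC ler_pdivrMr//; apply.
exists (`|x|^-1 *: x); last by rewrite linearZ normrZ normfV normr_id mulrC.
by rewrite /= normrZ normfV normr_id mulVf// gt_eqF.
Qed.

Lemma op_norm_le T M : 0 <= M -> (forall x, `|T x| <= M * `|x|) ->
  op_norm T <= M.
Proof.
move=> M0 TM; have [_] := op_norm_supremums T; apply => _ [x x1 <-].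
by rewrite (le_trans (TM x))// ler_piMr.
Qed.

Lemma ler_op_normD S T : op_norm (S + T) <= op_norm S + op_norm T.
Proof.
apply: op_norm_le; first by rewrite addr_ge0// op_norm_ge0.
move=> x; rewrite (le_trans (ler_normD _ _))// mulrDl.
by rewrite lerD// le_op_norm.
Qed.

Lemma op_norm0_eq0 T : op_norm T = 0 -> T = 0.
Proof.
move=> T0; apply: bounded_op_ext => x; apply/eqP.
by rewrite -normr_le0 (le_trans (le_op_norm _ _))// T0 mul0r.
Qed.

Lemma op_normZ (a : K) T : op_norm (a *: T) = `|a| * op_norm T.
Proof.
have le b S : op_norm (b *: S) <= `|b| * op_norm S.
  apply: op_norm_le; first by rewrite mulr_ge0// op_norm_ge0.
  by move=> x; rewrite normrZ -mulrA ler_wpM2l// le_op_norm.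
apply/le_anti; rewrite le/=; have [->|a0] := eqVneq a 0.
  by rewrite normr0 mul0r op_norm_ge0.
rewrite -ler_pdivlMl ?normr_gt0// -normfV.
by rewrite -{1}(scalerK a0 T) le.
Qed.

HB.instance Definition _ := Lmodule_isNormed.Build K (bounded_op X Y)
  ler_op_normD op_normZ op_norm0_eq0.

End bounded_op_norm.

Section bounded_op_comp.
Context (K : numFieldType) (X Y Z : normedModType K).

Lemma op_comp_subproof (S : bounded_op Y Z) (T : bounded_op X Y) :
  S \o T \in @bounded_linear K X Z.
Proof.
rewrite inE; split; first by move=> a u v /=; rewrite !linearP.
have [M M0 SM] := bounded_op_bound S; have [N N0 TN] := bounded_op_bound T.
exists (M * N) => x; rewrite -mulrA (le_trans (SM _))//.
by rewrite ler_wpM2l.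
Qed.

Definition op_comp (S : bounded_op Y Z) (T : bounded_op X Y) :
  bounded_op X Z := BoundedOp (op_comp_subproof S T).

End bounded_op_comp.

Definition dual (R : realType) k (X : normedModType (scalar_field R k)) : Type :=
  bounded_op X (scalar_field R k)^o.

HB.instance Definition _ (R : realType) k (X : normedModType (scalar_field R k)) :=
  NormedModule.copy (dual X) (bounded_op X (scalar_field R k)^o).

Section operators.
Context (R : realType) (k : scalar_kind).
Local Notation K := (scalar_field R k).
Context (X : normedModType K).
Implicit Types (T : bounded_op X X) (A : set (bounded_op X X)).

Lemma adjoint_subproof T :
  (fun y : dual X => op_comp y T : dual X) \in @bounded_linear K (dual X) (dual X).
Proof.
rewrite inE; split; first by move=> a y z; exact: bounded_op_ext.
exists `|T| => y; apply: op_norm_le; first by rewrite mulr_ge0.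
move=> x; rewrite (le_trans (le_op_norm y (T x)))//.
by rewrite (mulrC `|T|) -mulrA ler_wpM2l ?op_norm_ge0// le_op_norm.
Qed.

Definition adjoint T : bounded_op (dual X) (dual X) :=
  BoundedOp (adjoint_subproof T).

Definition compact_op T := precompact (T @` [set x | `|x| <= 1]).

Definition ess_norm T : K :=
  infimum 0 [set `|T + C| | C in [set C | compact_op C]].

Definition subalgebra A :=
  [/\ A 0,
      forall (a : K) S T, A S -> A T -> A (a *: S + T) &
      forall S T, A S -> A T -> A (op_comp S T)].

Lemma compact_op0 : compact_op 0.
Proof.
rewrite /compact_op (_ : _ @` _ = [set 0]).
  rewrite precompact_closed; first exact: compact_set1.
  exact/accessible_closed_set1/hausdorff_accessible/norm_hausdorff.
apply/seteqP; split=> [_ [x _ <-]//|_ ->].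
by exists 0 => //=; rewrite normr0.
Qed.

Lemma ess_normP T :
  infimums [set `|T + C| | C in [set C | compact_op C]] (ess_norm T).
Proof.
apply: scalar_infimumP; last by move=> _ [C _ <-].
by exists `|T + 0|, 0 => //; exact: compact_op0.
Qed.

(* For [K = R[i]] the inequality forces its right-hand side to be real and
   non-negative. *)
Definition resolving A (x : dual (dual X)) (y : dual X) :=
  forall T, A T -> `|x (adjoint T y)| <= ess_norm T * x y.

Definition finite_rank T :=
  exists n (e : 'I_n -> X),
    range T = [set \sum_(i < n) c i *: e i | c in [set: 'I_n -> K]].

Definition matrix_coefs T : {ptws X * dual X -> K} := fun p => p.2 (T p.1).

Definition wot : Type := initial_topology matrix_coefs.

HB.instance Definition _ := Topological.on wot.

End operators.

(* Main.v *)
(** Suppose that A has no resolving functional. For y != 0 in the dual X' of X, let W be the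
closure of the set of the y T with T in A and |T|_e < 1. It is convex, balanced and
stable under the operators of A of essential norm less than 1, so that a functional
which supports W at a point w0, together with w0, would be resolving. By the theorem of
Bishop and Phelps, W is therefore all of X'.

Let S be the ball of radius 1 about some y0 of norm 2. By weak-star compactness there
are T_1, ..., T_n in A of essential norm less than 1 such that every z in S is sent
close to y0 by the adjoint of some T_i. If 1 - T were invertible for every convex
combination T of 0 and the T_i, then the points z = c_0 (1 - T')^-1 y0, where T' is the
adjoint of T, would depend continuously on the coefficients c, which is refuted by the
Knaster-Kuratowski-Mazurkiewicz lemma. (The latter is deduced from a labelling lemma in
the style of Scarf.)

So some T in A with |T|_e < 1 has 1 - T not invertible. Let l >= 1 be the largest real
number such that l - T is not invertible. As m decreases to l, the normalized operators
T (m - T)^-1 lie in A and accumulate, by compactness, at a nonzero Z in A with T Z = l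
Z; since |T|_e < l, the eigenspace of T for l is finite dimensional, and Z has finite
rank. By transitivity of A, the operators of least positive rank in A include an
idempotent P. Over the complex numbers, minimality gives P A P = K P, hence P has rank
one, hence A contains all operators of rank one and is dense in the weak operator
topology. *)

(* The essential norm enters through a splitting: an operator of essential norm below 1 is a strict
   contraction plus a totally bounded operator. The latter turns weak-star closeness into norm
   closeness, makes the normalized resolvents accumulate, and keeps the eigenspace finite
   dimensional.

   The ball about [y0] has radius 1 while [y0] has norm 2, so it avoids 0. This is where the fixed
   point argument ends: the coefficient of the operator 0 must vanish, hence [z = 0], which lies
   outside the ball.

   As [A] may lack the identity, the inverse of [1 - T] is written [1 + Q] with [Q] in [A]. A Riesz
   projection would call for contour integrals; the limit of normalized resolvents along the real
   axis serves both fields, and is why the largest real [l] is taken.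

   Over the reals the minimal corner [P A P] can be a copy of the complex numbers or of the
   quaternions. The argument then stops at the idempotent, whence alternative (b). *)
From HB Require Import structures.
Require Import Defs.
From mathcomp Require Import all_boot all_order all_algebra.
From mathcomp Require Import all_classical reals topology normedtype.
From mathcomp Require Import sequences complex ring lra.
Import Order.TTheory GRing.Theory Num.Theory.
Import numFieldTopology.Exports numFieldNormedType.Exports.
Set Implicit Arguments.
Unset Strict Implicit.
Unset Printing Implicit Defensive.
Local Open Scope classical_set_scope.
Local Open Scope ring_scope.

(** * A combinatorial fixed point lemma *)

Section scarf.
Import mathcomp.boot.fintype mathcomp.boot.finset.
Local Open Scope set_scope.
Local Open Scope nat_scope.
Context (I W : finType) (r : I -> W -> nat) (s : I -> W) (c : W -> I).
Hypothesis r_inj : forall i, injective (r i).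
Hypothesis s_min : forall i w, r i (s i) <= r i w.
Hypothesis s_max : forall i l w, i != l -> w \notin codom s -> r i w < r i (s l).
Hypothesis cs : forall i, c (s i) = i.
Variable v0 : W.
Hypothesis v0P : v0 \notin codom s.
Variable i0 : I.

(** Each [r i] ranks [W]; the slack element [s i] comes lowest in order [i] and above all non-slack
    elements in the other orders. A set fails to be dominant when some [w] exceeds its least element
    in every order at once. Dominant sets play the role of the simplices of a triangulation. *)
Definition dominant (t : {set W}) :=
  [forall w, exists i, [forall a in t, r i w <= r i a]].

Lemma dominantP (t : {set W}) :
  reflect (forall w, exists i, forall a, a \in t -> r i w <= r i a) (dominant t).
Proof.
apply: (iffP forallP) => h w.
  by have /existsP[i /forall_inP hi] := h w; exists i.
by have [i hi] := h w; apply/existsP; exists i; apply/forall_inP.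
Qed.

Lemma dominantS (t u : {set W}) : t \subset u -> dominant u -> dominant t.
Proof.
move=> /subsetP tu /dominantP h; apply/dominantP => w.
by have [i hi] := h w; exists i => a /tu; exact: hi.
Qed.

(** Rooms stand for cells of full dimension, doors for facets that carry all colours but [i0].
    Incidences between them are counted modulo 2. *)
Let room (t : {set W}) := dominant t && (#|t| == #|I|).
Let door (t : {set W}) :=
  [&& dominant t, #|t|.+1 == #|I| & c @: t == [set~ i0]].

Let nexp (t u : {set W}) : door t -> room u -> t \subset u ->
  exists2 x, x \in u & t = u :\ x.
Proof.
move=> /and3P[_ /eqP ct _] /andP[_ /eqP cu] tu.
have [x] : exists x, x \in u :\: t.
  apply/set0Pn; rewrite -card_gt0 cardsD (setIidPr tu) cu -ct.
  by rewrite subSn// subnn.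
rewrite inE => /andP[xt xu]; exists x => //; apply/eqP.
by rewrite eqEcard subsetD1 tu xt /= -ltnS ct -cu (cardsD1 x u) xu.
Qed.

(** If such a room has a door, its colours are all but [i0] and exactly one occurs twice; removing
    either element of that colour gives its two doors. *)
Let roomD u : room u -> c @: u != [set: I] ->
  2 %| #|[set t | door t & t \subset u]|.
Proof.
move=> ru cu.
have [->|[t]] := set_0Vmem [set t | door t & t \subset u].
  by rewrite cards0.
rewrite inE => /andP[dt tu]; have [x xu tE] := nexp dt ru tu.
have /and3P[domt /eqP ct /eqP cit] := dt.
have cinj : {in t &, injective c}.
  apply/imset_injP; rewrite cit cardsC1 -ct /=.
  by [].
have cx0 : c x != i0.
  apply: contraNneq cu => cx0; apply/eqP/setP => i; rewrite inE.
  have [->|ii0] := eqVneq i i0; first by rewrite -cx0 imset_f.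
  have : i \in c @: t by rewrite cit !inE.
  by move=> /imsetP[y yt ->]; rewrite imset_f// (subsetP tu).
have : c x \in c @: t by rewrite cit !inE.
move=> /imsetP[y yt cxy].
have yu : y \in u by rewrite (subsetP tu).
have yx : y != x by move: yt; rewrite tE !inE => /andP[].
suff -> : [set t | door t & t \subset u] = [set t; u :\ y].
  rewrite cards2 (_ : t != _)//; apply: contraTneq yt => ->.
  by rewrite !inE eqxx.
have cuE : c @: u = c @: t.
  rewrite -(setD1K xu) -tE imsetU1; apply/setUidPr.
  by rewrite sub1set cxy imset_f.
apply/setP => t'; rewrite !inE; apply/andP/orP.
  case=> dt' tu'; have [z zu tE'] := nexp dt' ru tu'.
  have [zx|zx] := eqVneq z x; first by left; rewrite tE tE' zx.
  right; suff <- : z = y by rewrite tE'.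
  have zt : z \in t by rewrite tE !inE zx.
  have : c z \in c @: t'.
    have /and3P[_ _ /eqP ->] := dt'.
    by rewrite -cit imset_f.
  move=> /imsetP[z' z't' czz'].
  have zz' : z != z'.
    by apply: contraTneq z't' => <-; rewrite tE' !inE eqxx.
  have [z'x|z'x] := eqVneq z' x.
    by apply: cinj => //; rewrite czz' z'x cxy.
  have z't : z' \in t.
    by rewrite tE !inE z'x /=; move: z't'; rewrite tE' !inE => /andP[].
  by rewrite (cinj _ _ zt z't czz') eqxx in zz'.
case=> /eqP -> //; split; last exact: subD1set.
apply/and3P; split.
- by apply: dominantS (subD1set _ _) _; case/andP: ru.
- have /andP[_ /eqP <-] := ru.
  by rewrite (cardsD1 y u) yu.
- rewrite -cit -cuE eqEsubset imsetS ?subD1set//=.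
  apply/subsetP => _ /imsetP[z zu ->].
  have [->|zy] := eqVneq z y.
    by rewrite -cxy imset_f// !inE xu eq_sym yx.
  by rewrite imset_f// !inE zy.
Qed.

(** The only boundary door: the facet of slack elements opposite to [s i0]. *)
Let ideal := [set s l | l in [set~ i0]].

Let s_inj : injective s.
Proof. exact: can_inj cs. Qed.

Let idealP l : (s l \in ideal) = (l != i0).
Proof.
apply/imsetP/idP => [[k]|li0]; last by exists l; rewrite ?inE.
by rewrite !inE => + /s_inj ->.
Qed.

Let s_lt i w : w != s i -> r i (s i) < r i w.
Proof.
move=> ws; rewrite ltn_neqAle s_min andbT.
by apply: contra_neq ws => /r_inj.
Qed.

Let ideal_door : door ideal.
Proof.
apply/and3P; split.
- apply/dominantP => w; have [/codomP[l ->]|ws] := boolP (w \in codom s).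
    by exists l => a _; exact: s_min.
  exists i0 => _ /imsetP[l + ->]; rewrite !inE => li0.
  by rewrite ltnW// s_max// eq_sym.
- rewrite card_imset// cardsC1 prednK//.
  by apply/card_gt0P; exists i0.
- apply/eqP/setP => i; rewrite !inE; apply/imsetP/idP.
    by move=> [_ /imsetP[l + ->] ->]; rewrite !inE cs.
  by move=> ii0; exists (s i); rewrite ?cs// idealP.
Qed.

Let doorE t : door t -> t \subset codom s -> t = ideal.
Proof.
move=> /and3P[_ _ /eqP ct] ts; apply/eqP; rewrite eqEsubset; apply/andP.
split; apply/subsetP => x.
  move=> xt; have /codomP[l xl] := subsetP ts _ xt.
  rewrite xl idealP.
  have : c x \in c @: t by rewrite imset_f.
  by rewrite ct xl cs !inE.
move=> /imsetP[l + ->]; rewrite -ct => /imsetP[y yt ->].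
by have /codomP[m ym] := subsetP ts _ yt; rewrite ym cs -ym.
Qed.

Let room_ideal x : x \notin ideal ->
  room (x |: ideal) -> forall w, w \notin ideal -> r i0 w <= r i0 x.
Proof.
move=> xi /andP[/dominantP dx _] w wi.
have [i hi] := dx w; have [<-|ii0] := eqVneq i i0.
  by apply: hi; rewrite !inE eqxx.
have := hi (s i); rewrite !inE idealP ii0 orbT => /(_ erefl).
rewrite leqNgt s_lt//; apply: contraNneq wi => ->.
by rewrite idealP.
Qed.

Let v0i : v0 \notin ideal.
Proof. by apply: contra v0P => /imsetP[l _ ->]; exact: codom_f. Qed.

(** In every order [i] other than [i0] the slack [s i] is already lowest, so only the highest
    element for [r i0] outside [ideal] can complete it. *)
Let rooms_ideal : #|[set u | room u & ideal \subset u]| = 1.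
Proof.
have [x xi xmax] : exists2 x, x \notin ideal &
    forall w, w \notin ideal -> r i0 w <= r i0 x.
  by case: (@arg_maxnP _ v0 [pred w | w \notin ideal] (r i0) v0i) => x xi xm; exists x.
have xs : x \notin codom s.
  apply/negP => /codomP[l xl]; move: xi; rewrite xl idealP negbK => /eqP li.
  have := xmax _ v0i; rewrite xl li leqNgt s_lt//.
  by apply: contraNneq v0P => ->; exact: codom_f.
apply/eqP/cards1P; exists (x |: ideal); apply/setP => u; rewrite !inE.
apply/andP/eqP => [[ru iu]|->].
  have [y yu iE] := nexp ideal_door ru iu.
  have yi : y \notin ideal by rewrite iE !inE eqxx.
  have uE : u = y |: ideal by rewrite iE setD1K.
  rewrite uE; congr (_ |: _); apply: (@r_inj i0); apply/eqP.
  by rewrite eqn_leq xmax//= room_ideal// -uE.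
split; last exact: subsetUr.
apply/andP; split; last first.
  rewrite cardsU1 xi add1n; by case/and3P: ideal_door.
apply/dominantP => w; have [|wi] := boolP (w \in ideal).
  by move=> /imsetP[l _ ->]; exists l => a _; exact: s_min.
exists i0 => a; rewrite !inE => /orP[/eqP ->|]; first exact: xmax.
move=> /imsetP[l + ->]; rewrite !inE => li0.
apply: leq_trans (xmax _ wi) _; rewrite ltnW// s_max// eq_sym//.
Qed.

Section generic_door.
Variables (t : {set W}) (u0 : W).
Hypotheses (dt : door t) (u0t : u0 \in t) (u0s : u0 \notin codom s).

Let dom : dominant t. Proof. by case/and3P: dt. Qed.
Let card : #|t|.+1 = #|I|. Proof. by case/and3P: dt => _ /eqP. Qed.

Let mi i : W := [arg min_(a < u0 in t) r i a].

Let miP i : mi i \in t /\ forall a, a \in t -> r i (mi i) <= r i a.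
Proof. by rewrite /mi; case: arg_minnP. Qed.

Let mit i : mi i \in t. Proof. exact: (miP i).1. Qed.
Let mile i a : a \in t -> r i (mi i) <= r i a. Proof. exact: (miP i).2. Qed.

Let mi_surj a : a \in t -> exists i, a = mi i.
Proof.
move=> ta; have /dominantP/(_ a)[i hi] := dom; exists i.
by apply: (@r_inj i); apply/eqP; rewrite eqn_leq mile// hi.
Qed.

Let up i : {set W} := [set w | [forall (l | l != i), r l (mi l) < r l w]].

Let upP i w : reflect (forall l, l != i -> r l (mi l) < r l w) (w \in up i).
Proof. by rewrite inE; exact: forall_inP. Qed.

(** An element joining [t] as the new minimum in order [i] has to exceed the old minima in the other
    orders; [top i] is the only candidate. The default [s i] lies in [up i] because of the non-slack
    [u0] in [t]. *)
Let top i : W := [arg max_(w > s i in up i) r i w].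

Let topP i : top i \in up i /\ forall w, w \in up i -> r i w <= r i (top i).
Proof.
rewrite /top; case: arg_maxnP => //; apply/upP => l li.
by apply: (leq_ltn_trans (mile l u0t)); exact: s_max.
Qed.

Let up_le i w : w \in up i -> forall a, a \in t -> r i w <= r i a.
Proof.
move=> /upP wi a at_; have /dominantP/(_ w)[l hl] := dom.
have [<-|li] := eqVneq l i; first exact: hl.
by have := wi _ li; rewrite ltnNge hl.
Qed.

Let dbl : exists j k, [/\ j != k, mi j = mi k &
  forall i, (exists2 b, b \in t & forall l, l != i -> mi l != b) \/
    (i = j \/ i = k) ].
Proof.
have : ~~ injectiveb mi.
  apply/negP => /injectiveP /card_imset - /(_ predT).
  have : mi @: predT \subset t by apply/subsetP => _ /imsetP[i _ ->].
  by move=> /subset_leq_card + e; rewrite e -card ltnn.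
move=> /injectivePn[j [k jk mijk]]; exists j, k; split => // i.
have [->|ij] := eqVneq i j; first by right; left.
have [->|ik] := eqVneq i k; first by right; right.
left; exists (mi i) => // l li; apply/eqP => mil.
have : mi @: (~: [set i; j]) = t.
  apply/eqP; rewrite eqEsubset; apply/andP; split; apply/subsetP => b.
    by move=> /imsetP[m _ ->].
  move=> /mi_surj[m ->].
  have [->|mi'] := eqVneq m i.
    have [lj|lj] := eqVneq l j.
      by rewrite -mil lj mijk imset_f// !inE negb_or eq_sym ik eq_sym jk.
    by rewrite -mil imset_f// !inE negb_or li lj.
  have [->|mj] := eqVneq m j.
    by rewrite mijk imset_f// !inE negb_or eq_sym ik eq_sym jk.
  by rewrite imset_f// !inE negb_or mi' mj.
move=> /(congr1 (fun A : {set W} => #|A|)).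
have := leq_imset_card mi (~: [set i; j]).
rewrite [#|~: _|]cardsCs setCK cards2 ij -card subSS => /[swap] ->.
have : 0 < #|t| by apply/card_gt0P; exists u0.
by case: #|t| => // n _; rewrite subSS subn0 ltnn.
Qed.

(** Order [l] keeps the common minimum, which frees order [i] for the new element. *)
Let top_room i l : i != l -> mi i = mi l -> top i \notin t /\ room (top i |: t).
Proof.
move=> il mil; have [tu tm] := topP i.
have tt : top i \notin t.
  apply/negP => /mi_surj[m e].
  have [m' m'i e'] : exists2 m', m' != i & top i = mi m'.
    have [mi'|] := eqVneq m i; last by exists m.
    by exists l; rewrite 1?eq_sym// e mi'.
  by have /upP/(_ _ m'i) := tu; rewrite e' ltnn.
split=> //; apply/andP; split; last by rewrite cardsU1 tt add1n card.
apply/dominantP => w; have [wu|/upP wu] := boolP (w \in up i).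
  exists i => a; rewrite !inE => /orP[/eqP ->|]; first exact: tm.
  exact: up_le.
have [m /andP[mi' hm]] : exists m, (m != i) && (r m w <= r m (mi m)).
  apply/existsP; apply: contra_notT wu; rewrite negb_exists => /forallP h m mi'.
  by have := h m; rewrite mi' /= -ltnNge.
exists m => a; rewrite !inE => /orP[/eqP ->|at_].
  by apply: leq_trans hm _; apply: ltnW; move/upP: tu; apply.
exact: leq_trans hm (mile _ at_).
Qed.

Let room_top x : x \notin t -> room (x |: t) ->
  exists2 i, x = top i & forall b, b \in t -> exists2 l, l != i & mi l = b.
Proof.
move=> xt /andP[/dominantP dx _].
have [i hi] := dx x.
have hl l : l != i -> r l (mi l) < r l x.
  move=> li; rewrite ltnNge; apply/negP => xl.
  have : t \subset mi @: (~: [set i; l]).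
    apply/subsetP => b bt; have [m hm] := dx b.
    have bm : b = mi m.
      apply: (@r_inj m); apply/eqP; rewrite eqn_leq mile// hm//.
      by rewrite !inE mit orbT.
    rewrite bm imset_f// !inE; apply/negP => /orP[]/eqP ml.
      have := hi b; rewrite !inE bt orbT => /(_ erefl).
      have := hm x; rewrite !inE eqxx => /(_ erefl); rewrite ml => h1 h2.
      have e : x = b by apply: (@r_inj i); apply/eqP; rewrite eqn_leq h1 h2.
      by rewrite e bt in xt.
    have := hm x; rewrite !inE eqxx => /(_ erefl); rewrite ml => h1.
    have e : x = b.
      apply: (@r_inj l); apply/eqP; rewrite eqn_leq h1 andbT.
      by rewrite bm ml.
    by rewrite e bt in xt.
  move=> /subset_leq_card /leq_trans /(_ (leq_imset_card _ _)).
  rewrite [#|~: _|]cardsCs setCK cards2 eq_sym li -card subSS.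
  have : 0 < #|t| by apply/card_gt0P; exists u0.
  by case: #|t| => // n _; rewrite subSS subn0 ltnn.
have xup : x \in up i by apply/upP.
exists i.
  have [tu tm] := topP i; apply: (@r_inj i); apply/eqP; rewrite eqn_leq tm//=.
  have [m hm] := dx (top i).
  have [e|mi'] := eqVneq m i.
    by rewrite e in hm; apply: hm; rewrite !inE eqxx.
  have := hm (mi m); rewrite !inE mit orbT => /(_ erefl).
  by rewrite leqNgt; move/upP: tu => ->.
move=> b bt; have [m hm] := dx b.
have bm : b = mi m.
  apply: (@r_inj m); apply/eqP; rewrite eqn_leq mile// hm//.
  by rewrite !inE mit orbT.
exists m => //; apply/eqP => mi'.
have := hm x; rewrite !inE eqxx mi' => /(_ erefl).
have := hi b; rewrite !inE bt orbT => /(_ erefl) h1 h2.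
have e : x = b by apply: (@r_inj i); apply/eqP; rewrite eqn_leq h1 h2.
by rewrite e bt in xt.
Qed.

(** Either of the two orders that share a minimum may give it up, and no other order can. *)
Lemma rooms_door : #|[set u | room u & t \subset u]| = 2.
Proof.
have [j [k [jk mijk hjk]]] := dbl.
have [tj rj] := top_room jk mijk.
have kj : k != j by rewrite eq_sym.
have [tk rk] := top_room kj (esym mijk).
have topjk : top j != top k.
  apply/eqP => e; have /dominantP/(_ (top j))[i hi] := dom.
  have := hi _ (mit i); rewrite leqNgt; apply/negP; rewrite negbK.
  have [ij|ij] := eqVneq i j.
    by rewrite e; apply: (upP _ _ (topP k).1); rewrite ij.
  exact: (upP _ _ (topP j).1).
have tsub x y : x \notin t -> x |: t = y |: t -> x = y.
  move=> xt e; have : x \in y |: t by rewrite -e setU11.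
  by rewrite !inE (negbTE xt) orbF => /eqP.
suff -> : [set u | room u & t \subset u] = [set top j |: t; top k |: t].
  by rewrite cards2; case: eqVneq => // /(tsub _ _ tj)/eqP; rewrite (negbTE topjk).
apply/setP => u; rewrite !inE; apply/andP/orP.
  case=> ru tu; have [x xu tE] := nexp dt ru tu.
  have xt : x \notin t by rewrite tE !inE eqxx.
  have uE : u = x |: t by rewrite tE setD1K.
  rewrite uE in ru *; have [i -> hi] := room_top xt ru.
  case: (hjk i) => [[b bt hb]|[]->]; [|by left|by right].
  by have [l li lb] := hi b bt; have := hb l li; rewrite lb eqxx.
by case=> /eqP ->; rewrite subsetUr.
Qed.
End generic_door.

(** Were no room fully coloured, each would have an even number of doors; but [ideal] lies in one
    room and every other door in two. *)
Lemma colourful_dominant_set :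
  exists2 u, dominant u & c @: u = [set: I].
Proof.
apply: contrapT => nex.
have nc u : room u -> c @: u != [set: I].
  by move=> /andP[du _]; apply/eqP => e; apply: nex; exists u.
have e : \sum_(t | door t) #|[set u | room u & t \subset u]| =
         \sum_(u | room u) #|[set t | door t & t \subset u]|.
  have cE (P Q : pred {set W}) : #|[set u | P u & Q u]| = \sum_(u | P u) Q u.
    by rewrite -sum1dep_card big_mkcondr /=; apply: eq_bigr => u _; case: (Q u).
  under eq_bigr do rewrite cE.
  by rewrite exchange_big /=; apply: eq_bigr => u _; rewrite cE.
have : 2 %| \sum_(t | door t) #|[set u | room u & t \subset u]|.
  by rewrite e; apply: dvdn_sum => u ru; exact: roomD (nc _ ru).
rewrite (bigD1 ideal)//= rooms_ideal dvdn_addl//.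
apply: dvdn_sum => t /andP[dt ti].
suff [u0 u0t u0s] : exists2 u, u \in t & u \notin codom s.
  by rewrite (rooms_door dt u0t u0s).
apply: contrapT => h; move/eqP: ti; apply; apply: doorE => //.
apply/subsetP => x xt; apply: contra_notT h => xs; by exists x.
Qed.
End scarf.

(** * Labellings of the grid points of a simplex *)

Section grid_labelling.
Import mathcomp.boot.fintype mathcomp.boot.finset.
Local Open Scope set_scope.
Local Open Scope nat_scope.
Context (I : finType) (i0 : I) (N : nat).

Let grid := {x : {ffun I -> 'I_N.+1} | \sum_i x i == N}.
Let crd (x : grid) (i : I) : nat := val x i.

Let crd_sum x : \sum_i crd x i = N. Proof. exact/eqP/(valP x). Qed.

Let mk_grid (f : I -> nat) : \sum_i f i = N -> exists x, forall i, crd x i = f i.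
Proof.
move=> fN.
have fle i : f i < N.+1 by rewrite ltnS -fN (bigD1 i)//= leq_addr.
have h : \sum_i [ffun i => Ordinal (fle i)] i == N.
  by rewrite -[X in _ == X]fN; apply/eqP/eq_bigr => i _; rewrite ffunE.
by exists (Sub [ffun i => Ordinal (fle i)] h : grid) => i; rewrite /crd /= ffunE.
Qed.

Let W := (grid + I)%type.
Let M := #|{: grid}|.
(** Order [i] compares coordinate [i]. The factor [M] lets [enum_rank] break ties, the successor
    reserves rank 0 for the slack [inr i], and the other slacks come after all grid points. *)
Let rk i (w : W) : nat := match w with
  | inl x => (crd x i * M + enum_rank x).+1
  | inr l => if l == i then 0 else (N.+1 * M).+1 + enum_rank l
  end.

Let crd_le x i : crd x i <= N. Proof. by rewrite -ltnS ltn_ord. Qed.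

Let rk_grid x i : rk i (inl x) < (N.+1 * M).+1.
Proof.
rewrite /= ltnS mulSn addnC -addSn.
by rewrite leq_add ?ltn_ord// leq_mul2r crd_le orbT.
Qed.

Let rk_inj i : injective (rk i).
Proof.
have H x l : rk i (inl x) != rk i (inr l).
  rewrite neq_ltn /=; case: eqVneq => [_|_]; first by rewrite orbT.
  by rewrite (leq_trans (rk_grid x i))// leq_addr.
move=> [x|l] [y|m].
- move=> /= [/(congr1 (modn^~ M))]; rewrite !modnMDl !modn_small ?ltn_ord//.
  by move=> /val_inj/enum_rank_inj ->.
- by move/eqP; rewrite (negbTE (H _ _)).
- by move/esym/eqP; rewrite (negbTE (H _ _)).
- rewrite /=; case: eqVneq => [->|_]; case: eqVneq => [->|_] //.
  by move=> /addnI/val_inj/enum_rank_inj ->.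
Qed.

(** [C] collects the colours whose slack is absent from a colourful dominant set. Dominance forces
    the least coordinates of its grid points, summed over [C], to exceed [N - #|I|]; since each
    point has total [N], the points agree up to [#|I|]. *)
Lemma grid_labelling (label : (I -> nat) -> I) :
  exists (C : {set I}) (p : I -> I -> nat), C != set0 /\
    forall i, i \in C ->
      [/\ \sum_k p i k = N, label (p i) = i,
          (forall j k, j \in C -> p i k <= p j k + #|I|) &
          forall k, k \notin C -> p i k <= #|I|].
Proof.
pose c (w : W) := match w with inl x => label (crd x) | inr i => i end.
have [v00 _] : exists x, forall i, crd x i = (if i == i0 then N else 0).
  by apply: mk_grid; rewrite -big_mkcond /= big_pred1_eq.
have inr_codom x : (inl x : W) \notin codom inr by apply/negP => /codomP[].
have [||||u /dominantP du cu] :=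
    @colourful_dominant_set I W rk inr c rk_inj _ _ _ (inl v00) _ i0.
- by move=> i w /=; rewrite eqxx.
- move=> i l [x|m] il; last by rewrite codom_f.
  by move=> _; apply: leq_trans (rk_grid _ _) _; rewrite /= eq_sym (negbTE il) leq_addr.
- by [].
- exact: inr_codom.
pose C := [set i | inr i \notin u].
(* If [inr i] were in [u], its rank 0 in order [i] would be below that of [x]. *)
have domC x : exists2 i, i \in C & forall a, a \in u -> rk i (inl x) <= rk i a.
  have [i hi] := du (inl x); exists i => //; rewrite inE; apply/negP => /hi.
  by rewrite /= eqxx.
have xP i : i \in C -> exists x, inl x \in u /\ label (crd x) = i.
  rewrite inE => iu; have : i \in c @: u by rewrite cu inE.
  move=> /imsetP[[x|l] lu e]; first by exists x.
  by move: iu; rewrite e /= lu.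
have [iC iCC] : exists i, i \in C by have [i iC _] := domC v00; exists i.
have [x0 [x0u _]] := xP _ iCC.
pose mn k := crd [arg min_(x < x0 | inl x \in u) crd x k] k.
have mnP k : (exists2 x, inl x \in u & mn k = crd x k) /\
    forall x, inl x \in u -> mn k <= crd x k.
  rewrite /mn; case: arg_minnP => // x xu xm; split=> //; by exists x.
(* Otherwise raising every least coordinate on [C] by one, with the remainder put on [iC], gives a
   grid point that contradicts dominance. *)
have big : N < \sum_(k in C) mn k + #|I|.
  rewrite ltnNge; apply/negP => le.
  have le' : \sum_(k in C) (mn k).+1 <= N.
    under eq_bigr do rewrite -addn1.
    rewrite big_split /= sum1_card.
    by apply: leq_trans le; apply: leq_add => //; exact: max_card.
  pose rest := N - \sum_(k in C) (mn k).+1.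
  have [v vE] : exists v, forall k, crd v k =
      (if k \in C then (mn k).+1 else 0) + (if k == iC then rest else 0).
    apply: mk_grid; rewrite big_split /= -!big_mkcond /= big_pred1_eq.
    by rewrite subnKC.
  have [i iC' /=] := domC v.
  have [[x xu mnx] _] := mnP i.
  move=> /(_ _ xu) /=; rewrite ltnS leqNgt => /negP; apply.
  rewrite vE iC' mnx mulnDl mulSn -!addnA addnCA ltn_add2l.
  by rewrite ltn_addr// ltn_ord.
have up x k : inl x \in u -> crd x k <= (if k \in C then mn k else 0) + #|I|.
  move=> xu; rewrite -(leq_add2r (\sum_(j in C | j != k) mn j)).
  have lhs : crd x k + \sum_(j in C | j != k) mn j <= N.
    rewrite -[leqRHS](crd_sum x) [leqRHS](bigD1 k)//= leq_add2l big_mkcondl /=.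
    by apply: leq_sum => j _; case: ifP => // _; exact: (mnP j).2.
  apply: leq_trans lhs _; apply: ltnW; apply: leq_trans big _.
  case: ifPn => kC; first by rewrite (bigD1 k)//= addnAC.
  rewrite add0n addnC leq_add2l; apply: eq_leq; apply: eq_bigl => j.
  by case: eqVneq => [->|]; rewrite ?andbT ?(negbTE kC).
pose p i := crd (odflt x0 [pick x | (inl x \in u) && (label (crd x) == i)]).
have pP i : i \in C -> exists x, [/\ inl x \in u, label (crd x) = i & p i = crd x].
  move=> /xP[x [xu lx]]; rewrite /p; case: pickP => [y /andP[yu /eqP ly]|/(_ x)].
    by exists y.
  by rewrite xu lx eqxx.
exists C, p; split; first by apply/set0Pn; exists iC.
move=> i /pP[x [xu lx ->]]; split=> //.
- move=> j k /pP[y [yu ly ->]]; apply: leq_trans (up _ k xu) _.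
  by rewrite leq_add2r; case: ifP => // _; exact: (mnP k).2.
- by move=> k kC; have := up _ k xu; rewrite (negbTE kC).
Qed.

End grid_labelling.

(** * The dual KKM lemma *)

Lemma ultraI (T : Type) (U : set_system T) (A B : set T) :
  UltraFilter U -> U A -> U B -> U (A `&` B).
Proof. by move=> UU; exact: filterI. Qed.

Lemma ultraS (T : Type) (U : set_system T) (A B : set T) :
  UltraFilter U -> A `<=` B -> U A -> U B.
Proof. by move=> UU; exact: filterS. Qed.

Lemma ultra_ex (T : Type) (U : set_system T) (A : set T) :
  UltraFilter U -> U A -> exists t, A t.
Proof. by move=> UU; exact: filter_ex. Qed.

Lemma ultra_forall (T : Type) (U : set_system T) (I : finType) (f : I -> set T) :
  UltraFilter U -> (forall i, U (f i)) -> U [set x | forall i, f i x].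
Proof. by move=> UU h; exact: filter_forall. Qed.

Lemma ultra_finite (T : Type) (U : set_system T) (I : finType) (h : T -> I) :
  UltraFilter U -> exists i, U [set t | h t = i].
Proof.
move=> UU; apply: contrapT => nU.
have /filter_forall/filter_ex[t] : forall i, U (~` [set t | h t = i]).
  move=> i; have [Ui|//] := in_ultra_setVsetC [set t | h t = i] UU.
  by exfalso; apply: nU; exists i.
by move=> /(_ (h t)); apply.
Qed.

Lemma ultra_lim (R : realType) (T : Type) (U : set_system T) (f : T -> R) (M : R) :
  UltraFilter U -> U [set t | `|f t| <= M] ->
  exists l, forall e, 0 < e -> U [set t | `|f t - l| < e].
Proof.
move=> UU UM.
have FU : UltraFilter (f @ U).
  split; first by apply: fmap_proper_filter.
  move=> G PG sG; apply/seteqP; split => [A GA|]; last exact: sG.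
  have [//|UnA] := in_ultra_setVsetC (f @^-1` A) UU.
  have : G (A `&` ~` A) by apply: filterI => //; apply: sG.
  by rewrite setICr => /filter_not_empty.
have := @segment_compact R (- M) M; rewrite compact_ultra => /(_ _ FU)[].
  by rewrite /fmap/=; apply: filterS UM => t /=; rewrite in_itv /= ler_norml.
move=> l [_ fl]; exists l => e e0.
by move/cvgr_distC_lt : fl => /(_ _ e0).
Qed.

(** A free ultrafilter replaces the extraction of subsequences. *)
Lemma ultra_nat : exists U : set_system nat,
  UltraFilter U /\ forall n, U [set m | (n <= m)%N].
Proof.
have [U [UU sU]] := ultraFilterLemma eventually_filter.
by exists U; split => // n; apply: sU; exists n.
Qed.

Lemma norm_small0 (R : realType) (x : R) :
  (forall e : R, 0 < e -> `|x| <= e) -> x = 0.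
Proof.
move=> h; apply/eqP; rewrite -normr_le0; apply/ler_addgt0Pl => e e0.
by rewrite addr0 h.
Qed.

Section dual_kkm.
Context (R : realType) (I : finType).

Definition simplex (c : I -> R) := (forall i, 0 <= c i) /\ \sum_i c i = 1.

(** Points off the simplex are ignored: the functions to which this is applied involve
    quasi-inverses that take a default value there. *)
Definition simplex_continuous (f : (I -> R) -> R) :=
  forall c, simplex c -> forall e : R, 0 < e -> exists2 d : R, 0 < d &
    forall c', simplex c' -> (forall j, `|c' j - c j| < d) -> `|f c' - f c| < e.

(* The closed sets are the [0 <= g i]; by the hypothesis on [c i = 0], each of them
   contains the face opposite to the vertex [i]. *)
Lemma dual_kkm (i0 : I) (g : I -> (I -> R) -> R) :
  (forall i, simplex_continuous (g i)) ->
  (forall c, simplex c -> exists i, 0 <= g i c) ->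
  (forall c i, simplex c -> c i = 0 -> 0 <= g i c) ->
  exists2 c, simplex c & forall i, 0 <= g i c.
Proof.
move=> gcont gcov gface.
pose pt N (x : I -> nat) i : R := (x i)%:R / N.+1%:R.
have ptS N x : (\sum_k x k)%N = N.+1 -> simplex (pt N x).
  move=> xN; split=> [i|]; first by rewrite divr_ge0.
  by rewrite -mulr_suml -natr_sum xN divff ?pnatr_eq0.
pose label N (x : I -> nat) := xget i0 [set i | 0 <= g i (pt N x)].
have labelP N x : simplex (pt N x) -> 0 <= g (label N x) (pt N x).
  by move=> /gcov[i gi]; rewrite /label; case: xgetP => [//|/(_ i)].
have /choice[Cp CpP] : forall N, exists Cp : {set I} * (I -> I -> nat),
    Cp.1 != finset.set0 /\ forall i, i \in Cp.1 ->
      [/\ (\sum_k Cp.2 i k)%N = N.+1, label N (Cp.2 i) = i,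
          (forall j k, j \in Cp.1 -> Cp.2 i k <= Cp.2 j k + #|I|)%N &
          forall k, k \notin Cp.1 -> (Cp.2 i k <= #|I|)%N].
  by move=> N; have [C [p Cp]] := grid_labelling i0 N.+1 (label N); exists (C, p).
(* Along a free ultrafilter the grids get finer and the colour set is a constant [C]; the points
   attached to the colours of [C] then share one limit [c]. *)
have [U [UU Unat]] := ultra_nat.
have [C UC] := ultra_finite (fun N => (Cp N).1) UU.
have [i1 i1C] : exists i, i \in C.
  by have [N /= <-] := ultra_ex UU UC; have [/set0Pn] := CpP N.
have /choice[c cP] : forall k, exists l : R, forall e, 0 < e ->
    U [set N | `|pt N ((Cp N).2 i1) k - l| < e].
  move=> k; apply: (@ultra_lim _ _ _ _ 1) => //.
  apply: (ultraS UU _ UC) => N /= NC; have [_] := CpP N => /(_ i1).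
  rewrite NC => /(_ i1C)[s _ _ _]; rewrite ger0_norm ?divr_ge0//.
  rewrite ler_pdivrMr// mul1r ler_nat -s (bigD1 k)//= leq_addr//.
have inv_small (e : R) : 0 < e -> U [set N | #|I|%:R / N.+1%:R < e :> R].
  move=> e0; have F1 := Unat (Num.truncn (#|I|%:R / e)); apply: (ultraS UU _ F1) => N /= hN.
  rewrite ltr_pdivrMr// mulrC -ltr_pdivrMr//.
  by apply: lt_le_trans (truncnS_gt _) _; rewrite ler_nat ltnS.
have cP' i : i \in C -> forall e : R, 0 < e ->
    U [set N | forall k, `|pt N ((Cp N).2 i) k - c k| < e].
  move=> iC e e0.
  apply: (@ultra_forall _ _ _ (fun k => [set N | `|pt N ((Cp N).2 i) k - c k| < e]) UU) => k.
  have e20 : 0 < e / 2 by rewrite divr_gt0.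
  have F1 := ultraI UU (inv_small _ e20) (ultraI UU UC (cP k _ e20)).
  apply: (ultraS UU _ F1) => N [/= hN [NC hc]].
  have [_] := CpP N; rewrite NC => h.
  have [_ _ /(_ i1 k i1C) h1 _] := h _ iC; have [_ _ /(_ i k iC) h2 _] := h _ i1C.
  have : `|pt N ((Cp N).2 i) k - pt N ((Cp N).2 i1) k| <= #|I|%:R / N.+1%:R.
    rewrite -mulrBl normrM [X in _ * X]ger0_norm ?invr_ge0//.
    rewrite ler_wpM2r ?invr_ge0//.
    move: h1 h2; rewrite -!(ler_nat R) !natrD => h1 h2.
    by rewrite ler_norml; apply/andP; split; lra.
  move=> h3; apply: le_lt_trans (ler_distD (pt N ((Cp N).2 i1) k) _ _) _.
  rewrite [e]splitr; apply: ltrD hc; exact: le_lt_trans h3 hN.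
have cS : simplex c.
  split=> [i|].
    rewrite leNgt; apply/negP => ci; have nci : 0 < - c i by rewrite oppr_gt0.
    have [N /=] := ultra_ex UU (cP i _ nci).
    have : 0 <= pt N ((Cp N).2 i1) i by rewrite divr_ge0.
    by move=> h; rewrite ltr_distlC => /andP[]; lra.
  apply/eqP; rewrite -subr_eq0; apply/eqP/norm_small0 => e e0.
  have e10 : 0 < e / #|I|.+1%:R by rewrite divr_gt0.
  have [N [/= NC hN]] := ultra_ex UU (ultraI UU UC (cP' _ i1C _ e10)).
  have [_] := CpP N; rewrite NC => /(_ _ i1C)[/ptS[_ <-] _ _ _].
  rewrite -sumrB; apply: le_trans (ler_norm_sum _ _ _) _.
  apply: (@le_trans _ _ (\sum_(i : I) e / #|I|.+1%:R)).
    by apply: ler_sum => i _; rewrite distrC ltW.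
  rewrite sumr_const -[leLHS]mulr_natr -mulrA ler_piMr ?(ltW e0)//.
  by rewrite mulrC ler_pdivrMr// mul1r ler_nat.
(* On [C] the sign at the points labelled [i] passes to the limit. Off [C] the coordinate [c i] is 0
   and the face hypothesis applies. *)
exists c => // i; have [iC|iC] := boolP (i \in C).
  rewrite leNgt; apply/negP => gi.
  have ngi : 0 < - g i c by rewrite oppr_gt0.
  have [d d0 hd] := gcont i c cS _ ngi.
  have [N [/= NC hN]] := ultra_ex UU (ultraI UU UC (cP' _ iC _ d0)).
  have [_] := CpP N; rewrite NC => /(_ _ iC)[/ptS s lab _ _].
  have := hd _ s hN; have := labelP _ _ s; rewrite lab ltr_norml => h /andP[_].
  by lra.
apply: gface => //; apply/norm_small0 => e e0.
have e20 : 0 < e / 2 by rewrite divr_gt0.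
have [N [/= hN [NC hc]]] :=
  ultra_ex UU (ultraI UU (inv_small _ e20) (ultraI UU UC (cP i _ e20))).
have [_] := CpP N; rewrite NC => /(_ _ i1C)[_ _ _ /(_ _ iC) h].
have : pt N ((Cp N).2 i1) i <= #|I|%:R / N.+1%:R.
  by rewrite ler_pM2r ?invr_gt0// ler_nat.
have : 0 <= pt N ((Cp N).2 i1) i by rewrite divr_ge0.
move: hc; rewrite ltr_distl => /andP[h1 h2] h3 h4.
have h5 := le_lt_trans h4 hN.
by rewrite ler_norml; apply/andP; split; lra.
Qed.

End dual_kkm.

(** * Real parts and real-valued norms *)

Section scalars.
Context {R : realType} {k : scalar_kind}.
Local Notation K := (scalar_field R k).

Definition rc (r : R) : K :=
  match k return scalar_field R k with
  | real_scalars => r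
  | complex_scalars => r%:C%C
  end.

Definition re : K -> R :=
  match k return scalar_field R k -> R with
  | real_scalars => id
  | complex_scalars => fun z => complex.Re z
  end.

Lemma rcD r s : rc (r + s) = rc r + rc s.
Proof. by rewrite /rc; case: k => //=; rewrite rmorphD. Qed.

Lemma rcM r s : rc (r * s) = rc r * rc s.
Proof. by rewrite /rc; case: k => //=; rewrite rmorphM. Qed.

Lemma rcN r : rc (- r) = - rc r.
Proof. by rewrite /rc; case: k => //=; rewrite rmorphN. Qed.

Lemma rc0 : rc 0 = 0. Proof. by rewrite /rc; case: k. Qed.

Lemma rc1 : rc 1 = 1. Proof. by rewrite /rc; case: k. Qed.

Lemma rcV r : rc r^-1 = (rc r)^-1.
Proof. by rewrite /rc; case: k => //=; rewrite fmorphV. Qed.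

Lemma le_rc r s : (rc r <= rc s) = (r <= s).
Proof. by rewrite /rc; case: k => //=; rewrite lecR. Qed.

Lemma lt_rc r s : (rc r < rc s) = (r < s).
Proof. by rewrite /rc; case: k => //=; rewrite ltcR. Qed.

Lemma norm_rc r : `|rc r| = rc `|r|.
Proof. by rewrite /rc; case: k => //=; rewrite normc_def /= expr0n addr0 sqrtr_sqr. Qed.

Lemma re_rcM r x : re (rc r * x) = r * re x.
Proof. by rewrite /re /rc; case: k x => //= [[a b]] /=; rewrite mul0r subr0. Qed.

Lemma rcK r : re (rc r) = r.
Proof. by rewrite /re /rc; case: k. Qed.

Lemma reK x : 0 <= x -> rc (re x) = x.
Proof.
rewrite /re /rc; case: k x => //= -[a b].
by rewrite lecE /= => /andP[/eqP -> _].
Qed.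

Lemma scalar_gt0P (e : K) : 0 < e -> exists2 r : R, 0 < r & e = rc r.
Proof.
move=> e0; exists (re e); last by rewrite reK// ltW.
by rewrite -lt_rc rc0 reK// ltW.
Qed.

(* For [k = complex_scalars], this is the complexification [v |-> f v - i f (i v)]. *)
Lemma real_linear_extension (V : lmodType K) (f : V -> R) :
  (forall u v, f (u + v) = f u + f v) -> (forall r v, f (rc r *: v) = r * f v) ->
  exists2 F : V -> K, (forall a u v, F (a *: u + v) = a * F u + F v) &
    forall v, re (F v) = f v.
Proof.
rewrite /rc /re; case: k V f => /= V f fD fZ.
  by exists f => // a u v; rewrite fD fZ.
pose i : R[i] := 'i%C.
have fN v : f (- v) = - f v by rewrite -scaleN1r -(rmorphN1 (real_complex R)) fZ mulN1r.
exists (fun v => (f v +i* - f (i *: v))%C) => // a u v.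
have aE : a *: u = (complex.Re a)%:C%C *: u + (complex.Im a)%:C%C *: (i *: u).
  by case: a => x y; rewrite scalerA -scalerDl; congr (_ *: _); simpc.
have iaE : i *: (a *: u) = (complex.Re a)%:C%C *: (i *: u) + (complex.Im a)%:C%C *: (- u).
  case: a {aE} => x y; rewrite -scaleN1r !scalerA -scalerDl; congr (_ *: _).
  by rewrite /i; simpc.
rewrite scalerDr iaE aE !fD !fZ fN; case: a {aE iaE} => x y /=.
by rewrite -[RHS]/((_ +i* _)%C); congr (_ +i* _)%C; ring.
Qed.

(* Locked, since unifying the norms of distinct vectors is costly. *)
Fact nrm_key : unit. Proof. exact: tt. Qed.

Definition nrm : forall V : normedZmodType K, V -> R :=
  locked_with nrm_key (fun V v => re `|v|).
Arguments nrm {V} v.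

Lemma nrmE (V : normedZmodType K) (v : V) : nrm v = re `|v|.
Proof. by rewrite /nrm unlock. Qed.

Section norm.
Context {V : normedZmodType K}.
Implicit Types u v w : V.

Lemma rc_nrm v : rc (nrm v) = `|v|. Proof. by rewrite nrmE reK. Qed.

Lemma nrm_ge0 v : 0 <= nrm v. Proof. by rewrite -le_rc rc_nrm rc0. Qed.

Lemma nrm0 : nrm (0 : V) = 0. Proof. by rewrite nrmE normr0 -[X in re X]rc0 rcK. Qed.

Lemma nrm_eq0 v : nrm v = 0 -> v = 0.
Proof. by move=> v0; apply/eqP; rewrite -normr_eq0 -rc_nrm v0 rc0. Qed.

Lemma nrm_gt0 v : v != 0 -> 0 < nrm v.
Proof. by rewrite -normr_gt0 -rc_nrm -rc0 lt_rc. Qed.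

Lemma nrmN v : nrm (- v) = nrm v. Proof. by rewrite !nrmE normrN. Qed.

Lemma nrmD u v : nrm (u + v) <= nrm u + nrm v.
Proof. by rewrite -le_rc rcD !rc_nrm ler_normD. Qed.

Lemma nrmB u v : nrm (u - v) = nrm (v - u).
Proof. by rewrite -nrmN opprB. Qed.

Lemma nrm_dist w u v : nrm (u - v) <= nrm (u - w) + nrm (w - v).
Proof. by rewrite (le_trans _ (nrmD _ _))// addrA subrK. Qed.

Lemma nrm_sub u v : nrm u - nrm v <= nrm (u - v).
Proof. by rewrite lerBlDr (le_trans _ (nrmD _ _))// subrK. Qed.

Lemma nrm_sum (I : Type) (s : seq I) (P : pred I) (F : I -> V) :
  nrm (\sum_(i <- s | P i) F i) <= \sum_(i <- s | P i) nrm (F i).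
Proof.
elim/big_rec2: _ => [|i x y _ h]; first by rewrite nrm0.
by apply: le_trans (nrmD _ _) _; rewrite lerD2l.
Qed.

End norm.

Lemma nrmM (a b : K) : nrm (a * b) = nrm a * nrm b.
Proof. by rewrite !nrmE normrM -(reK (normr_ge0 a)) re_rcM rcK. Qed.

Lemma nrmV (a : K) : nrm a^-1 = (nrm a)^-1.
Proof. by rewrite !nrmE normfV -(reK (normr_ge0 a)) -rcV !rcK. Qed.

Lemma nrm_rc r : nrm (rc r) = `|r|.
Proof. by rewrite nrmE norm_rc rcK. Qed.

Lemma nrm1 : nrm (1 : K) = 1.
Proof. by rewrite -rc1 nrm_rc normr1. Qed.

Lemma re_le_nrm (a : K) : re a <= nrm a.
Proof.
rewrite nrmE /re; case: k a => [a|[a b]] /=; first exact: ler_norm.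
rewrite (le_trans (ler_norm _))//.
by rewrite -[leLHS]sqrtr_sqr ler_wsqrtr// lerDl sqr_ge0.
Qed.

Lemma nrmZ (V : normedModType K) (a : K) (v : V) : nrm (a *: v) = nrm a * nrm v.
Proof. by rewrite !nrmE normrZ -(reK (normr_ge0 a)) re_rcM rcK. Qed.

Lemma nrmZrc (V : normedModType K) r (v : V) : nrm (rc r *: v) = `|r| * nrm v.
Proof. by rewrite nrmZ nrm_rc. Qed.

Lemma phaseP (a : K) : exists2 u : K, nrm u = 1 & u * a = rc (nrm a).
Proof.
have [->|a0] := eqVneq a 0.
  by exists 1; rewrite ?nrm1// mulr0 nrm0 rc0.
exists (`|a| / a); last by rewrite divfK// rc_nrm.
by rewrite nrmM nrmV [nrm `|a|]nrmE normr_id -nrmE divff// gt_eqF// nrm_gt0.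
Qed.

Lemma ultra_lim_scalar (T : Type) (U : set_system T) (f : T -> K) (M : R) :
  UltraFilter U -> U [set t | nrm (f t) <= M] ->
  exists l, forall e : R, 0 < e -> U [set t | nrm (f t - l) < e].
Proof.
rewrite (_ : nrm = fun v : K => re `|v|); last by apply/funext => v; rewrite nrmE.
rewrite /re; case: k f => /= f UU UM; first exact: ultra_lim UM.
have imle (z : R[i]) : `|complex.Im z| <= complex.Re `|z|.
  case: z => a b; rewrite normc_def /=.
  by rewrite -[leLHS]sqrtr_sqr ler_wsqrtr// lerDr sqr_ge0.
have rele (z : R[i]) : `|complex.Re z| <= complex.Re `|z|.
  case: z => a b; rewrite normc_def /=.
  by rewrite -[leLHS]sqrtr_sqr ler_wsqrtr// lerDl sqr_ge0.
have [a ah] : exists a, forall e : R, 0 < e -> U [set t | `|complex.Re (f t) - a| < e].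
  by apply: ultra_lim (ultraS UU _ UM) => t; exact: le_trans (rele _).
have [b bh] : exists a, forall e : R, 0 < e -> U [set t | `|complex.Im (f t) - a| < e].
  by apply: ultra_lim (ultraS UU _ UM) => t; exact: le_trans (imle _).
exists (a +i* b)%C => e e0.
have e2 : 0 < e / 2 by rewrite divr_gt0.
apply: (ultraS UU _ (ultraI UU (ah _ e2) (bh _ e2))) => t [/= h1 h2].
apply: (@le_lt_trans _ _ (`|complex.Re (f t) - a| + `|complex.Im (f t) - b|)).
  case: (f t) => x y; rewrite /=.
  move: (x - a) (y - b) => p q.
  have pq : 0 <= `|p| + `|q| by rewrite addr_ge0.
  rewrite -[leRHS]ger0_norm// -sqrtr_sqr ler_wsqrtr//.
  rewrite sqrrD !real_normK ?num_real// addrAC lerDl mulrn_wge0// mulr_ge0//.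
by rewrite [e]splitr ltrD.
Qed.

End scalars.

(** * Hahn-Banach separation *)

Section hahn_banach.
Context {R : realType} {k : scalar_kind}.
Local Notation K := (scalar_field R k).
Context {V : lmodType K}.
Implicit Types p q : V -> R.

(** Scaling is by positive reals only, so that both fields are treated alike. *)
Definition sublinear q :=
  (forall u v, q (u + v) <= q u + q v) /\
  (forall r v, 0 < r -> q (rc r *: v) <= r * q v).

Lemma sublinearZ q r v : sublinear q -> 0 < r -> q (rc r *: v) = r * q v.
Proof.
move=> [_ qZ] r0; apply/eqP; rewrite eq_le qZ//=.
have := qZ r^-1 (rc r *: v); rewrite invr_gt0 => /(_ r0).
by rewrite scalerA -rcM mulVf ?gt_eqF// rc1 scale1r ler_pdivlMl.
Qed.

Lemma sublinear0 q : sublinear q -> q 0 = 0.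
Proof.
move=> sq; have := sublinearZ 0 sq (ltr0n R 2).
by rewrite scaler0 => h; lra.
Qed.

Lemma sublinearN q v : sublinear q -> - q (- v) <= q v.
Proof.
move=> sq; have := sq.1 v (- v); rewrite subrr (sublinear0 sq); lra.
Qed.

(** Serves the descent step, the lower bounds of chains and the distance to a cone; [b] keeps the
    infima finite. *)
Lemma sublinear_inf (I : Type) (F : set I) (g : I -> V -> R) (b : V -> R) :
  F !=set0 -> (forall v i, F i -> b v <= g i v) ->
  (forall u v i j, F i -> F j -> exists2 l, F l & g l (u + v) <= g i u + g j v) ->
  (forall r v i, 0 < r -> F i -> exists2 j, F j & g j (rc r *: v) <= r * g i v) ->
  sublinear (fun v => inf [set g i v | i in F]) /\
  forall i v, F i -> inf [set g i v | i in F] <= g i v.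
Proof.
move=> [i0 Fi0] gb gD gZ.
have le i v : F i -> inf [set g i v | i in F] <= g i v.
  move=> Fi; apply: ge_inf; last by exists i.
  by exists (b v) => _ [j Fj <-]; exact: gb.
have ne v : [set g i v | i in F] !=set0 by exists (g i0 v), i0.
split=> //; split=> [u v|r v r0].
- rewrite -lerBlDr; apply: lb_le_inf => // _ [i Fi <-].
  rewrite lerBlDl -lerBlDr; apply: lb_le_inf => // _ [j Fj <-].
  rewrite lerBlDr; have [l Fl h] := gD u v i j Fi Fj.
  by rewrite [leRHS]addrC; apply: le_trans h; exact: le.
- rewrite -ler_pdivrMl//; apply: lb_le_inf => // _ [i Fi <-].
  rewrite ler_pdivrMl//; have [j Fj h] := gZ r v i r0 Fi.
  by apply: le_trans h; exact: le.
Qed.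

(** Take the infimum of [q (v + t c) - t q c] over [t >= 0]: [t = 0] bounds it by [q v], and [t = 1]
    gives the bound at [- c]. *)
Lemma sublinear_descent q c : sublinear q ->
  exists q', [/\ sublinear q', forall v, q' v <= q v & q' (- c) <= - q c].
Proof.
move=> sq; pose F := [set t : R | 0 <= t].
pose g (t : R) v := q (v + rc t *: c) - t * q c.
have qt t v : 0 <= t -> q (rc t *: v) = t * q v.
  rewrite le_eqVlt => /predU1P[<-|]; last exact: sublinearZ.
  by rewrite rc0 scale0r mul0r sublinear0.
have [||||sq' le] := @sublinear_inf R F g (fun v => - q (- v)).
- by exists 0; exact: lexx.
- move=> v t /= t0; rewrite /g -(qt _ _ t0).
  have := sq.1 (- v) (v + rc t *: c); rewrite addKr; lra.
- move=> u v s t /= s0 t0; exists (s + t); first exact: addr_ge0.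
  rewrite /g rcD scalerDl addrACA mulrDl.
  have := sq.1 (u + rc s *: c) (v + rc t *: c); lra.
- move=> r v t r0 /= t0; exists (r * t); first by apply: mulr_ge0 => //; exact: ltW.
  by rewrite /g rcM -scalerA -scalerDr sublinearZ// mulrBr mulrA.
exists (fun v => inf [set g t v | t in F]); split=> // [v|].
  apply: le_trans (le 0 v (lexx 0)) _.
  by rewrite /g rc0 scale0r addr0 mul0r subr0.
apply: le_trans (le 1 (- c) ler01) _.
by rewrite /g rc1 scale1r addNr sublinear0// mul1r sub0r.
Qed.

Lemma sublinear_minimal p : sublinear p ->
  exists q, [/\ sublinear q, forall v, q v <= p v &
    forall q', sublinear q' -> (forall v, q' v <= q v) -> q' = q].
Proof.
move=> sp; pose T := {q | sublinear q /\ forall v, q v <= p v}.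
pose ge (a b : T) := `[< forall v, proj1_sig b v <= proj1_sig a v >].
have Teq (a b : T) : proj1_sig a = proj1_sig b -> a = b.
  by case: a b => [a ha] [b hb] /= e; subst b; congr exist.
have [||||[q [sq qp]] qmin] := @Zorn T ge.
- by move=> a; apply/asboolP.
- move=> a b c /asboolP ab /asboolP bc; apply/asboolP => v.
  exact: le_trans (bc v) (ab v).
- move=> a b /asboolP ab /asboolP ba; apply/Teq/funext => v.
  by apply/eqP; rewrite eq_le ab ba.
- move=> A Atot; have [[a Aa]|A0] := pselect (A !=set0); last first.
    exists (exist _ p (conj sp (fun v => lexx _))) => a Aa; exfalso.
    by apply: A0; exists a.
  have [||||sq le] := @sublinear_inf T A (@proj1_sig _ _) (fun v => - p (- v)).
  - by exists a.
  - move=> v b _; have [sb bp] := proj2_sig b.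
    apply: le_trans (sublinearN v sb); rewrite lerN2; exact: bp.
  - move=> u v b c Ab Ac; have [/asboolP h|/asboolP h] := Atot b c Ab Ac.
      exists c => //; have [sc _] := proj2_sig c.
      by apply: le_trans (sc.1 _ _) _; rewrite lerD2r.
    exists b => //; have [sb _] := proj2_sig b.
    by apply: le_trans (sb.1 _ _) _; rewrite lerD2l.
  - move=> r v b r0 Ab; exists b => //; have [sb _] := proj2_sig b.
    exact: sb.2.
  unshelve eexists.
    exists (fun v => inf [set proj1_sig b v | b in A]); split=> // v.
    by apply: le_trans (le _ v Aa) _; exact: (proj2_sig a).2.
  by move=> b Ab; apply/asboolP => v /=; exact: le.
exists q; split=> // q' sq' q'q.
have q'p v : q' v <= p v := le_trans (q'q v) (qp v).
have e : exist _ q' (conj sq' q'p) = exist _ q (conj sq qp) :> T.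
  by apply: qmin; apply/asboolP.
exact: (congr1 (@proj1_sig _ _) e).
Qed.

(* A minimal sublinear functional is linear, since it is not changed by [sublinear_descent]. *)
Lemma hahn_banach p c : sublinear p ->
  exists f : V -> R, [/\ forall u v, f (u + v) = f u + f v,
    forall r v, f (rc r *: v) = r * f v, forall v, f v <= p v & f c = p c].
Proof.
(* Descending at [c] beforehand makes any linear functional below [p'] attain [p c] at [c], through
   its value at [- c]. *)
move=> sp; have [p' [sp' p'p p'c]] := sublinear_descent c sp.
have [f [sf fp' fmin]] := sublinear_minimal sp'.
have fN v : f (- v) = - f v.
  have [q [sq qf qv]] := sublinear_descent v sf.
  have e := fmin _ sq qf; rewrite e in qv.
  by have := sublinearN v sf; lra.
have fD u v : f (u + v) = f u + f v.
  have := sf.1 u v; have := sf.1 (- u) (- v); rewrite -opprD !fN; lra.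
exists f; split=> //.
- move=> r v; have [r0|r0|->] := ltgtP r 0.
  + have := sublinearZ v sf (_ : 0 < - r); rewrite oppr_gt0 => /(_ r0).
    by rewrite rcN scaleNr fN; lra.
  + exact: sublinearZ.
  + by rewrite rc0 scale0r mul0r sublinear0.
- by move=> v; exact: le_trans (fp' v) (p'p v).
- apply/eqP; rewrite eq_le (le_trans (fp' c) (p'p c))/=.
  by have := fp' (- c); rewrite fN; lra.
Qed.

End hahn_banach.

(** * Separation and completeness for bounded operators *)

Section bounded_operators.
Context {R : realType} {k : scalar_kind}.
Local Notation K := (scalar_field R k).
Implicit Types X Y Z V : normedModType K.

Definition adherent V (S : set V) (v : V) :=
  forall e : R, 0 < e -> exists2 w, S w & nrm (v - w) < e.

Definition cauchy_seq V (u : nat -> V) := forall e : R, 0 < e ->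
  exists N, forall m n, (N <= m)%N -> (N <= n)%N -> nrm (u m - u n) < e.

Definition converges V (u : nat -> V) (l : V) := forall e : R, 0 < e ->
  exists N, forall n, (N <= n)%N -> nrm (u n - l) < e.

Definition seq_complete V := forall u : nat -> V, cauchy_seq u -> exists l, converges u l.

Lemma adherent_separated V (S : set V) v : ~ adherent S v ->
  exists2 d : R, 0 < d & forall w, S w -> d <= nrm (v - w).
Proof.
move=> nS; apply: contrapT => h; apply: nS => d d0.
apply: contrapT => h'; apply: h; exists d => // w Sw.
by rewrite leNgt; apply/negP => lt; apply: h'; exists w.
Qed.

Lemma bounded_op_ex X Y (f : X -> Y) (M : R) :
  (forall a u v, f (a *: u + v) = a *: f u + f v) ->
  (forall x, nrm (f x) <= M * nrm x) -> exists T : bounded_op X Y, T =1 f.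
Proof.
move=> lf fM; have bf : f \in @bounded_linear K X Y.
  rewrite inE; split=> //; exists (rc M) => x.
  by rewrite -!rc_nrm -rcM (@le_rc _ k).
by exists (BoundedOp bf).
Qed.

Lemma nrm_op_app X Y (T : bounded_op X Y) x : nrm (T x) <= nrm T * nrm x.
Proof. by rewrite -(@le_rc _ k) rcM !rc_nrm; exact: le_op_norm. Qed.

Lemma nrm_op_le X Y (T : bounded_op X Y) (M : R) :
  0 <= M -> (forall x, nrm (T x) <= M * nrm x) -> nrm T <= M.
Proof.
move=> M0 TM; rewrite -(@le_rc _ k) rc_nrm; apply: op_norm_le; first by rewrite -rc0 (@le_rc _ k).
by move=> x; rewrite -!rc_nrm -rcM (@le_rc _ k).
Qed.

Lemma nrm_comp X Y Z (S : bounded_op Y Z) (T : bounded_op X Y) :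
  nrm (op_comp S T) <= nrm S * nrm T.
Proof.
apply: nrm_op_le => [|x]; first by rewrite mulr_ge0// nrm_ge0.
apply: le_trans (nrm_op_app S (T x)) _; rewrite -mulrA.
by rewrite ler_wpM2l ?nrm_ge0// nrm_op_app.
Qed.

(** Hahn-Banach is applied to the distance to [C]: it is sublinear since [C] is a convex cone,
    vanishes on [C], and is at least [d] at [c]. *)
Lemma cone_separation V (C : set V) (c : V) (d : R) :
  C 0 -> (forall u v, C u -> C v -> C (u + v)) ->
  (forall r v, 0 < r -> C v -> C (rc r *: v)) ->
  0 < d -> (forall w, C w -> d <= nrm (c - w)) ->
  exists f : V -> R, [/\ (forall u v, f (u + v) = f u + f v),
    (forall r v, f (rc r *: v) = r * f v), (forall v, f v <= nrm v),
    (forall w, C w -> f w <= 0) & 0 < f c].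
Proof.
move=> C0 CD CZ d0 Cd.
have [||||sp le] := @sublinear_inf R k V V C (fun w v => nrm (v - w)) (fun=> 0).
- by exists 0.
- by move=> v w _; exact: nrm_ge0.
- move=> u v w z Cw Cz; exists (w + z); first exact: CD.
  by rewrite opprD addrACA nrmD.
- move=> r v w r0 Cw; exists (rc r *: w); first exact: CZ.
  by rewrite -scalerBr nrmZrc gtr0_norm.
have [f [fD fZ fp fc]] := hahn_banach c sp.
exists f; split=> //.
- move=> v; apply: le_trans (fp v) _; apply: le_trans (le 0 v C0) _.
  by rewrite subr0.
- move=> w Cw; apply: le_trans (fp w) _; apply: le_trans (le w w Cw) _.
  by rewrite subrr nrm0.
- rewrite fc; apply: lt_le_trans d0 _; apply: lb_le_inf.
    by exists (nrm (c - 0)), 0.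
  by move=> _ [w Cw <-]; exact: Cd.
Qed.

(** Rotating [v] by a phase makes [F v] real, so the bound on the real part [f] bounds [F] as
    well. *)
Lemma real_functional_extension V (f : V -> R) :
  (forall u v, f (u + v) = f u + f v) -> (forall r v, f (rc r *: v) = r * f v) ->
  (forall v, f v <= nrm v) ->
  exists F : bounded_op V K^o, forall v, re (F v) = f v.
Proof.
move=> fD fZ fn; have [F lF reF] := real_linear_extension fD fZ.
have [|T TF] := @bounded_op_ex V K^o F 1 lF.
  move=> v; have [u u1 uF] := phaseP (F v).
  have F0 : F 0 = 0.
    by have := lF (-1) 0 0; rewrite scaler0 addr0 mulN1r addNr.
  have Fu : F (u *: v) = rc (nrm (F v)) by rewrite -uF -[u *: v]addr0 lF F0 addr0.
  rewrite mul1r -[nrm (F v : K^o)]/(nrm (F v : K)) -[leLHS](@rcK _ k) -Fu reF.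
  by apply: le_trans (fn _) _; rewrite nrmZ u1 mul1r.
by exists T => v; rewrite TF.
Qed.

Definition subspace V (L : set V) :=
  L 0 /\ forall a u v, L u -> L v -> L (a *: u + v).

Lemma subspaceZ V (L : set V) a u : subspace L -> L u -> L (a *: u).
Proof. by move=> [L0 Lc] Lu; rewrite -[_ *: _]addr0; exact: Lc. Qed.

Lemma subspaceD V (L : set V) u v : subspace L -> L u -> L v -> L (u + v).
Proof. by move=> [_ Lc] Lu Lv; rewrite -[u]scale1r; exact: Lc. Qed.

(** A subspace is a cone stable under phases, so a functional whose real part is at most 0 on it
    vanishes there. *)
Lemma subspace_separation V (L : set V) (u : V) :
  subspace L -> ~ adherent L u ->
  exists2 F : bounded_op V K^o, F u = 1 & forall w, L w -> F w = 0.
Proof.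
move=> sL /adherent_separated[d d0 dL].
have [||f [fD fZ fn fL fu]] := @cone_separation V L u d sL.1 _ _ d0 dL.
- by move=> v w; exact: subspaceD.
- by move=> r v _; exact: subspaceZ.
have [F Ff] := real_functional_extension fD fZ fn.
have Fu0 : F u != 0.
  by apply: contraTneq fu => Fu; rewrite -Ff Fu -[X in re X]rc0 rcK ltxx.
exists ((F u)^-1 *: F); first by rewrite -[LHS]/((F u)^-1 * F u) mulVf.
move=> w Lw; suff Fw : F w = 0 by rewrite -[LHS]/((F u)^-1 * F w) Fw mulr0.
have [a a1 aF] := phaseP (F w).
have : re (F (a *: w)) <= 0 by rewrite Ff; apply: fL; exact: subspaceZ.
have -> : F (a *: w) = a * F w by exact: linearZ.
rewrite aF rcK => h.
by apply: nrm_eq0; apply/eqP; rewrite eq_le h nrm_ge0.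
Qed.

Lemma functional_ex V (u : V) : u != 0 -> exists F : bounded_op V K^o, F u = 1.
Proof.
move=> u0; have [||F Fu _] := @subspace_separation V [set 0] u.
- by split=> // a v w /= -> ->; rewrite scaler0 addr0.
- move=> /(_ (nrm u))[|w ->]; first exact: nrm_gt0.
  by rewrite subr0 ltxx.
by exists F.
Qed.

Lemma cauchy_bounded V (u : nat -> V) : cauchy_seq u -> exists M : R, forall n, nrm (u n) <= M.
Proof.
move=> /(_ 1 ltr01)[N hN]; exists (\sum_(i < N.+1) nrm (u i) + 1) => n.
have [nN|nN] := ltnP n N.+1.
  rewrite (bigD1 (Ordinal nN))//= -addrA lerDl addr_ge0// sumr_ge0// => i _.
  exact: nrm_ge0.
have := hN n N (ltnW nN) (leqnn N); have := nrm_sub (u n) (u N).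
rewrite (bigD1 ord_max)//=.
have : 0 <= \sum_(i < N.+1 | i != ord_max) nrm (u i).
  by rewrite sumr_ge0// => i _; exact: nrm_ge0.
lra.
Qed.

Lemma cauchy_ultra V (u : nat -> V) (U : set_system nat) l : UltraFilter U ->
  (forall n, U [set m | (n <= m)%N]) ->
  (forall e : R, 0 < e -> U [set n | nrm (u n - l) < e]) ->
  cauchy_seq u -> converges u l.
Proof.
move=> UU Un Ul cu e e0; have e2 : 0 < e / 2 by rewrite divr_gt0.
have [N hN] := cu _ e2; exists N => n nN.
have [m [/= mN ml]] := ultra_ex UU (ultraI UU (Un N) (Ul _ e2)).
have := nrm_dist (u m) (u n) l; have := hN n m nN mN; lra.
Qed.

Lemma scalar_complete : seq_complete (K^o : normedModType K).
Proof.
move=> u cu; have [U [UU Un]] := ultra_nat.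
have [M uM] := cauchy_bounded cu.
have [|l lP] := @ultra_lim_scalar R k nat U u M UU.
  by apply: ultraS UU _ (Un 0%N) => n _; exact: uM.
by exists l; exact: cauchy_ultra Un lP cu.
Qed.

Lemma bounded_op_complete X Y : seq_complete Y ->
  seq_complete (bounded_op X Y : normedModType K).
Proof.
move=> cY u cu; have [M uM] := cauchy_bounded cu.
have /choice[f fP] : forall x, exists l, converges (fun n => u n x) l.
  move=> x; apply: cY => e e0.
  have x1 : 0 < nrm x + 1 by rewrite ltr_wpDl// nrm_ge0.
  have [N hN] := cu (e / (nrm x + 1)) (divr_gt0 e0 x1); exists N => m n mN nN.
  apply: le_lt_trans (nrm_op_app (u m - u n) x) _.
  apply: (@le_lt_trans _ _ (nrm (u m - u n) * (nrm x + 1))).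
    by rewrite ler_wpM2l ?nrm_ge0// lerDl.
  by rewrite -ltr_pdivlMr// hN.
have unique (l : Y) : (forall e : R, 0 < e -> nrm l <= e) -> l = 0.
  move=> h; apply: nrm_eq0; apply: norm_small0 => e e0.
  by rewrite ger0_norm ?nrm_ge0// h.
have [||T Tf] := @bounded_op_ex X Y f (M + 1).
- move=> a x y; apply/eqP; rewrite -subr_eq0; apply/eqP/unique => e e0.
  have a0 := nrm_ge0 a.
  have a2 : 0 < 2 + nrm a by lra.
  have d0 : 0 < e / (2 + nrm a) by rewrite divr_gt0.
  have [N1 h1] := fP x _ d0; have [N2 h2] := fP y _ d0.
  have [N3 h3] := fP (a *: x + y) _ d0.
  pose n := maxn N1 (maxn N2 N3).
  have {}h1 := h1 n (leq_maxl _ _).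
  have /h2 {}h2 : (N2 <= n)%N by rewrite !leq_max leqnn orbT.
  have /h3 {}h3 : (N3 <= n)%N by rewrite !leq_max leqnn !orbT.
  have -> : f (a *: x + y) - (a *: f x + f y) =
      - (u n (a *: x + y) - f (a *: x + y)) +
      (a *: (u n x - f x) + (u n y - f y)).
    by rewrite (linearP (u n)) scalerBr opprB (addrACA (a *: u n x)) -opprD addrA subrK.
  apply: le_trans (nrmD _ _) _; rewrite nrmN.
  apply: le_trans (lerD (lexx _) (nrmD _ _)) _; rewrite nrmZ.
  have : nrm a * nrm (u n x - f x) <= nrm a * (e / (2 + nrm a)).
    by rewrite ler_wpM2l// ltW.
  have : (2 + nrm a) * (e / (2 + nrm a)) = e.
    by rewrite mulrC divfK// gt_eqF.
  lra.
- move=> x; rewrite leNgt; apply/negP => lt.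
  have d0 : 0 < nrm (f x) - (M + 1) * nrm x by lra.
  have [N hN] := fP x _ d0; have := hN N (leqnn N).
  have := nrm_sub (f x) (u N x); rewrite nrmB.
  have : nrm (u N x) <= M * nrm x.
    apply: le_trans (nrm_op_app _ _) _; rewrite ler_wpM2r ?nrm_ge0//.
  have := nrm_ge0 x; lra.
exists T => e e0; have e2 : 0 < e / 2 by rewrite divr_gt0.
have [N hN] := cu _ e2; exists N => n nN.
suff : nrm (u n - T) <= e / 2 by lra.
apply: nrm_op_le => [|x]; first exact: ltW.
apply/ler_addgt0Pr => d d0; have [N' hN'] := fP x d d0.
have := hN' (maxn N N') (leq_maxr _ _).
have := hN n (maxn N N') nN (leq_maxl _ _).
set m := maxn N N' => h1 h2.
rewrite -[X in nrm X]/(u n x - T x) Tf.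
apply: le_trans (nrm_dist (u m x) _ _) _; apply: lerD; last exact: ltW.
apply: le_trans (nrm_op_app (u n - u m) x) _.
by rewrite ler_wpM2r ?nrm_ge0// ltW.
Qed.

End bounded_operators.

(** * The Bishop-Phelps theorem *)

Section bishop_phelps.
Context {R : realType} {k : scalar_kind}.
Local Notation K := (scalar_field R k).
Context {V : normedModType K}.

(** Ekeland's variational principle for the distance to [y]. A move within [S w] decreases this
    distance by at least [eps] times the displacement; near-minimizers on nested sets [S (u n)] form
    a Cauchy sequence, and its limit [w0] admits no further strict decrease. *)
Lemma ekeland (W : set V) (y : V) (eps : R) : seq_complete V ->
  W !=set0 -> (forall v, adherent W v -> W v) -> 0 < eps ->
  exists2 w0, W w0 &
    forall w, W w -> nrm (w0 - y) <= nrm (w - y) + eps * nrm (w - w0).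
Proof.
move=> cV [w1 Ww1] clW eps0.
pose phi v := nrm (v - y).
pose S w := [set w' | W w' /\ phi w' + eps * nrm (w' - w) <= phi w].
have Sid w : W w -> S w w by move=> Ww; split=> //; rewrite subrr nrm0 mulr0 addr0.
have Strans a b c : S a b -> S b c -> S a c.
  move=> [_ ab] [Wc bc]; split=> //; have := nrm_dist b c a.
  rewrite -(ler_pM2l eps0) mulrDr; lra.
pose small (n : nat) : R := n.+1%:R^-1.
have small0 n : 0 < small n by rewrite invr_gt0.
have /choice[next nextP] : forall p : V * nat, exists w', W p.1 ->
    S p.1 w' /\ forall w, S p.1 w -> phi w' <= phi w + small p.2.
  move=> [w n] /=; have [Ww|nW] := pselect (W w); last by exists w.
  have hi : has_inf [set phi w' | w' in S w].
    split; first by exists (phi w), w => //; exact: Sid.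
    by exists 0 => _ [w' _ <-]; exact: nrm_ge0.
  have [_ [w' Sw' <-] lt] := inf_adherent (small0 n) hi.
  exists w' => _; split=> // w'' Sw''; apply: le_trans (ltW lt) _.
  by rewrite lerD2r ge_inf//; [exact: hi.2|exists w''].
pose u := fix u n := if n is m.+1 then next (u m, m) else w1.
have Wu n : W (u n).
  by elim: n => //= n /(nextP (u n, n))[[]].
have Su m n : (m <= n)%N -> S (u m) (u n).
  elim: n => [|n IH]; first by rewrite leqn0 => /eqP ->; exact: Sid.
  rewrite leq_eqVlt => /predU1P[->|]; first exact: Sid.
  by rewrite ltnS => /IH h; apply: Strans h _; have [] := nextP (u n, n) (Wu n).
have small_lim (e : R) : 0 < e -> exists n, small n < e.
  move=> e0; exists (Num.truncn e^-1).
  by rewrite /small invf_plt ?posrE// truncnS_gt.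
have phi_step n w : S (u n.+1) w -> phi (u n.+1) <= phi w + small n.
  have [h1 h2] := nextP (u n, n) (Wu n); move=> Sw; apply: h2; exact: Strans h1 Sw.
have cu : cauchy_seq u.
  move=> e e0; have e20 : 0 < eps * (e / 2) by rewrite mulr_gt0// divr_gt0.
  have [n hn] := small_lim _ e20.
  exists n.+1 => i j ni nj.
  have near i' : (n < i')%N -> nrm (u i' - u n.+1) < e / 2.
    move=> ni'; rewrite -(ltr_pM2l eps0); have si := Su _ _ ni'.
    have := phi_step n _ si; have [_] := si; lra.
  have := nrm_dist (u n.+1) (u i) (u j); rewrite (nrmB (u n.+1)).
  have := near _ ni; have := near _ nj; lra.
have [w0 uw0] := cV u cu.
have Ww0 : W w0.
  apply: clW => e e0; have [N hN] := uw0 e e0; exists (u N) => //.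
  by rewrite nrmB hN.
have Sw0 n : S (u n) w0.
  split=> //; apply/ler_addgt0Pr => e e0.
  have d0 : 0 < e / (1 + eps) by rewrite divr_gt0// addr_gt0.
  have [N hN] := uw0 _ d0; pose m := maxn N n.
  have := hN m (leq_maxl _ _); have [_] := Su n m (leq_maxr _ _).
  have := nrm_dist (u m) w0 y; rewrite (nrmB w0 (u m)).
  have := nrm_dist (u m) w0 (u n); rewrite (nrmB w0 (u m)).
  rewrite -(ler_pM2l eps0) mulrDr /phi => h1 h2 h3 h4.
  have h5 : (1 + eps) * nrm (u m - w0) <= e.
    by rewrite mulrC -ler_pdivlMr ?ltW// addr_gt0.
  by rewrite mulrDl mul1r in h5; lra.
exists w0 => // w Ww; rewrite leNgt; apply/negP => lt.
have Sw : S w0 w by split=> //; exact: ltW.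
have h : phi w0 <= phi w.
  apply/ler_addgt0Pr => e /small_lim[n hn].
  have := phi_step n w (Strans _ _ _ (Sw0 n.+1) Sw).
  have [_] := Sw0 n.+1; have := mulr_ge0 (ltW eps0) (nrm_ge0 (w0 - u n.+1)); lra.
by have := mulr_ge0 (ltW eps0) (nrm_ge0 (w - w0)); rewrite /phi in h; lra.
Qed.

(** At a point [w0] given by Ekeland's principle, the cone generated by [W - w0] stays away from
    [y - w0]; a functional that separates them supports [W] at [w0]. *)
Lemma bishop_phelps (W : set V) (y : V) : seq_complete V ->
  W !=set0 -> (forall v, adherent W v -> W v) ->
  (forall u v t, W u -> W v -> 0 <= t <= 1 -> W (rc t *: u + rc (1 - t) *: v)) ->
  ~ W y ->
  exists w0 (f : V -> R), W w0 /\ [/\ forall u v, f (u + v) = f u + f v,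
    forall r v, f (rc r *: v) = r * f v, forall v, f v <= nrm v,
    forall w, W w -> f w <= f w0 & exists v, 0 < f v].
Proof.
move=> cV W0 clW cvxW nWy.
have half0 : 0 < 2^-1 :> R by rewrite invr_gt0.
have [w0 Ww0 ek] := ekeland y cV W0 clW half0.
pose c := y - w0.
have c0 : 0 < nrm c.
  by apply: nrm_gt0; apply/eqP => /subr0_eq e; apply: nWy; rewrite e.
pose C := [set v | exists2 rw : R * V, 0 < rw.1 /\ W rw.2 & v = rc rw.1 *: (rw.2 - w0)].
have C0 : C 0 by exists (1, w0); rewrite //= subrr scaler0.
have CD u v : C u -> C v -> C (u + v).
  move=> [[r a] /= [r0 Wa] ->] [[s b] /= [s0 Wb] ->].
  have rs : 0 < r + s by rewrite addr_gt0.
  have rs1 : 1 - r / (r + s) = s / (r + s).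
    by apply/eqP; rewrite subr_eq -mulrDl addrC divff// gt_eqF.
  exists (r + s, rc (r / (r + s)) *: a + rc (1 - r / (r + s)) *: b) => /=.
    split=> //; apply: cvxW => //; rewrite divr_ge0 ?(ltW r0) ?(ltW rs)//=.
    by rewrite ler_pdivrMr// mul1r lerDl ltW.
  rewrite rs1 [RHS]scalerBr [X in _ = X - _]scalerDr !scalerA -!rcM.
  rewrite !(mulrC (r + s)) !divfK ?gt_eqF//.
  by rewrite rcD [X in _ - X]scalerDl opprD [RHS]addrACA -!scalerBr.
have CZ r v : 0 < r -> C v -> C (rc r *: v).
  move=> r0 [[s b] /= [s0 Wb] ->]; exists (r * s, b); first by rewrite /= mulr_gt0.
  by rewrite rcM scalerA.
have ek1 w : W w -> nrm c <= nrm (c - (w - w0)) + 2^-1 * nrm (w - w0).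
  by move=> /ek; rewrite nrmB -/c [in X in _ -> X]/c opprB addrA subrK (nrmB w y).
(* Slope 1/2 gives [|c| <= |c - v| + |v| / 2], and [|v| <= |c| + |c - v|] turns this into the bound
   by one third. The inequality passes from [W - w0] to its multiples by convexity of [W] for
   factors at most 1, of the norm for larger ones. *)
have Cd v : C v -> nrm c / 3 <= nrm (c - v).
  move=> Cv; suff : nrm c <= nrm (c - v) + 2^-1 * nrm v.
    have := nrm_sub v c; rewrite nrmB; lra.
  move: Cv => [[r w] /= [r0 Ww] ->].
  have [r1|r1] := leP r 1.
    have -> : rc r *: (w - w0) = rc r *: w + rc (1 - r) *: w0 - w0.
      by rewrite rcD rcN rc1 scalerDl scale1r scaleNr addrA addrAC addrK scalerBr.
    by apply: ek1; apply: cvxW => //; rewrite (ltW r0).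
  have := ek1 w Ww; set x := w - w0.
  have -> : c - x = rc r^-1 *: (c - rc r *: x) + rc (1 - r^-1) *: c.
    rewrite scalerBr scalerA -rcM mulVf ?gt_eqF// rc1 scale1r [RHS]addrAC -scalerDl -rcD.
    by rewrite [r^-1 + _]addrC subrK rc1 scale1r.
  have ri : 0 < r^-1 by rewrite invr_gt0.
  have ri1 : 0 <= 1 - r^-1 by rewrite subr_ge0 invf_le1// ltW.
  move=> h; have := le_trans h (lerD (nrmD _ _) (lexx _)).
  rewrite !nrmZrc !ger0_norm ?(ltW ri) ?(ltW r0)// => {}h.
  have e : r^-1 * (2^-1 * (r * nrm x)) = 2^-1 * nrm x.
    by field; rewrite gt_eqF.
  by rewrite -(ler_pM2l ri) mulrDr e; move: h; rewrite mulrBl mul1r; lra.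
have c3 : 0 < nrm c / 3 by rewrite divr_gt0.
have [f [fD fZ fn fC fc]] := cone_separation C0 CD CZ c3 Cd.
exists w0, f; split=> //; split=> //; last by exists c.
move=> w Ww; have fN : f (- w0) = - f w0.
  have := fZ (-1) w0; rewrite rcN rc1 scaleN1r => ->; lra.
have : f (w - w0) <= 0.
  by apply: fC; exists (1, w); rewrite ?rc1 ?scale1r.
by rewrite fD fN subr_le0.
Qed.

End bishop_phelps.

(** * Essential norm *)

Section essential_norm.
Context {R : realType} {k : scalar_kind}.
Local Notation K := (scalar_field R k).
Implicit Types X Y Z : normedModType K.

(** Total boundedness of the image of the unit ball, expressed by a finite colouring of the ball on
    whose classes [C] varies little. With no centres to choose, sums and products just combine
    colourings. *)
Definition finitely_coverable X Y (C : bounded_op X Y) := forall e : R, 0 < e ->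
  exists (I : finType) (h : X -> I), forall x y,
    nrm x <= 1 -> nrm y <= 1 -> h x = h y -> nrm (C x - C y) < e.

Lemma compact_finitely_coverable X (C : bounded_op X X) :
  compact_op C -> finitely_coverable C.
Proof.
rewrite /compact_op precompactE compact_cover => cC e e0.
have e2 : 0 < e / 2 by rewrite divr_gt0.
have rc2 : 0 < rc (e / 2) :> K by rewrite -(@rc0 R k) lt_rc.
have [||D _ CD] := cC X setT (fun y => ball y (rc (e / 2))).
- by move=> y _; exact: ball_open.
- by move=> y _; exists y => //; exact: ballxx.
pose h x : 'I_(size (finmap.enum_fset D)).+1 :=
  inord (find (fun y => `[< nrm (C x - y) < e / 2 >]) (finmap.enum_fset D)).
exists 'I_(size (finmap.enum_fset D)).+1, h => x y x1 y1.
have hP z : nrm z <= 1 -> (h z < size (finmap.enum_fset D))%N /\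
    nrm (C z - nth 0 (finmap.enum_fset D) (h z)) < e / 2.
  move=> z1; have [|d dD] := CD (C z).
    apply: subset_closure; exists z => //=.
    by rewrite -rc_nrm -(@rc1 R k) le_rc.
  rewrite -ball_normE /ball_/= => dz.
  have hd : has (fun y => `[< nrm (C z - y) < e / 2 >]) (finmap.enum_fset D).
    apply/hasP; exists d => //; apply/asboolP.
    by rewrite nrmB -(@lt_rc _ k) rc_nrm.
  rewrite /h inordK ?ltnS ?find_size// -has_find; split=> //.
  exact/asboolP/(nth_find 0 hd).
move=> hxy; have [_] := hP x x1; have [_] := hP y y1; rewrite hxy => h1 h2.
have := nrm_dist (nth 0 (finmap.enum_fset D) (h y)) (C x) (C y).
by rewrite (nrmB (nth _ _ _)); lra.
Qed.

Lemma finitely_coverable0 X Y : finitely_coverable (0 : bounded_op X Y).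
Proof. by move=> e e0; exists unit, (fun=> tt) => x y _ _ _; rewrite subrr nrm0. Qed.

Lemma finitely_coverableD X Y (C D : bounded_op X Y) :
  finitely_coverable C -> finitely_coverable D -> finitely_coverable (C + D).
Proof.
move=> cC cD e e0; have e2 : 0 < e / 2 by rewrite divr_gt0.
have [I [h hC]] := cC _ e2; have [J [g gD]] := cD _ e2.
exists (I * J)%type, (fun x => (h x, g x)) => x y x1 y1 [hxy gxy].
have -> : (C + D) x - (C + D) y = (C x - C y) + (D x - D y).
  by rewrite -[(C + D) x]/(C x + D x) -[(C + D) y]/(C y + D y) opprD addrACA.
by apply: le_lt_trans (nrmD _ _) _; rewrite [e]splitr ltrD ?hC ?gD.
Qed.

Lemma finitely_coverable_compl X Y Z (S : bounded_op Y Z) (C : bounded_op X Y) :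
  finitely_coverable C -> finitely_coverable (op_comp S C).
Proof.
move=> cC e e0; have S0 : 0 < nrm S + 1 by rewrite ltr_wpDl// nrm_ge0.
have [I [h hC]] := cC _ (divr_gt0 e0 S0); exists I, h => x y x1 y1 hxy.
have -> : op_comp S C x - op_comp S C y = S (C x - C y) by rewrite linearB.
apply: le_lt_trans (nrm_op_app _ _) _; have := hC x y x1 y1 hxy.
rewrite ltr_pdivlMr// mulrC; apply: le_lt_trans.
by rewrite ler_wpM2r ?nrm_ge0// lerDl.
Qed.

Lemma finitely_coverable_compr X Y Z (C : bounded_op Y Z) (S : bounded_op X Y) :
  finitely_coverable C -> finitely_coverable (op_comp C S).
Proof.
move=> cC e e0; have S0 : 0 < nrm S + 1 by rewrite ltr_wpDl// nrm_ge0.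
have [I [h hC]] := cC _ (divr_gt0 e0 S0).
pose s x := rc (nrm S + 1)^-1 *: S x.
have s1 x : nrm x <= 1 -> nrm (s x) <= 1.
  move=> x1; rewrite nrmZrc gtr0_norm ?invr_gt0// ler_pdivrMl// mulr1.
  apply: le_trans (nrm_op_app _ _) _.
  by rewrite (@le_trans _ _ (nrm S))// ?lerDl// ler_piMr ?nrm_ge0.
exists I, (h \o s) => x y x1 y1 /= hxy.
have := hC _ _ (s1 _ x1) (s1 _ y1) hxy.
rewrite -linearB -scalerBr linearZ nrmZrc gtr0_norm ?invr_gt0// mulrC.
by rewrite ltr_pM2r ?invr_gt0// linearB.
Qed.

Lemma finitely_coverableZ X Y (a : K) (C : bounded_op X Y) :
  finitely_coverable C -> finitely_coverable (a *: C).
Proof.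
move=> cC e e0; have a0 : 0 < nrm a + 1 by rewrite ltr_wpDl// nrm_ge0.
have [I [h hC]] := cC _ (divr_gt0 e0 a0); exists I, h => x y x1 y1 hxy.
rewrite -[(a *: C) x]/(a *: C x) -[(a *: C) y]/(a *: C y) -scalerBr nrmZ.
have := hC x y x1 y1 hxy.
rewrite ltr_pdivlMr// mulrC; apply: le_lt_trans.
by rewrite ler_wpM2r ?nrm_ge0// lerDl.
Qed.

(** A strict bound on the essential norm that keeps its witness [C] at hand in place of an
    infimum. *)
Definition ess_lt X Y (T : bounded_op X Y) (r : R) :=
  exists2 C : bounded_op X Y, finitely_coverable C & nrm (T - C) < r.

Lemma ess_lt_nrm X Y (T : bounded_op X Y) r : nrm T < r -> ess_lt T r.
Proof. by exists 0; rewrite ?subr0//; exact: finitely_coverable0. Qed.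

Lemma ess_lt_compact X (T C : bounded_op X X) r :
  compact_op C -> nrm (T + C) < r -> ess_lt T r.
Proof.
move=> /compact_finitely_coverable cC lt; exists (- C); last by rewrite opprK.
by rewrite -scaleN1r; exact: finitely_coverableZ.
Qed.

(** The product [(S - C) (T - D)] differs from [S T] by the totally bounded [C T + (S - C) D]. *)
Lemma ess_lt_comp X (S T : bounded_op X X) r s :
  ess_lt S r -> ess_lt T s -> ess_lt (op_comp S T) (r * s).
Proof.
move=> [C cC rS] [D cD sT].
exists (op_comp C T + op_comp (S - C) D).
  apply: finitely_coverableD; first exact: finitely_coverable_compr.
  exact: finitely_coverable_compl.
have -> : op_comp S T - (op_comp C T + op_comp (S - C) D) = op_comp (S - C) (T - D).
  apply: bounded_op_ext => x.
  rewrite -[LHS]/(S (T x) - (C (T x) + (S - C) (D x))).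
  have e : (S - C) (T x - D x) = S (T x) - C (T x) - (S - C) (D x).
    exact: linearB.
  by rewrite -[RHS]/((S - C) (T x - D x)) e opprD addrA.
apply: le_lt_trans (nrm_comp _ _) _.
by apply: ltr_pM => //; exact: nrm_ge0.
Qed.

Lemma ess_ltZ X (T : bounded_op X X) (a : K) r :
  a != 0 -> ess_lt T r -> ess_lt (a *: T) (nrm a * r).
Proof.
move=> a0 [C cC rT]; exists (a *: C); first exact: finitely_coverableZ.
by rewrite -scalerBr nrmZ ltr_pM2l// nrm_gt0.
Qed.

Lemma ess_ltZrc X (T : bounded_op X X) (s r : R) :
  0 < s -> ess_lt T r -> ess_lt (rc s *: T) (s * r).
Proof.
move=> s0 Tr; rewrite -[s in s * r]gtr0_norm// -(@nrm_rc _ k); apply: ess_ltZ => //.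
by rewrite -(@rc0 R k) gt_eqF// lt_rc.
Qed.

Lemma ess_lt_normalize X (T : bounded_op X X) (r : R) :
  0 < r -> ess_lt T r -> ess_lt (rc r^-1 *: T) 1.
Proof.
move=> r0 Tr; have <- : r^-1 * r = 1 by rewrite mulVf// gt_eqF.
by apply: ess_ltZrc; rewrite ?invr_gt0.
Qed.

Lemma ess_lt_sum X (I : finType) (c : I -> R) (T : I -> bounded_op X X) (r : R) :
  (forall i, 0 <= c i) -> \sum_i c i <= 1 -> 0 < r ->
  (forall i, ess_lt (T i) r) -> ess_lt (\sum_i rc (c i) *: T i) r.
Proof.
move=> c0 c1 r0 hT.
have /choice[C CP] : forall i, exists C : bounded_op X X,
    finitely_coverable C /\ nrm (T i - C) < r.
  by move=> i; have [C] := hT i; exists C.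
exists (\sum_i rc (c i) *: C i).
  apply: (big_ind (fun C => finitely_coverable C)).
  - exact: finitely_coverable0.
  - exact: finitely_coverableD.
  - by move=> i _; apply: finitely_coverableZ; exact: (CP i).1.
rewrite -sumrB.
(* The [c i] may all be 0, so termwise strictness does not suffice: failure of the bound forces
   every [c i] to vanish, which contradicts [0 < r]. *)
apply: le_lt_trans (nrm_sum _ _ _) _; rewrite ltNge; apply/negP => ge.
have n0 i : 0 <= r - nrm (T i - C i) by rewrite subr_ge0 ltW// (CP i).2.
have : \sum_i c i * (r - nrm (T i - C i)) <= 0.
  under eq_bigr do rewrite mulrBr.
  rewrite sumrB subr_le0 -mulr_suml; apply: (@le_trans _ _ r).
    by rewrite ler_piMl// ltW.
  apply: le_trans ge _; apply: ler_sum => i _.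
  by rewrite -scalerBr nrmZrc ger0_norm.
move=> le0; have c00 i : c i = 0.
  apply/eqP; have := psumr_eq0P (fun i _ => mulr_ge0 (c0 i) (n0 i)).
  have s0 : \sum_i c i * (r - nrm (T i - C i)) = 0.
    by apply/eqP; rewrite eq_le le0 sumr_ge0// => l _; rewrite mulr_ge0.
  move=> /(_ predT s0 i isT)/eqP; rewrite mulf_eq0 => /orP[//|].
  by rewrite gt_eqF// subr_gt0 (CP i).2.
move: ge; rewrite big1 ?leNgt ?r0// => i _.
by rewrite c00 rc0 !scale0r subrr nrm0.
Qed.

End essential_norm.

(** * Algebras without resolving functionals *)

Section no_resolving_functional.
Context {R : realType} {k : scalar_kind}.
Local Notation K := (scalar_field R k).
Context {X : normedModType K} (A : set (bounded_op X X)).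
Hypothesis Aalg : subalgebra A.
Hypothesis nres : ~ exists (x : dual (dual X)) (y : dual X),
  [/\ x != 0, y != 0 & resolving A x y].

Local Notation D := (bounded_op X K^o).

Lemma algZ a T : A T -> A (a *: T).
Proof. by case: Aalg => A0 Al _ AT; rewrite -[_ *: _]addr0; exact: Al. Qed.

Lemma algD S T : A S -> A T -> A (S + T).
Proof. by case: Aalg => _ Al _ AS AT; rewrite -[S]scale1r; exact: Al. Qed.

Lemma algN T : A T -> A (- T).
Proof. by move=> AT; rewrite -scaleN1r; exact: algZ. Qed.

Lemma algB S T : A S -> A T -> A (S - T).
Proof. by move=> AS /algN; exact: algD. Qed.

Lemma algM S T : A S -> A T -> A (op_comp S T).
Proof. by case: Aalg => _ _; apply. Qed.

(** Once [y] is rotated so that [F y] is non-negative, such an [F] would be resolving, with 0 on the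
    left-hand side. *)
Lemma no_annihilator (F : bounded_op D K^o) (y : D) :
  F != 0 -> y != 0 -> ~ forall T, A T -> F (op_comp y T) = 0.
Proof.
move=> F0 y0 FT; apply: nres.
have [u u1 uF] := phaseP (F y).
have u0 : u != 0.
  by apply/eqP => u0; move: u1; rewrite u0 nrm0 => /eqP; rewrite eq_sym oner_eq0.
have Fuy (S : D) : F (u *: S) = u * F S by exact: linearZ.
exists F, (u *: y); split=> //; first by rewrite scaler_eq0 negb_or u0.
move=> T AT.
have -> : F (adjoint T (u *: y)) = 0.
  have -> : adjoint T (u *: y) = u *: op_comp y T :> D.
    by apply: bounded_op_ext => v.
  by rewrite Fuy FT// mulr0.
rewrite normr0 Fuy uF mulr_ge0//; last by rewrite -(@rc0 R k) le_rc nrm_ge0.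
have [_] := ess_normP T; apply => _ [C _ <-] //.
Qed.

(** If a functional [f] vanished on the orbit, evaluation at [v], as an element of the bidual, would
    vanish at every [op_comp f T]. *)
Lemma dense_orbit (v : X) : v != 0 -> forall u, adherent [set T v | T in A] u.
Proof.
move=> v0 u; apply: contrapT => nu.
have sL : subspace [set T v | T in A].
  split; first by exists 0 => //; case: Aalg.
  by move=> a _ _ [S AS <-] [T AT <-]; exists (a *: S + T) => //; case: Aalg => _ + _; apply.
have [f fu fT] := subspace_separation sL nu.
have [||F FE] := @bounded_op_ex R k D K^o (fun g : D => g v) (nrm v).
- by [].
- by move=> g; rewrite mulrC; exact: (nrm_op_app g v).
have [h hv] := functional_ex v0.
apply: (@no_annihilator F f).
- by apply/eqP => F0; have := FE h; rewrite F0 hv => /esym/eqP; rewrite oner_eq0.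
- by apply/eqP => f0; move: fu; rewrite f0 => /esym/eqP; rewrite oner_eq0.
- by move=> T AT; rewrite FE; apply: fT; exists T.
Qed.

(* The set [W] of the proof is the closure of the orbit of [y] under the operators of [A]
   of essential norm less than [1]; it is invariant under these operators, hence a
   functional which supports [W] at a point [w0] is resolving together with [w0]. *)
Lemma dense_essential_orbit (y : D) : y != 0 ->
  forall w, adherent [set op_comp y T | T in [set T | A T /\ ess_lt T 1]] w.
Proof.
move=> y0 z; apply: contrapT; set W0 := [set _ | _ in _] => nz.
pose W := [set w : D | adherent W0 w].
have W0W w : W0 w -> W w by move=> W0w e e0; exists w; rewrite ?subrr ?nrm0.
have W00 : W0 0.
  exists 0; last by apply: bounded_op_ext => v; exact: linear0.
  by split; [case: Aalg|apply: ess_lt_nrm; rewrite nrm0].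
have clW w : adherent W w -> W w.
  move=> aw e e0; have e2 : 0 < e / 2 by rewrite divr_gt0.
  have [w1 W1 h1] := aw _ e2; have [w2 W2 h2] := W1 _ e2.
  exists w2; first exact: W2; apply: le_lt_trans (nrm_dist w1 w w2) _.
  by rewrite [e]splitr ltrD.
(* Scalars of [K] with this bound give convexity and stability under phases at once. *)
have W0c a b S T : nrm a + nrm b <= 1 -> W0 S -> W0 T -> W0 (a *: S + b *: T).
  move=> ab [S' [AS [C cC hC]] <-] [T' [AT [E cE hE]] <-].
  exists (a *: S' + b *: T'); last first.
    apply: bounded_op_ext => v.
    by rewrite -[LHS]/(y (a *: S' v + b *: T' v)) linearD !linearZ.
  split; first by apply: algD; exact: algZ.
  exists (a *: C + b *: E).
    by apply: finitely_coverableD; exact: finitely_coverableZ.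
  rewrite opprD addrACA -!scalerBr; apply: le_lt_trans (nrmD _ _) _.
  rewrite !nrmZ; set s := nrm (S' - C) in hC *; set t := nrm (T' - E) in hE *.
  have a0 := nrm_ge0 a; have b0 := nrm_ge0 b.
  pose m := Num.max s t.
  have m1 : m < 1 by rewrite gt_max hC.
  have m0 : 0 <= m by rewrite le_max nrm_ge0.
  apply: le_lt_trans m1; apply: (@le_trans _ _ ((nrm a + nrm b) * m)).
    by rewrite mulrDl lerD// ler_wpM2l// le_max lexx ?orbT.
  by rewrite ler_piMl.
have Wc a b S T : nrm a + nrm b <= 1 -> W S -> W T -> W (a *: S + b *: T).
  move=> ab WS WT e e0.
  have [S' S1 S2] := WS _ e0; have [T' T1 T2] := WT _ e0.
  exists (a *: S' + b *: T'); first exact: W0c.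
  rewrite opprD addrACA -!scalerBr; apply: le_lt_trans (nrmD _ _) _.
  rewrite !nrmZ; set s := nrm (S - S') in S2 *; set t := nrm (T - T') in T2 *.
  have a0 := nrm_ge0 a; have b0 := nrm_ge0 b.
  pose m := Num.max s t.
  have m1 : m < e by rewrite gt_max S2.
  have m0 : 0 <= m by rewrite le_max nrm_ge0.
  apply: le_lt_trans m1; apply: (@le_trans _ _ ((nrm a + nrm b) * m)).
    by rewrite mulrDl lerD// ler_wpM2l// le_max lexx ?orbT.
  by rewrite ler_piMl.
have cD : seq_complete (D : normedModType K).
  exact/bounded_op_complete/scalar_complete.
have [||w0 [f [Ww0 [fD fZ fn fW [z1 fz1]]]]] := bishop_phelps cD _ clW _ nz.
- by exists 0; exact: W0W.
- move=> u v t Wu Wv /andP[t0 t1]; apply: Wc => //.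
  by rewrite !nrm_rc !ger0_norm ?subr_ge0// addrC subrK.
have [F Ff] := real_functional_extension fD fZ fn.
have FZ a (S : D) : F (a *: S) = a * F S by exact: linearZ.
have F0 : F != 0.
  apply/eqP => F0; have := Ff z1; rewrite F0 => e.
  have : re (0 : K) = f z1 by [].
  by rewrite -[X in re X](@rc0 R k) rcK => e'; rewrite -e' ltxx in fz1.
have Wu u S : nrm u = 1 -> W S -> W (u *: S).
  move=> u1 WS; rewrite -[_ *: _]addr0 -(scale0r S); apply: Wc => //.
  by rewrite u1 nrm0 addr0.
have [u u1 uF] := phaseP (F w0).
pose m := nrm (F w0 : K).
have Fm S : W S -> nrm (F S : K) <= m.
  move=> WS; have [a a1 aF] := phaseP (F S).
  have := fW _ (Wu _ _ a1 WS); rewrite -Ff FZ aF rcK => /le_trans; apply.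
  by rewrite -Ff re_le_nrm.
(* Composition with [T / r] maps [W] into itself, and [m] is the maximum of [|F|] on [W]. *)
have FT T (r : R) : A T -> 0 < r -> ess_lt T r -> nrm (F (op_comp (u *: w0) T) : K) <= r * m.
  move=> AT r0 Tr; rewrite -ler_pdivrMl//.
  have -> : r^-1 * nrm (F (op_comp (u *: w0) T) : K) =
      nrm (F (op_comp (u *: w0) (rc r^-1 *: T)) : K).
    have -> : op_comp (u *: w0) (rc r^-1 *: T) = rc r^-1 *: op_comp (u *: w0) T.
      apply: bounded_op_ext => v.
      by rewrite -[LHS]/(u * w0 (rc r^-1 *: T v)) linearZ mulrCA.
    by rewrite FZ nrmM nrm_rc gtr0_norm ?invr_gt0.
  set T' := rc r^-1 *: T.
  have AT' : A T' by exact: algZ.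
  have T'1 : ess_lt T' 1 by exact: ess_lt_normalize.
  apply: Fm => e e0.
  have T0 : 0 < nrm T' + 1 by rewrite ltr_wpDl// nrm_ge0.
  have [_ [S [AS S1] <-] h] := Wu u w0 u1 Ww0 _ (divr_gt0 e0 T0).
  exists (op_comp y (op_comp S T')).
    by exists (op_comp S T') => //; split; [exact: algM|rewrite -[1]mulr1; exact: ess_lt_comp].
  have -> : op_comp (u *: w0) T' - op_comp y (op_comp S T') =
      op_comp (u *: w0 - op_comp y S) T' by apply: bounded_op_ext.
  apply: le_lt_trans (nrm_comp _ _) _; move: h; rewrite ltr_pdivlMr//; apply: le_lt_trans.
  by rewrite ler_wpM2l ?nrm_ge0// lerDl.
(* For [m = 0] the functional vanishes on [W], hence annihilates the orbit of [y] under [A].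
   Otherwise [w0] is non-zero and [FT] is the resolving inequality. *)
have [m0|m0] := eqVneq m 0.
  apply: (@no_annihilator F y F0 y0) => T AT.
  have Tr : ess_lt T (nrm T + 1) by apply: ess_lt_nrm; rewrite ltrDl.
  have r0 : 0 < nrm T + 1 by rewrite ltr_wpDl// nrm_ge0.
  have yT : W (op_comp y (rc (nrm T + 1)^-1 *: T)).
    apply: W0W; exists (rc (nrm T + 1)^-1 *: T) => //.
    by split; [exact: algZ|exact: ess_lt_normalize].
  have := Fm _ yT; rewrite m0.
  have -> : op_comp y (rc (nrm T + 1)^-1 *: T) = rc (nrm T + 1)^-1 *: op_comp y T.
    by apply: bounded_op_ext => v; rewrite -[LHS]/(y (rc _ *: T v)) linearZ.
  rewrite FZ nrmM nrm_rc gtr0_norm ?invr_gt0// => h.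
  apply: nrm_eq0; apply/eqP; rewrite eq_le nrm_ge0 andbT.
  by move: h; rewrite ler_pdivrMl// mulr0.
have {}m0 : 0 < m by rewrite lt_def m0 nrm_ge0.
apply: nres; exists F, (u *: w0).
have Fw : F (u *: w0) = rc m by rewrite FZ uF.
split=> //.
  apply/eqP => e; move: Fw; rewrite e linear0 => /(congr1 (@nrm R k K)).
  by rewrite nrm0 nrm_rc gtr0_norm// => h; rewrite -h ltxx in m0.
move=> T AT; rewrite Fw -rc_nrm.
have rm0 : 0 < rc m :> K by rewrite -(@rc0 R k) lt_rc.
rewrite -ler_pdivrMr// -rcV -rcM.
have [_] := ess_normP T; apply => _ [C cC <-].
rewrite -rc_nrm (@le_rc R k) ler_pdivrMr//.
apply/ler_addgt0Pr => e e0.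
pose r := nrm (T + C) + e / m.
have em : 0 < e / m by rewrite divr_gt0.
have r0 : 0 < r by rewrite ltr_wpDl// nrm_ge0.
have : ess_lt T r by apply: ess_lt_compact cC _; rewrite ltrDl.
by move=> /(FT T r AT r0); rewrite mulrDl divfK// gt_eqF.
Qed.

End no_resolving_functional.

(** * Weak-star compactness and the finite family of operators *)

Section finite_cover.
Context {R : realType} {k : scalar_kind}.
Local Notation K := (scalar_field R k).

Lemma nrm_op_le_ball (X Y : normedModType K) (T : bounded_op X Y) (M : R) :
  0 <= M -> (forall x, nrm x <= 1 -> nrm (T x) <= M) -> nrm T <= M.
Proof.
move=> M0 TM; apply: nrm_op_le => // x.
have [->|x0] := eqVneq x 0; first by rewrite linear0 !nrm0 mulr0.
have x1 := nrm_gt0 x0; have xi : 0 < (nrm x)^-1 by rewrite invr_gt0.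
have := TM (rc (nrm x)^-1 *: x).
rewrite linearZ !nrmZrc (gtr0_norm xi) mulVf ?gt_eqF// => /(_ (lexx _)).
by rewrite ler_pdivrMl// mulrC.
Qed.

Lemma finitely_coverable_net (X Y : normedModType K) (C : bounded_op X Y) (e : R) :
  finitely_coverable C -> 0 < e ->
  exists (I : finType) (p : I -> X), (forall i, nrm (p i) <= 1) /\
    forall x, nrm x <= 1 -> exists i, nrm (C x - C (p i)) < e.
Proof.
move=> cC e0; have [I [h hC]] := cC e e0.
pose p i := xget 0 [set x | nrm x <= 1 /\ h x = i].
have p1 i : nrm (p i) <= 1.
  by rewrite /p; case: xgetP => [x _ []//|_]; rewrite nrm0.
exists I, p; split=> // x x1; exists (h x); apply: hC => //.
by rewrite /p; case: xgetP => [y _ []//|/(_ x)[]].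
Qed.

Context {X : normedModType K}.
Local Notation D := (bounded_op X K^o).

(* Weak-star compactness of the balls of the dual (Banach-Alaoglu) *)
Lemma ultra_weak_limit (U : set_system D) (y0 : D) (r : R) : UltraFilter U ->
  U [set z | nrm (z - y0) <= r] ->
  exists2 z0 : D, nrm (z0 - y0) <= r &
    forall x (e : R), 0 < e -> U [set z | nrm (z x - z0 x : K) < e].
Proof.
move=> UU Ur; have zM z : nrm (z - y0) <= r -> nrm z <= r + nrm y0.
  by have := nrm_sub z y0; lra.
have [z1 z1r] := ultra_ex UU Ur.
have r0 : 0 <= r := le_trans (nrm_ge0 _) z1r.
have /choice[f fP] : forall x, exists l : K, forall e : R, 0 < e ->
    U [set z : D | nrm (z x - l : K) < e].
  move=> x; apply: (@ultra_lim_scalar R k D U (fun z => z x) ((r + nrm y0) * nrm x)) => //.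
  apply: ultraS UU _ Ur => z /= /zM h; apply: le_trans (nrm_op_app z x) _.
  by rewrite ler_wpM2r ?nrm_ge0.
have zx0 z x : nrm (z - y0) <= r -> nrm (z x - y0 x : K) <= r * nrm x.
  move=> h; apply: le_trans (nrm_op_app (z - y0) x) _.
  by rewrite ler_wpM2r ?nrm_ge0.
have fb x : nrm (f x - y0 x : K) <= r * nrm x.
  apply/ler_addgt0Pr => e e0.
  have [z [/= zr z2]] := ultra_ex UU (ultraI UU Ur (fP x e e0)).
  apply: le_trans (nrm_dist (z x : K) _ _) _; rewrite nrmB addrC.
  by apply: lerD; [exact: zx0|exact: ltW].
have [||z0 zE] := @bounded_op_ex R k X K^o f (r + nrm y0).
- move=> a u v; apply/eqP; rewrite -subr_eq0; apply/eqP/nrm_eq0/norm_small0 => e e0.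
  rewrite ger0_norm ?nrm_ge0//; have a0 := nrm_ge0 a.
  have a2 : 0 < 2 + nrm a by lra.
  have d0 : 0 < e / (2 + nrm a) by rewrite divr_gt0.
  have [z [/= h1 [h2 h3]]] := ultra_ex UU (ultraI UU (fP u _ d0)
    (ultraI UU (fP v _ d0) (fP (a *: u + v) _ d0))).
  have -> : f (a *: u + v) - (a * f u + f v) =
      - (z (a *: u + v) - f (a *: u + v)) + (a * (z u - f u) + (z v - f v)).
    have -> : z (a *: u + v) = a * z u + z v by exact: linearP.
    by ring.
  apply: le_trans (nrmD _ _) _; rewrite nrmN.
  apply: le_trans (lerD (lexx _) (nrmD _ _)) _; rewrite nrmM.
  have : nrm a * nrm (z u - f u : K) <= nrm a * (e / (2 + nrm a)).
    by rewrite ler_wpM2l// ltW.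
  have : (2 + nrm a) * (e / (2 + nrm a)) = e by rewrite mulrC divfK// gt_eqF.
  by lra.
- move=> x; rewrite -[f x](subrK (y0 x : K)) mulrDl.
  apply: le_trans (nrmD (f x - y0 x : K) (y0 x : K)) _.
  by apply: lerD; [exact: fb|exact: (nrm_op_app y0 x)].
exists z0; last by move=> x e e0; rewrite zE; exact: fP.
by apply: nrm_op_le => // x; rewrite -[X in nrm X]/(z0 x - y0 x) zE; exact: fb.
Qed.

Context (A : set (bounded_op X X)).
Hypothesis Aalg : subalgebra A.
Hypothesis nres : ~ exists (x : dual (dual X)) (y : dual X),
  [/\ x != 0, y != 0 & resolving A x y].

Lemma orbit_approx (y w : D) (r e : R) : y != 0 -> 0 < r -> 0 < e ->
  exists T, [/\ A T, ess_lt T r & nrm (op_comp y T - w) < e].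
Proof.
move=> y0 r0 e0.
have [_ [T [AT T1] <-] h] :=
  dense_essential_orbit Aalg nres y0 (rc r^-1 *: w) (divr_gt0 e0 r0).
exists (rc r *: T); split; first exact: algZ.
  by rewrite -[r in ess_lt _ r]mulr1; exact: ess_ltZrc.
have -> : op_comp y (rc r *: T) - w = - (rc r *: (rc r^-1 *: w - op_comp y T)).
  rewrite scalerBr scalerA -rcM divff ?gt_eqF// rc1 scale1r opprB; congr (_ - _).
  by apply: bounded_op_ext => v; exact: linearZ.
by rewrite nrmN nrmZrc gtr0_norm// mulrC -ltr_pdivlMr.
Qed.

(** If no finite family works, the sets [far s] generate a filter on the ball. A weak-star limit
    [z0] of a finer ultrafilter is non-zero, so some [T] in [A] sends it close to [y0]; the totally
    bounded part of [T] carries this over to many [z], contradicting [far [:: T]]. *)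
Lemma finite_cover (y0 : D) : nrm y0 = 2 ->
  exists n (T : 'I_n -> bounded_op X X), (forall i, A (T i) /\ ess_lt (T i) 1) /\
    forall z : D, nrm (z - y0) <= 1 ->
      exists i, nrm (op_comp z (T i) - y0) < 9%:R / 10%:R.
Proof.
move=> y02; apply: contrapT => ncov.
pose good T := A T /\ ess_lt T 1.
pose far (s : seq (bounded_op X X)) := [set z : D | nrm (z - y0) <= 1 /\
  forall T, T \in s -> 9%:R / 10%:R <= nrm (op_comp z T - y0)].
have far0 s : (forall T, T \in s -> good T) -> far s !=set0.
  move=> sg; apply: contrapT => nfar; apply: ncov.
  exists (size s), (tnth (in_tuple s)); split=> [i|z z1].
    by apply: sg; exact: mem_tnth.
  apply: contrapT => nz; apply: nfar; exists z; split=> // T Ts.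
  rewrite leNgt; apply/negP => lt; apply: nz.
  have is_ : (index T s < size s)%N by rewrite index_mem.
  by exists (Ordinal is_); rewrite (tnth_nth 0) /= nth_index.
pose F : set_system D := [set P | exists2 s, (forall T, T \in s -> good T) & far s `<=` P].
have PF : ProperFilter F.
  apply: Build_ProperFilter_ex.
    by move=> P [s /far0[z zs] sP]; exists z; exact: sP.
  split.
  - by exists [::].
  - move=> P Q [s sg sP] [t tg tQ]; exists (s ++ t).
      by move=> T; rewrite mem_cat => /orP[/sg|/tg].
    move=> z [z1 zst]; split; [apply: sP|apply: tQ]; split=> // T Ts;
    by apply: zst; rewrite mem_cat Ts ?orbT.
  - by move=> P Q PQ [s sg sP]; exists s => // z /sP/PQ.
have [U [UU FU]] := ultraFilterLemma PF.
have U1 : U [set z | nrm (z - y0) <= 1].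
  by apply: FU; exists [::] => // z [].
have [z0 z01 z0lim] := ultra_weak_limit UU U1.
have z00 : z0 != 0.
  by apply/eqP => e; move: z01; rewrite e sub0r nrmN y02; lra.
have r0 : 0 < 10%:R^-1 :> R by rewrite invr_gt0.
have e0 : 0 < 4%:R^-1 :> R by rewrite invr_gt0.
(* The error for [z] is at most 1/4 + 3/20 + 2/10 = 6/10, below 9/10: the three terms come from
   [z0], from [C] on a net of mesh 1/20, and from [T - C], with [nrm (z - z0) <= 2]. *)
have [T [AT [C cC TC] Ty]] := orbit_approx y0 z00 r0 e0.
have UT : U [set z | 9%:R / 10%:R <= nrm (op_comp z T - y0)].
  apply: FU; exists [:: T].
    move=> S; rewrite inE => /eqP ->; split=> //; exists C => //; lra.
  by move=> z [_]; apply; rewrite inE.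
have d0 : 0 < 20%:R^-1 :> R by rewrite invr_gt0.
have [I [p [p1 pC]]] := finitely_coverable_net cC d0.
have UI := ultra_forall UU (fun i => z0lim (C (p i)) _ d0).
have [z [/= z1 [z2 z3]]] := ultra_ex UU (ultraI UU U1 (ultraI UU UT UI)).
have zz : nrm (z - z0) <= 2 by have := nrm_dist y0 z z0; rewrite (nrmB y0); lra.
have h1 : nrm (op_comp (z - z0) C) <= 3%:R / 20%:R.
  apply: nrm_op_le_ball; first by lra.
  move=> x x1; have [i xi] := pC x x1.
  have -> : op_comp (z - z0) C x =
      (z - z0) (C x - C (p i)) + (z (C (p i)) - z0 (C (p i))).
    rewrite linearB -[op_comp (z - z0) C x]/((z - z0) (C x)).
    by rewrite -[z _ - z0 _]/((z - z0) (C (p i))) subrK.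
  have h : nrm (z - z0) * nrm (C x - C (p i)) <= 2 * 20%:R^-1.
    exact: (ler_pM (nrm_ge0 _) (nrm_ge0 _) zz (ltW xi)).
  apply: le_trans (nrmD (_ : K) (_ : K)) _.
  apply: (@le_trans _ _ (2 * 20%:R^-1 + 20%:R^-1)); last by lra.
  apply: lerD; last exact: ltW (z3 i).
  by apply: le_trans h; exact: nrm_op_app.
have h2 : nrm (op_comp (z - z0) (T - C)) <= 2 / 10%:R.
  apply: le_trans (nrm_comp _ _) _.
  by have := ler_pM (nrm_ge0 _) (nrm_ge0 _) zz (ltW TC); lra.
have e : op_comp z T - y0 = (op_comp z0 T - y0) +
    (op_comp (z - z0) C + op_comp (z - z0) (T - C)).
  have -> : op_comp (z - z0) C + op_comp (z - z0) (T - C) = op_comp z T - op_comp z0 T.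
    apply: bounded_op_ext => x.
    have l : (z - z0) (T x - C x) = (z - z0) (T x) - (z - z0) (C x) by exact: linearB.
    rewrite -[LHS]/((z - z0) (C x) + (z - z0) (T x - C x)) l addrC subrK//.
  by rewrite [RHS]addrC addrA subrK.
have := nrmD (op_comp z0 T - y0) (op_comp (z - z0) C + op_comp (z - z0) (T - C)).
have := nrmD (op_comp (z - z0) C) (op_comp (z - z0) (T - C)).
rewrite -e; lra.
Qed.

End finite_cover.

(** * Quasi-inverses *)

Lemma contraction_fixpoint (R : realType) (k : scalar_kind)
    (V : normedModType (scalar_field R k)) (B : set V) (g : V -> V) (q : R) :
  seq_complete V -> B !=set0 -> (forall v, adherent B v -> B v) ->
  (forall v, B v -> B (g v)) -> 0 <= q -> q < 1 ->
  (forall u v, nrm (g u - g v) <= q * nrm (u - v)) ->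
  exists2 v, B v & g v = v.
Proof.
move=> cV [v0 Bv0] clB gB q0 q1 gq.
pose u n := iter n g v0.
have Bu n : B (u n) by elim: n => //= n; exact: gB.
pose d := nrm (u 1 - u 0) / (1 - q).
have q10 : 0 < 1 - q by rewrite subr_gt0.
have ud m : nrm (u m - u 0) <= d.
  elim: m => [|m IH]; first by rewrite subrr nrm0 divr_ge0 ?nrm_ge0// ltW.
  apply: le_trans (nrm_dist (u 1) _ _) _.
  have : nrm (u m.+1 - u 1) <= q * d by apply: le_trans (gq _ _) _; rewrite ler_wpM2l.
  have : (1 - q) * d = nrm (u 1 - u 0) by rewrite mulrC divfK// gt_eqF.
  by rewrite mulrBl mul1r; lra.
have uq n m : nrm (u (n + m)%N - u n) <= q ^+ n * d.
  elim: n => [|n IH]; first by rewrite mul1r.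
  by apply: le_trans (gq _ _) _; rewrite exprS -mulrA ler_wpM2l.
have d0 : 0 <= d := le_trans (nrm_ge0 _) (ud 0%N).
have qlim (e : R) : 0 < e -> exists N, q ^+ N * d < e.
  move=> e0; have d1 : 0 < d + 1 by rewrite ltr_wpDl.
  have /cvgrPdist_lt/(_ _ (divr_gt0 e0 d1))[N _ hN] : (GRing.exp q : nat -> R) @ \oo --> 0.
    by apply: cvg_expr; rewrite ger0_norm.
  exists N; have := hN N (leqnn N).
  rewrite /= sub0r normrN ger0_norm ?exprn_ge0// ltr_pdivlMr//; apply: le_lt_trans.
  by rewrite ler_wpM2l ?exprn_ge0// lerDl.
have cu : cauchy_seq u.
  move=> e e0; have e2 : 0 < e / 2 by rewrite divr_gt0.
  have [N hN] := qlim _ e2; exists N => m n Nm Nn.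
  have := uq N (m - N)%N; have := uq N (n - N)%N; rewrite !subnKC//.
  by have := nrm_dist (u N) (u m) (u n); rewrite (nrmB (u N)); lra.
have [l ul] := cV u cu.
exists l.
  by apply: clB => e /ul[N hN]; exists (u N) => //; rewrite nrmB hN.
apply/eqP; rewrite -subr_eq0; apply/eqP/nrm_eq0/norm_small0 => e e0.
have e2 : 0 < e / 2 by rewrite divr_gt0.
have [N hN] := ul _ e2; rewrite ger0_norm ?nrm_ge0//.
have := hN N.+1 (leqW (leqnn N)); have := hN N (leqnn N).
have := nrm_dist (u N.+1) (g l) l; have := gq l (u N); rewrite (nrmB l).
have : q * nrm (u N - l) <= nrm (u N - l) by rewrite ler_piMl ?nrm_ge0// ltW.
rewrite -[g (u N)]/(u N.+1); lra.
Qed.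

Section operator_ring.
Context (K : numFieldType) (X : normedModType K).

Lemma id_op_subproof : @id X \in @bounded_linear K X X.
Proof.
by apply/mem_set; split=> //; exists 1 => x; rewrite mul1r.
Qed.

Definition id_op : bounded_op X X := BoundedOp id_op_subproof.

Let compA : associative (@op_comp K X X X).
Proof. by move=> S T U; exact: bounded_op_ext. Qed.

Let comp1 : left_id id_op (@op_comp K X X X).
Proof. by move=> S; exact: bounded_op_ext. Qed.

Let compr1 : right_id id_op (@op_comp K X X X).
Proof. by move=> S; exact: bounded_op_ext. Qed.

Let compDl : left_distributive (@op_comp K X X X) +%R.
Proof. by move=> S T U; exact: bounded_op_ext. Qed.

Let compDr : right_distributive (@op_comp K X X X) +%R.
Proof. by move=> S T U; apply: bounded_op_ext => x; exact: linearD. Qed.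

HB.instance Definition _ :=
  GRing.Zmodule_isPzRing.Build (bounded_op X X) compA comp1 compr1 compDl compDr.

End operator_ring.

Section quasi_inverse.
Context {R : realType} {k : scalar_kind}.
Local Notation K := (scalar_field R k).
Context {X : normedModType K} (A : set (bounded_op X X)).
Implicit Types S T Q : bounded_op X X.

Lemma nrm_mul S T : nrm (S * T) <= nrm S * nrm T.
Proof. exact: nrm_comp. Qed.

Lemma nrm_1D Q : nrm (1 + Q) <= 1 + nrm Q.
Proof.
apply: le_trans (nrmD _ _) _; rewrite lerD2r; apply: nrm_op_le => // x.
by rewrite mul1r.
Qed.

(** Here [Q] is [T (1 - T)^-1], which can lie in [A] even when the identity does not. *)
Definition quasi_inverse T Q := [/\ A Q, (1 + Q) * (1 - T) = 1 & (1 - T) * (1 + Q) = 1].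

(** The resolvent identity. *)
Lemma quasi_inverse_diff T T' Q Q' : quasi_inverse T Q -> quasi_inverse T' Q' ->
  Q' - Q = (1 + Q') * (T' - T) * (1 + Q).
Proof.
move=> [_ _ r] [_ l _].
have -> : T' - T = (1 - T) - (1 - T') by rewrite opprB [RHS]addrC addrA subrK.
by rewrite mulrBr mulrBl l mul1r -mulrA r mulr1 opprD addrACA subrr add0r.
Qed.

(** Smallness of [T' - T] keeps [1 + nrm Q'] below [2 (1 + nrm Q)] in the resolvent identity. *)
Lemma quasi_inverse_near T T' Q Q' :
  quasi_inverse T Q -> quasi_inverse T' Q' ->
  nrm (T' - T) * (1 + nrm Q) <= 2^-1 ->
  nrm (Q' - Q) <= 2 * (1 + nrm Q) ^+ 2 * nrm (T' - T).
Proof.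
move=> qT qT' small; have e := quasi_inverse_diff qT qT'.
have Q0 := nrm_ge0 Q; have Q'0 := nrm_ge0 Q'; have D0 := nrm_ge0 (T' - T).
have h : nrm (Q' - Q) <= (1 + nrm Q') * (nrm (T' - T) * (1 + nrm Q)).
  rewrite e -mulrA; apply: le_trans (nrm_mul _ _) _.
  apply: ler_pM; rewrite ?nrm_ge0 ?nrm_1D//.
  by apply: le_trans (nrm_mul _ _) _; rewrite ler_wpM2l// nrm_1D.
have := nrm_sub Q' Q.
have : (1 + nrm Q') * (nrm (T' - T) * (1 + nrm Q)) <= (1 + nrm Q') * 2^-1.
  by rewrite ler_wpM2l// addr_ge0.
move=> h1 h2; have h3 : 1 + nrm Q' <= 2 * (1 + nrm Q) by lra.
apply: le_trans h _; apply: (@le_trans _ _ (2 * (1 + nrm Q) * (nrm (T' - T) * (1 + nrm Q)))).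
  by rewrite ler_wpM2r// mulr_ge0// addr_ge0.
by rewrite expr2 (mulrC (nrm (T' - T))) !mulrA.
Qed.

Hypothesis Aalg : subalgebra A.
Hypothesis Acl : forall T, adherent A T -> A T.
Hypothesis cX : seq_complete (bounded_op X X : normedModType K).

Let AM S T : A S -> A T -> A (S * T). Proof. exact: algM. Qed.

(** A left and a right inverse arise as fixed points of contractions of the closed set [A], and
    associativity identifies them. At [T = 0] this replaces the Neumann series. *)
Lemma quasi_inverse_perturb T T' Q : A T -> A T' -> quasi_inverse T Q ->
  nrm (T' - T) * (1 + nrm Q) < 1 -> exists Q', quasi_inverse T' Q'.
Proof.
move=> AT AT' [AQ lQ rQ] small; set D := T' - T in small.
have AD : A D by exact: algB.
have A0 : A !=set0 by exists 0; case: Aalg.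
have AE : A (D * (1 + Q)) by rewrite mulrDr mulr1; apply: algD => //; exact: AM.
have AE' : A ((1 + Q) * D) by rewrite mulrDl mul1r; apply: algD => //; exact: AM.
have q0 : 0 <= nrm D * (1 + nrm Q) by rewrite mulr_ge0// ?addr_ge0// nrm_ge0.
have [||L AL LE] := @contraction_fixpoint R k _ A
    (fun Z => Q + (1 + Z) * (D * (1 + Q))) _ cX A0 Acl _ q0 small.
- move=> Z AZ; rewrite mulrDl mul1r; apply: algD => //; apply: algD => //; exact: AM.
- move=> U Z; rewrite opprD addrACA subrr add0r -mulrBl opprD addrACA subrr add0r.
  apply: le_trans (nrm_mul _ _) _; rewrite mulrC ler_wpM2r ?nrm_ge0//.
  by apply: le_trans (nrm_mul _ _) _; rewrite ler_wpM2l ?nrm_ge0// nrm_1D.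
have [||L' AL' LE'] := @contraction_fixpoint R k _ A
    (fun Z => Q + ((1 + Q) * D) * (1 + Z)) _ cX A0 Acl _ q0 small.
- move=> Z AZ; rewrite mulrDr mulr1; apply: algD => //; apply: algD => //; exact: AM.
- move=> U Z; rewrite opprD addrACA subrr add0r -mulrBr opprD addrACA subrr add0r.
  apply: le_trans (nrm_mul _ _) _; rewrite ler_wpM2r ?nrm_ge0//.
  apply: le_trans (nrm_mul _ _) _; rewrite mulrC ler_wpM2l ?nrm_ge0// nrm_1D//.
have TE : 1 - T' = 1 - T - D by rewrite /D opprB addrA subrK.
have l : (1 + L) * (1 - T') = 1.
  rewrite TE mulrBr -[in X in X * (1 - T)]LE addrA mulrDl lQ -!mulrA lQ mulr1.
  by rewrite addrK.
have r : (1 - T') * (1 + L') = 1.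
  rewrite TE mulrBl -[in X in (1 - T) * X]LE' addrA mulrDr rQ !mulrA rQ mul1r.
  by rewrite addrK.
have e : 1 + L = 1 + L'.
  have : (1 + L) * ((1 - T') * (1 + L')) = 1 + L' by rewrite mulrA l mul1r.
  by rewrite r mulr1.
by exists L; split=> //; rewrite e.
Qed.

End quasi_inverse.

(** * Continuous functions on a simplex *)

Section simplex_continuity.
Context {R : realType} {I : finType}.
Implicit Types f g : (I -> R) -> R.

Lemma simplex_continuous_cst (a : R) : @simplex_continuous R I (fun=> a).
Proof. by move=> c _ e e0; exists 1 => // c' _ _; rewrite subrr normr0. Qed.

Lemma simplex_continuous_coord i : @simplex_continuous R I (fun c => c i).
Proof. by move=> c _ e e0; exists e. Qed.

Lemma simplex_continuousD f g : simplex_continuous f -> simplex_continuous g ->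
  simplex_continuous (fun c => f c + g c).
Proof.
move=> cf cg c sc e e0; have e2 : 0 < e / 2 by rewrite divr_gt0.
have [d d0 hd] := cf c sc _ e2; have [d' d'0 hd'] := cg c sc _ e2.
exists (Num.min d d') => [|c' sc' cc']; first by rewrite lt_min d0.
rewrite opprD addrACA; apply: le_lt_trans (ler_normD _ _) _.
rewrite [e]splitr ltrD//; [apply: hd|apply: hd'] => // j; apply: lt_le_trans (cc' j) _.
  by rewrite ge_min lexx.
by rewrite ge_min lexx orbT.
Qed.

Lemma simplex_continuousM f g : simplex_continuous f -> simplex_continuous g ->
  simplex_continuous (fun c => f c * g c).
Proof.
move=> cf cg c sc e e0.
pose a := `|g c| + 1; have a0 : 0 < a by rewrite ltr_wpDl.
pose b := `|f c| + 1; have b0 : 0 < b by rewrite ltr_wpDl.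
have ea : 0 < e / 2 / a by rewrite !divr_gt0.
have eb : 0 < Num.min 1 (e / 2 / b) by rewrite lt_min ltr01 !divr_gt0.
have [d d0 hd] := cf c sc _ ea; have [d' d'0 hd'] := cg c sc _ eb.
exists (Num.min d d') => [|c' sc' cc']; first by rewrite lt_min d0.
have {}hd : `|f c' - f c| < e / 2 / a.
  by apply: hd => // j; apply: lt_le_trans (cc' j) _; rewrite ge_min lexx.
have {}hd' : `|g c' - g c| < Num.min 1 (e / 2 / b).
  by apply: hd' => // j; apply: lt_le_trans (cc' j) _; rewrite ge_min lexx orbT.
move: hd'; rewrite lt_min => /andP[h1 h2].
have ga : `|g c'| <= a.
  by rewrite -[g c'](subrK (g c)) (le_trans (ler_normD _ _))// addrC lerD2l ltW.
have -> : f c' * g c' - f c * g c = (f c' - f c) * g c' + f c * (g c' - g c) by ring.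
apply: le_lt_trans (ler_normD _ _) _; rewrite !normrM [e]splitr; apply: ltr_leD.
  apply: (@le_lt_trans _ _ (`|f c' - f c| * a)); first by rewrite ler_wpM2l.
  by rewrite -ltr_pdivlMr.
apply: (@le_trans _ _ (b * `|g c' - g c|)); first by rewrite ler_wpM2r// lerDl.
by rewrite mulrC -ler_pdivlMr// ltW.
Qed.

Lemma simplex_continuous_sum (J : finType) (F : J -> (I -> R) -> R) :
  (forall j, simplex_continuous (F j)) -> simplex_continuous (fun c => \sum_j F j c).
Proof.
move=> cF; have : forall s : seq J, simplex_continuous (fun c => \sum_(j <- s) F j c).
  elim=> [|j s IH].
    rewrite (_ : (fun c => _) = fun=> 0); first exact: simplex_continuous_cst.
    by apply/funext => c; rewrite big_nil.
  rewrite (_ : (fun c => _) = fun c => F j c + \sum_(i <- s) F i c).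
    exact: simplex_continuousD.
  by apply/funext => c; rewrite big_cons.
exact.
Qed.

Lemma simplex_continuous_pos f : simplex_continuous f ->
  simplex_continuous (fun c => Num.max 0 (f c)).
Proof.
move=> cf c sc e e0; have [d d0 hd] := cf c sc _ e0; exists d => // c' sc' cc'.
have := hd c' sc' cc'; rewrite !ltr_norml => /andP[h1 h2].
by have [h3|h3] := leP 0 (f c); have [h4|h4] := leP 0 (f c'); lra.
Qed.

End simplex_continuity.

(** * The fixed point argument *)

Section no_quasi_inverse.
Context {R : realType} {k : scalar_kind}.
Local Notation K := (scalar_field R k).
Context {X : normedModType K} (A : set (bounded_op X X)).
Hypothesis Aalg : subalgebra A.
Hypothesis nres : ~ exists (x : dual (dual X)) (y : dual X),
  [/\ x != 0, y != 0 & resolving A x y].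
Local Notation D := (bounded_op X K^o).

(* In the proof, [z c - z c \o S c = c None *: y0], that is, [z c - y0] is the combination
   of the [z c \o T i - y0] with coefficients [c (Some i)].  A fixed point of the
   normalized [psi] would satisfy [psi i c > 0] whenever [c i > 0]: all the vectors
   [z c \o T i] which occur are close to [y0], so [z c] is close to [y0] and
   [psi None c = 0]; hence [c None = 0] and [z c = 0], which is not close to [y0]. *)
Lemma no_quasi_inverse (y0 : D) : nrm y0 = 2 ->
  exists T, [/\ A T, ess_lt T 1 & ~ exists Q, quasi_inverse A T Q].
Proof.
move=> y02; have [n [T [TA Tcov]]] := finite_cover Aalg nres y02.
apply: contrapT => nex.
(* The index [None] is the vertex that carries the operator 0. *)
pose S (c : option 'I_n -> R) := \sum_(i < n) rc (c (Some i)) *: T i.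
have sumI (c : option 'I_n -> R) : \sum_i c i = c None + \sum_(i < n) c (Some i).
  rewrite (bigD1 None)//=; congr (_ + _).
  rewrite (reindex_omap Some id) /=; last by case.
  by apply: eq_bigl => i; rewrite eqxx.
have sc1 (c : option 'I_n -> R) : simplex c -> \sum_(i < n) c (Some i) = 1 - c None.
  by move=> [_]; rewrite sumI => <-; rewrite addrC addKr.
have AS c : A (S c).
  apply: (big_ind (fun B => A B)).
  - by case: Aalg.
  - by move=> *; exact: algD.
  - by move=> i _; apply: algZ => //; case: (TA i).
have eS c : simplex c -> ess_lt (S c) 1.
  move=> sc; apply: ess_lt_sum => //.
  - by move=> i; case: sc.
  - by rewrite sc1// lerBlDr lerDl; case: sc.
  - by move=> i; case: (TA i).
have /choice[Q QP] : forall c, exists Q, simplex c -> quasi_inverse A (S c) Q.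
  move=> c; have [sc|nsc] := pselect (simplex c); last by exists 0.
  have [Q qQ] : exists Q, quasi_inverse A (S c) Q.
    by apply: contrapT => nQ; apply: nex; exists (S c); split=> //; exact: eS.
  by exists Q.
pose z c : D := rc (c None) *: op_comp y0 (1 + Q c).
have zS c : simplex c -> z c = op_comp (z c) (S c) + rc (c None) *: y0.
  move=> /QP[_ q _]; apply: bounded_op_ext => x.
  have h : y0 ((1 + Q c) (x - S c x)) = y0 x.
    exact: (congr1 (fun B : bounded_op X X => y0 (B x)) q).
  rewrite (linearB (1 + Q c)) (linearB y0) in h.
  rewrite -[z c x]/(rc (c None) * y0 ((1 + Q c) x)).
  rewrite -[RHS]/(rc (c None) * y0 ((1 + Q c) (S c x)) + rc (c None) * y0 x).
  by rewrite -mulrDr -h; congr (_ * _); rewrite [RHS]addrC subrK.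
have zy c : simplex c -> nrm (z c - y0) <=
    \sum_(i < n) c (Some i) * nrm (op_comp (z c) (T i) - y0).
  move=> sc.
  have -> : z c - y0 = \sum_(i < n) rc (c (Some i)) *: (op_comp (z c) (T i) - y0).
    under eq_bigr do rewrite scalerBr.
    rewrite sumrB -scaler_suml.
    have -> : \sum_(i < n) rc (c (Some i)) = rc (1 - c None) :> K.
      by rewrite -sc1//; elim/big_rec2: _ => [|i u v _ ->]; rewrite ?rc0 ?rcD.
    have -> : \sum_(i < n) rc (c (Some i)) *: op_comp (z c) (T i) = op_comp (z c) (S c).
      rewrite /S; elim/big_rec2: _ => [|i u v _ ->].
        by apply: bounded_op_ext => x; rewrite -[RHS]/(z c 0) linear0.
      by apply: bounded_op_ext => x; rewrite -[RHS]/(z c (_ *: _ + _)) linearP.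
    rewrite [in LHS]zS// rcD rc1 rcN scalerDl scale1r scaleNr opprD opprK addrA.
    by rewrite addrAC.
  apply: le_trans (nrm_sum _ _ _) _; apply: ler_sum => i _.
  by rewrite nrmZrc ger0_norm//; case: sc.
have zcont c : simplex c -> forall e : R, 0 < e -> exists2 d : R, 0 < d &
    forall c', simplex c' -> (forall j, `|c' j - c j| < d) -> nrm (z c' - z c) < e.
  move=> sc e e0.
  pose M := \sum_(i < n) nrm (T i).
  have M0 : 0 <= M by apply: sumr_ge0 => i _; exact: nrm_ge0.
  pose q := 1 + nrm (Q c).
  have q0 : 0 < q by rewrite ltr_wpDr ?nrm_ge0.
  (* A Lipschitz constant for [z] near [c], where [nrm y0 = 2] contributes a factor 2 to each term.
     The first bound in [d] below is what [quasi_inverse_near] requires. *)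
  pose L := 4 * q ^+ 2 * M + 2 * q.
  have L0 : 0 < L by rewrite ltr_wpDl ?mulr_gt0// !mulr_ge0// ?exprn_ge0// ltW.
  have Mq : 0 < 2 * (M + 1) * q by rewrite !mulr_gt0// ltr_wpDl.
  pose d := Num.min (2 * (M + 1) * q)^-1 (e / L / 2).
  have d0 : 0 < d by rewrite lt_min invr_gt0 Mq !divr_gt0.
  exists d => // c' sc' cc'.
  have SM : nrm (S c' - S c) <= d * M.
    rewrite /S -sumrB mulr_sumr; apply: le_trans (nrm_sum _ _ _) _.
    apply: ler_sum => i _; rewrite -scalerBl -rcN -rcD nrmZrc.
    by rewrite ler_wpM2r ?nrm_ge0// ltW.
  have dM : d * M * q <= 2^-1.
    apply: (@le_trans _ _ ((2 * (M + 1) * q)^-1 * (M + 1) * q)).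
      rewrite ler_wpM2r ?(ltW q0)// ler_pM ?(ltW d0)// ?lerDl//.
      by rewrite ge_min lexx.
    have M1 : M + 1 != 0 by rewrite gt_eqF// ltr_wpDl.
    by rewrite le_eqVlt; apply/orP; left; apply/eqP; field; rewrite M1 gt_eqF.
  have QQ : nrm (Q c' - Q c) <= 2 * q ^+ 2 * (d * M).
    apply: le_trans (quasi_inverse_near (QP c sc) (QP c' sc') _) _.
      by apply: le_trans dM; rewrite ler_wpM2r// ltW.
    by rewrite ler_wpM2l// mulr_ge0// exprn_ge0// ltW.
  have -> : z c' - z c = rc (c' None) *: op_comp y0 (Q c' - Q c) +
      rc (c' None - c None) *: op_comp y0 (1 + Q c).
    have -> : op_comp y0 (Q c' - Q c) = op_comp y0 (1 + Q c') - op_comp y0 (1 + Q c).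
      apply: bounded_op_ext => x.
      rewrite -[RHS]/(y0 (x + Q c' x) - y0 (x + Q c x)) -linearB opprD addrACA.
      by rewrite subrr add0r.
    by rewrite scalerBr rcD rcN scalerDl scaleNr addrA subrK.
  apply: le_lt_trans (nrmD _ _) _; rewrite !nrmZrc.
  have c'1 : `|c' None| <= 1.
    rewrite ger0_norm; last by case: sc'.
    case: sc' => c'0 <-; rewrite sumI lerDl sumr_ge0// => i _; exact: c'0.
  have h1 : `|c' None| * nrm (op_comp y0 (Q c' - Q c)) <= 1 * (2 * (2 * q ^+ 2 * (d * M))).
    apply: ler_pM => //; first exact: nrm_ge0.
    by apply: le_trans (nrm_comp _ _) _; rewrite y02 ler_wpM2l.
  have h2 : `|c' None - c None| * nrm (op_comp y0 (1 + Q c)) <= d * (2 * q).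
    apply: ler_pM => //; [exact: nrm_ge0|exact: ltW|].
    by apply: le_trans (nrm_comp _ _) _; rewrite y02 ler_wpM2l// nrm_1D.
  apply: le_lt_trans (lerD h1 h2) _.
  have -> : 1 * (2 * (2 * q ^+ 2 * (d * M))) + d * (2 * q) = d * L by rewrite /L; ring.
  have : d <= e / L / 2 by rewrite ge_min lexx orbT.
  have : e / L / 2 < e / L by have := divr_gt0 e0 L0; lra.
  by move=> h3 /le_lt_trans /(_ h3); rewrite ltr_pdivlMr.
have ncont (B : bounded_op X X) :
    simplex_continuous (fun c => nrm (op_comp (z c) B - y0)).
  move=> c sc e e0; have B0 : 0 < nrm B + 1 by rewrite ltr_wpDl// nrm_ge0.
  have [d d0 hd] := zcont c sc _ (divr_gt0 e0 B0).
  exists d => // c' sc' cc'; have := hd c' sc' cc'; rewrite ltr_pdivlMr//.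
  apply: le_lt_trans; apply: (@le_trans _ _ (nrm (op_comp (z c' - z c) B))); last first.
    by apply: le_trans (nrm_comp _ _) _; rewrite ler_wpM2l ?nrm_ge0// lerDl.
  have -> : op_comp (z c' - z c) B =
      (op_comp (z c') B - y0) - (op_comp (z c) B - y0).
    by rewrite opprB addrA subrK; exact: bounded_op_ext.
  have h (a b : D) : `|nrm a - nrm b| <= nrm (a - b).
    apply/ler_normlP; split; last exact: nrm_sub.
    by rewrite opprB nrmB; exact: nrm_sub.
  exact: (h (op_comp (z c') B - y0) (op_comp (z c) B - y0)).
pose s c := nrm (op_comp (z c) 1 - y0).
have sE c : s c = nrm (z c - y0).
  by rewrite /s; congr (nrm (_ - _)); exact: bounded_op_ext.
pose dd i c := nrm (op_comp (z c) (T i) - y0).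
(* [psi None] is positive for [s c > 9/10], and for [s c < 1] a [psi (Some j)] is positive as soon
   as [dd j c < 9/10]. These ranges overlap, so by [Tcov] the sum [Psi] is positive everywhere. *)
pose psi (i : option 'I_n) c := if i is Some j
  then Num.max 0 (1 - s c) * Num.max 0 (9%:R / 10%:R - dd j c)
  else Num.max 0 (s c - 9%:R / 10%:R).
have cN f : simplex_continuous f -> simplex_continuous (fun c : option 'I_n -> R => - f c).
  move=> cf; rewrite (_ : (fun c => _) = fun c => -1 * f c).
    by apply: simplex_continuousM => //; exact: simplex_continuous_cst.
  by apply/funext => c; rewrite mulN1r.
have cpsi i : simplex_continuous (psi i).
  case: i => [j|] /=.
    apply: simplex_continuousM; apply: simplex_continuous_pos;
      apply: simplex_continuousD; try exact: simplex_continuous_cst;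
      by apply: cN; exact: ncont.
  apply: simplex_continuous_pos; apply: simplex_continuousD; first exact: ncont.
  exact: simplex_continuous_cst.
have psi0 i c : 0 <= psi i c.
  by case: i => [j|]; rewrite /= ?mulr_ge0 ?le_max ?lexx.
pose Psi c := \sum_i psi i c.
have Psi0 c : 0 < Psi c.
  rewrite lt_def sumr_ge0// andbT; apply/negP => /eqP Psi0.
  have {}Psi0 i : psi i c = 0.
    by have := psumr_eq0P (fun i _ => psi0 i c) Psi0; apply.
  have s9 : s c <= 9%:R / 10%:R.
    by have := Psi0 None; rewrite /= /Num.max; case: ltP => // h1 h2; lra.
  have [|i hi] := Tcov (z c); first by rewrite -sE; lra.
  have /eqP := Psi0 (Some i); rewrite /= mulf_eq0 => /orP[] /eqP.
    by rewrite /Num.max; case: ltP; lra.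
  by rewrite /Num.max; case: ltP; rewrite /dd; lra.
(* These functions sum to 0 on the simplex, so they vanish where all are non-negative: such a [c] is
   a fixed point of [psi / Psi]. *)
have [|||c sc hc] := @dual_kkm R _ (None : option 'I_n) (fun i c => psi i c - c i * Psi c).
- move=> i; apply: simplex_continuousD => //; apply: cN.
  apply: simplex_continuousM; first exact: simplex_continuous_coord.
  exact: simplex_continuous_sum.
- move=> c [c0 c1]; apply: contrapT => h.
  have : \sum_i psi i c < \sum_i c i * Psi c.
    apply: ltr_sum => [|i _]; first by apply/hasP; exists None; rewrite ?mem_index_enum.
    rewrite -subr_lt0 ltNge; apply/negP => h'; apply: h; by exists i.
  by rewrite -mulr_suml c1 mul1r ltxx.
- by move=> c i _ ->; rewrite mul0r subr0.
have psiE i : psi i c = c i * Psi c.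
  have h : \sum_i (psi i c - c i * Psi c) = 0.
    by rewrite sumrB -mulr_suml; case: sc => _ ->; rewrite mul1r subrr.
  have := psumr_eq0P (fun i _ => hc i) h => /(_ i isT)/eqP.
  by rewrite subr_eq0 => /eqP.
have c0 := sc.1.
have s9 : s c <= 9%:R / 10%:R.
  rewrite sE; apply: le_trans (zy c sc) _.
  apply: (@le_trans _ _ (\sum_(i < n) c (Some i) * (9%:R / 10%:R))).
    apply: ler_sum => i _; have := c0 (Some i); rewrite le_eqVlt => /predU1P[<-|ci].
      by rewrite !mul0r.
    rewrite ler_pM2l//; have : 0 < psi (Some i) c by rewrite psiE mulr_gt0.
    rewrite /=; have [h|h _] := leP (9%:R / 10%:R - dd i c) 0.
      by rewrite mulr0 ltxx.
    by move: h; rewrite subr_gt0 => /ltW.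
  rewrite -mulr_suml sc1//; have := c0 None; lra.
have : psi None c = 0 by rewrite /=; apply: max_idPl; rewrite subr_le0.
rewrite psiE => /eqP; rewrite mulf_eq0 (gt_eqF (Psi0 c)) orbF => /eqP c00.
move: s9; rewrite sE /z c00 rc0 scale0r sub0r nrmN y02; lra.
Qed.

End no_quasi_inverse.

(** * A compact operator in the algebra *)

Section spectral_limit.
Context {R : realType} {k : scalar_kind}.
Local Notation K := (scalar_field R k).

Lemma ultra_cauchy_limit (V : normedModType K) (T : Type) (U : set_system T)
    (z : T -> V) : UltraFilter U -> seq_complete V ->
  (forall e : R, 0 < e -> exists2 S, U S & forall s t, S s -> S t -> nrm (z s - z t) < e) ->
  exists l, forall e : R, 0 < e -> U [set t | nrm (z t - l) < e].
Proof.
move=> UU cV zc.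
pose eps (n : nat) : R := n.+1%:R^-1.
have eps0 n : 0 < eps n by rewrite invr_gt0.
have epsP (e : R) : 0 < e -> exists N, forall n, (N <= n)%N -> eps n < e.
  move=> e0; exists (Num.truncn e^-1) => n hn.
  rewrite /eps invf_plt ?posrE//; apply: lt_le_trans (truncnS_gt _) _.
  by rewrite ler_nat ltnS.
have /choice[S SP] : forall n, exists S, U S /\
    forall s t, S s -> S t -> nrm (z s - z t) < eps n.
  by move=> n; have [S US SS] := zc _ (eps0 n); exists S.
have /choice[t tS] : forall n, exists t, S n t.
  by move=> n; exact: ultra_ex UU (SP n).1.
have tt n m : nrm (z (t n) - z (t m)) < eps n + eps m.
  have [s [sn sm]] := ultra_ex UU (ultraI UU (SP n).1 (SP m).1).
  apply: le_lt_trans (nrm_dist (z s) _ _) _.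
  by apply: ltrD; [exact: (SP n).2|exact: (SP m).2].
have [|l lP] := cV (z \o t).
  move=> e e0; have e2 : 0 < e / 2 by rewrite divr_gt0.
  have [N hN] := epsP _ e2; exists N => m n Nm Nn.
  by apply: lt_le_trans (tt m n) _; rewrite [e]splitr lerD// ltW// hN.
exists l => e e0; have e2 : 0 < e / 2 by rewrite divr_gt0.
have [N hN] := epsP _ e2; have [N' hN'] := lP _ e2.
pose n := maxn N N'; apply: (ultraS UU _ (SP n).1) => s Ss /=.
apply: le_lt_trans (nrm_dist (z (t n)) _ _) _; rewrite [e]splitr; apply: ltrD.
  apply: lt_trans (hN n (leq_maxl _ _)); exact: (SP n).2.
exact: hN' (leq_maxr _ _).
Qed.

Context {X : normedModType K} (A : set (bounded_op X X)).
Hypothesis Aalg : subalgebra A.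
Hypothesis Acl : forall T, adherent A T -> A T.
Hypothesis cX : seq_complete (bounded_op X X : normedModType K).

Let AM S T : A S -> A T -> A (S * T). Proof. exact: algM. Qed.

Lemma approximate_eigenoperator T : A T -> ~ (exists Q, quasi_inverse A T Q) ->
  exists2 l : R, 1 <= l & forall e : R, 0 < e -> exists Z,
    [/\ A Z, nrm Z = 1, nrm (rc l *: Z - T * Z) <= e & nrm (rc l *: Z - Z * T) <= e].
Proof.
move=> AT nQ.
pose Ti (m : R) : bounded_op X X := rc m^-1 *: T.
have ATi m : A (Ti m) by exact: algZ.
pose G m := exists Q, quasi_inverse A (Ti m) Q.
pose N := [set m : R | 1 <= m /\ ~ G m].
have N1 : N 1 by split=> //; rewrite /G /Ti invr1 rc1 scale1r.
have Nle m : N m -> m <= nrm T.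
  move=> [m1 nG]; rewrite leNgt; apply/negP => lt; apply: nG.
  have m0 : 0 < m by exact: lt_le_trans m1.
  apply: (quasi_inverse_perturb Aalg Acl cX (T := 0) (Q := 0)) => //.
  - by case: Aalg.
  - by split; [case: Aalg|rewrite addr0 subr0 mulr1..].
  - rewrite subr0 nrm0 addr0 mulr1 nrmZrc gtr0_norm ?invr_gt0//.
    by rewrite mulrC ltr_pdivrMr// mul1r.
have hN : has_sup N by split; [exists 1|exists (nrm T)].
pose l := sup N.
have l1 : 1 <= l by exact: (sup_upper_bound hN).
have l0 : 0 < l by exact: lt_le_trans l1.
have TiB m m' : 0 < m -> 0 < m' -> nrm (Ti m' - Ti m) = `|m'^-1 - m^-1| * nrm T.
  by move=> m0 m'0; rewrite /Ti -scalerBl -rcN -rcD nrmZrc.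
have TiBle m m' : 1 <= m -> 1 <= m' -> nrm (Ti m' - Ti m) <= `|m' - m| * nrm T.
  move=> m1 m'1; have m0 : 0 < m by exact: lt_le_trans m1.
  have m'0 : 0 < m' by exact: lt_le_trans m'1.
  rewrite TiB// ler_wpM2r ?nrm_ge0//.
  have -> : m'^-1 - m^-1 = (m - m') * (m' * m)^-1.
    by field; rewrite !gt_eqF.
  rewrite normrM distrC ler_piMr// normfV gtr0_norm ?mulr_gt0//.
  by rewrite invf_le1 ?mulr_gt0// mulr_ege1.
have nGl : ~ G l.
  move=> [Q qQ]; pose t := (nrm T + 1) * (1 + nrm Q).
  have Q1 : 0 < 1 + nrm Q by rewrite ltr_wpDr// nrm_ge0.
  have T1 : 0 < nrm T + 1 by rewrite ltr_wpDl// nrm_ge0.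
  have t0 : 0 < t by rewrite mulr_gt0.
  have ti0 : 0 < t^-1 by rewrite invr_gt0.
  have [m Nm lm] := sup_adherent ti0 hN; have [m1 nGm] := Nm; apply: nGm.
  apply: (quasi_inverse_perturb Aalg Acl cX (ATi l) (ATi m) qQ).
  have ml : m <= l by exact: (sup_upper_bound hN).
  apply: (@le_lt_trans _ _ (`|m - l| * t)).
    rewrite /t mulrA ler_wpM2r ?(ltW Q1)//; apply: le_trans (TiBle _ _ l1 m1) _.
    by rewrite ler_wpM2l// lerDl.
  rewrite distrC ger0_norm ?subr_ge0// -ltr_pdivlMr// mul1r.
  by rewrite ltrBlDr addrC -ltrBlDr.
exists l => // e e0.
pose t := nrm T + 1; have t0 : 0 < t by rewrite ltr_wpDl// nrm_ge0.
(* The second bound forces [nrm Q >= 2 t / e], so [T / nrm Q] costs at most [e / 2]; the first bound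
   covers the term [d Q / nrm Q]. *)
pose d := Num.min (e / 2) (t * (1 + 2 * t / e))^-1.
have te : 0 < 1 + 2 * t / e by rewrite addr_gt0// divr_gt0// mulr_gt0.
have d0 : 0 < d by rewrite lt_min divr_gt0//= invr_gt0 mulr_gt0.
pose m := l + d.
have m1 : 1 <= m by rewrite /m -[1]addr0 lerD// ltW.
have m0 : 0 < m by exact: lt_le_trans m1.
have [Q qQ] : G m.
  apply: contrapT => nG; have : m <= l by apply: (sup_upper_bound hN).
  by rewrite /m gerDl leNgt d0.
have big : 1 <= d * t * (1 + nrm Q).
  rewrite leNgt; apply/negP => lt; apply: nGl.
  apply: (quasi_inverse_perturb Aalg Acl cX (ATi m) (ATi l) qQ).
  apply: le_lt_trans lt; rewrite ler_wpM2r ?addr_ge0 ?nrm_ge0//.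
  apply: le_trans (TiBle _ _ m1 l1) _.
  by rewrite distrC /m [l + d]addrC addrK gtr0_norm// ler_wpM2l ?lerDl// ltW.
have Qbig : 2 * t / e <= nrm Q.
  rewrite -(lerD2l 1); apply: (@le_trans _ _ ((d * t)^-1)).
    rewrite -[leLHS]invrK lef_pV2 ?posrE ?invr_gt0 ?mulr_gt0//.
    rewrite -ler_pdivlMr// -invfM mulrC.
    by rewrite ge_min lexx orbT.
  by rewrite -[leLHS]mul1r ler_pdivrMr ?mulr_gt0// mulrC.
have Q0 : 0 < nrm Q by apply: lt_le_trans Qbig; rewrite divr_gt0// mulr_gt0.
have [AQ lQ rQ] := qQ.
have mTi : rc m *: Ti m = T.
  by rewrite /Ti scalerA -rcM divff ?gt_eqF// rc1 scale1r.
have lE : rc m *: Q = T + Q * T.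
  have e1 : Q = Ti m + Q * Ti m.
    move: lQ; rewrite mulrBr mulr1 mulrDl mul1r => /eqP.
    by rewrite -addrA -subr_eq0 addrAC subrr add0r subr_eq0 => /eqP.
  rewrite {1}e1 scalerDr mTi; congr (_ + _); apply: bounded_op_ext => x.
  by rewrite -[LHS]/(rc m *: Q (Ti m x)) -linearZ -[rc m *: Ti m x]/((rc m *: Ti m) x) mTi.
have rE : rc m *: Q = T + T * Q.
  have e1 : Q = Ti m + Ti m * Q.
    move: rQ; rewrite mulrBl mul1r mulrDr mulr1 => /eqP.
    by rewrite -addrA -subr_eq0 addrAC subrr add0r subr_eq0 => /eqP.
  rewrite {1}e1 scalerDr mTi; congr (_ + _); apply: bounded_op_ext => x.
  by rewrite -[LHS]/((rc m *: Ti m) (Q x)) mTi.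
have qi : 0 < (nrm Q)^-1 by rewrite invr_gt0.
have small (B : bounded_op X X) : rc m *: Q = T + B ->
    nrm (rc (nrm Q)^-1 *: (rc l *: Q - B)) <= e.
  move=> mQ; have -> : rc l *: Q - B = T - rc d *: Q.
    apply/eqP; rewrite subr_eq addrAC -mQ -scalerBl -rcN -rcD /m.
    by rewrite addrK.
  rewrite nrmZrc gtr0_norm// ler_pdivrMl//.
  apply: le_trans (nrmD _ _) _; rewrite nrmN nrmZrc gtr0_norm//.
  have : d * nrm Q <= e / 2 * nrm Q by rewrite ler_wpM2r ?nrm_ge0// ge_min lexx.
  have : 2 * t <= nrm Q * e by rewrite -ler_pdivrMr.
  by rewrite /t; lra.
exists (rc (nrm Q)^-1 *: Q); split.
- exact: algZ.
- by rewrite nrmZrc gtr0_norm// mulVf// gt_eqF.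
- have -> : rc l *: (rc (nrm Q)^-1 *: Q) - T * (rc (nrm Q)^-1 *: Q) =
      rc (nrm Q)^-1 *: (rc l *: Q - T * Q); last exact: small.
    rewrite scalerBr !scalerA [rc l * _]mulrC; congr (_ - _).
    by apply: bounded_op_ext => x; exact: linearZ.
- have -> : rc l *: (rc (nrm Q)^-1 *: Q) - (rc (nrm Q)^-1 *: Q) * T =
      rc (nrm Q)^-1 *: (rc l *: Q - Q * T); last exact: small.
    rewrite scalerBr !scalerA [rc l * _]mulrC; congr (_ - _).
    exact: bounded_op_ext.
Qed.

(* [C * D * C] runs over a precompact set of operators when [D] is bounded. *)
Lemma eigenoperator T : A T -> ess_lt T 1 -> ~ (exists Q, quasi_inverse A T Q) ->
  exists l : R, 1 <= l /\ exists Z, [/\ A Z, nrm Z = 1 & T * Z = rc l *: Z].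
Proof.
move=> AT [C cC TC] nQ; have [l l1 hl] := approximate_eigenoperator AT nQ.
exists l; split=> //.
pose eps (n : nat) : R := n.+1%:R^-1.
have eps0 n : 0 < eps n by rewrite invr_gt0.
have /choice[Z ZP] : forall n, exists Z, [/\ A Z, nrm Z = 1,
    nrm (rc l *: Z - T * Z) <= eps n & nrm (rc l *: Z - Z * T) <= eps n].
  by move=> n; exact: hl.
have [U [UU Un]] := ultra_nat.
have Ueps (e : R) : 0 < e -> U [set n | eps n < e].
  move=> e0; apply: (ultraS UU _ (Un (Num.truncn e^-1))) => n /= hn.
  rewrite /eps invf_plt ?posrE//; apply: lt_le_trans (truncnS_gt _) _.
  by rewrite ler_nat ltnS.
pose rho := nrm (T - C); pose kap : R := 1 - rho.
have kap0 : 0 < kap by rewrite subr_gt0.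
pose c := nrm C + 1; have c0 : 0 < c by rewrite ltr_wpDl// nrm_ge0.
have Cc : nrm C <= c by rewrite lerDl.
(* As [l >= 1] and [nrm (T - C) < 1], the part [T - C] is absorbed on either side, and [D] is
   controlled by [C * D], which is controlled by [C * D * C]. *)
have key (D : bounded_op X X) (s : R) :
    nrm (rc l *: D - T * D) <= s -> nrm (rc l *: D - D * T) <= s ->
    kap * nrm D <= nrm (C * D) + s /\
    kap * nrm (C * D) <= nrm (C * D * C) + c * s.
  move=> h1 h2.
  have lD (B : bounded_op X X) : nrm B <= l * nrm B by rewrite ler_peMl ?nrm_ge0.
  have nl (B : bounded_op X X) : l * nrm B = nrm (rc l *: B).
    by rewrite nrmZrc ger0_norm// (le_trans ler01).
  have kE (B : bounded_op X X) : kap * nrm B = nrm B - rho * nrm B.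
    by rewrite /kap mulrBl mul1r.
  split.
    have e : rc l *: D = (rc l *: D - T * D) + (C * D + (T - C) * D).
      by rewrite -mulrDl [C + _]addrC subrK subrK.
    have := lD D; rewrite nl e.
    have := nrmD (rc l *: D - T * D) (C * D + (T - C) * D).
    have := nrmD (C * D) ((T - C) * D).
    have := nrm_mul (T - C) D; rewrite -/rho kE; lra.
  have Cl : rc l *: (C * D) = C * (rc l *: D).
    by apply: bounded_op_ext => x; rewrite -[RHS]/(C (rc l *: D x)) linearZ.
  have e : rc l *: (C * D) = C * (rc l *: D - D * T) + (C * D * C + C * D * (T - C)).
    by rewrite -[X in _ + X]mulrDr [C + _]addrC subrK mulrBr Cl mulrA subrK.
  have := lD (C * D); rewrite nl e.
  have := nrmD (C * (rc l *: D - D * T)) (C * D * C + C * D * (T - C)).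
  have := nrmD (C * D * C) (C * D * (T - C)).
  have := nrm_mul (C * D) (T - C); rewrite -/rho.
  have := le_trans (nrm_mul C (rc l *: D - D * T)) (ler_pM (nrm_ge0 _) (nrm_ge0 _) Cc h2).
  by rewrite kE (mulrC rho); lra.
have [|Z0 Z0P] := @ultra_cauchy_limit (bounded_op X X) nat U Z UU cX.
  move=> e e0.
  have L0 : 0 < 5%:R * c + 2 * kap by rewrite addr_gt0// mulr_gt0.
  (* With [s = 2 t] and [nrm (C * D * C) <= 3 c t], the two bounds of [key] give
     [kap ^+ 2 * nrm D <= (5 c + 2 kap) t]. *)
  pose t := e * kap ^+ 2 / (5%:R * c + 2 * kap) / 2.
  have t0 : 0 < t by rewrite !divr_gt0// mulr_gt0// exprn_gt0.
  have [I [p [p1 pC]]] := finitely_coverable_net cC t0.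
  have [J [h hC]] := cC t t0.
  pose sc (x : X) := rc c^-1 *: x.
  have scZ n i : nrm (sc (Z n (C (p i)))) <= 1.
    rewrite nrmZrc gtr0_norm ?invr_gt0// ler_pdivrMl// mulr1.
    apply: le_trans (nrm_op_app _ _) _; have [_ -> _ _] := ZP n; rewrite mul1r.
    apply: le_trans (nrm_op_app _ _) _; apply: le_trans Cc.
    by rewrite ler_piMr ?nrm_ge0.
  (* The label records the classes of the rescaled vectors [Z n (C (p i))] at the net points.
     Indices with equal labels have close [C (Z n (C (p i)))]. *)
  have [lab Ulab] := ultra_finite (fun n => [ffun i => h (sc (Z n (C (p i))))]) UU.
  exists ([set n | eps n < t] `&` [set n | [ffun i => h (sc (Z n (C (p i))))] = lab]).
    by apply: ultraI => //; exact: Ueps.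
  move=> m n [/= mt ml] [/= nt nl]; set D := Z m - Z n.
  have [AZm Zm1 Zm2 Zm3] := ZP m; have [AZn Zn1 Zn2 Zn3] := ZP n.
  have D2 : nrm D <= 2 by have := nrmD (Z m) (- Z n); rewrite nrmN Zm1 Zn1 -/D; lra.
  have h1 : nrm (rc l *: D - T * D) <= 2 * t.
    have -> : rc l *: D - T * D = (rc l *: Z m - T * Z m) - (rc l *: Z n - T * Z n).
      by rewrite /D scalerBr mulrBr (opprD (T * Z m)) addrACA -opprD.
    apply: le_trans (nrmD _ _) _; rewrite nrmN; lra.
  have h2 : nrm (rc l *: D - D * T) <= 2 * t.
    have -> : rc l *: D - D * T = (rc l *: Z m - Z m * T) - (rc l *: Z n - Z n * T).
      by rewrite /D scalerBr mulrBl (opprD (Z m * T)) addrACA -opprD.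
    apply: le_trans (nrmD _ _) _; rewrite nrmN; lra.
  have CDC : nrm (C * D * C) <= 3%:R * c * t.
    apply: nrm_op_le_ball; first by rewrite mulr_ge0 ?(ltW t0)// mulr_ge0 ?(ltW c0).
    move=> x x1; have [i xi] := pC x x1.
    have -> : (C * D * C) x = (C * D) (C x - C (p i)) + C (D (C (p i))).
      have e1 : (C * D) (C x - C (p i)) = (C * D) (C x) - (C * D) (C (p i)).
        exact: linearB.
      by rewrite e1 -[C (D _)]/((C * D) (C (p i))) subrK.
    apply: le_trans (nrmD _ _) _.
    have a1 : nrm ((C * D) (C x - C (p i))) <= c * 2 * t.
      apply: le_trans (nrm_op_app _ _) _; apply: ler_pM; rewrite ?nrm_ge0 ?(ltW xi)//.
      by apply: le_trans (nrm_mul _ _) _; apply: ler_pM; rewrite ?nrm_ge0.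
    have a2 : nrm (C (D (C (p i)))) <= c * t.
      have hh : h (sc (Z m (C (p i)))) = h (sc (Z n (C (p i)))).
        have := congr1 (fun f : {ffun I -> J} => f i) (etrans ml (esym nl)).
        by rewrite !ffunE.
      have := hC _ _ (scZ m i) (scZ n i) hh.
      rewrite -linearB -scalerBr linearZ nrmZrc gtr0_norm ?invr_gt0//.
      by rewrite ltr_pdivrMl// => /ltW.
    by rewrite -mulrA in a1; lra.
  have [k1 k2] := key D _ h1 h2.
  have k3 : kap ^+ 2 * nrm D <= (5%:R * c + 2 * kap) * t.
    have := ler_wpM2l (ltW kap0) k1; rewrite mulrDr mulrA -expr2; lra.
  rewrite -(ltr_pM2l (exprn_gt0 2 kap0)); apply: le_lt_trans k3 _.
  have -> : (5%:R * c + 2 * kap) * t = kap ^+ 2 * e / 2.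
    by rewrite /t; field; rewrite gt_eqF.
  by have := mulr_gt0 (exprn_gt0 2 kap0) e0; lra.
exists Z0; split.
- apply: Acl => e /Z0P h; have [n /= hn] := ultra_ex UU h.
  by exists (Z n); [case: (ZP n)|rewrite nrmB].
- apply/eqP; rewrite -subr_eq0; apply/eqP/norm_small0 => e e0.
  have [n /= hn] := ultra_ex UU (Z0P _ e0); have [_ Z1 _ _] := ZP n.
  have := nrm_sub (Z n) Z0; have := nrm_sub Z0 (Z n); rewrite (nrmB Z0) Z1.
  by rewrite ler_norml; move=> h1 h2; apply/andP; split; lra.
- apply/eqP; rewrite eq_sym -subr_eq0; apply/eqP/nrm_eq0/norm_small0 => e e0.
  rewrite ger0_norm ?nrm_ge0//.
  pose M := l + nrm T + 1.
  have M0 : 0 < M by have := nrm_ge0 T; rewrite /M; lra.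
  have e2 : 0 < e / 2 / M by rewrite !divr_gt0.
  have e2' : 0 < e / 2 by rewrite divr_gt0.
  have [n /= [hn en]] := ultra_ex UU (ultraI UU (Z0P _ e2) (Ueps _ e2')).
  have [_ _ Z1 _] := ZP n.
  have -> : rc l *: Z0 - T * Z0 = (rc l *: Z n - T * Z n) -
      (rc l *: (Z n - Z0) - T * (Z n - Z0)).
    rewrite scalerBr mulrBr opprB addrA addrA subrK opprB [RHS]addrC addrA.
    by rewrite subrK.
  apply: le_trans (nrmD _ _) _; rewrite nrmN.
  have a1 : nrm (rc l *: (Z n - Z0) - T * (Z n - Z0)) <= M * nrm (Z n - Z0).
    apply: le_trans (nrmD _ _) _; rewrite nrmN nrmZrc ger0_norm; last by lra.
    by have := nrm_mul T (Z n - Z0); have := nrm_ge0 (Z n - Z0); rewrite /M; lra.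
  have a2 : M * nrm (Z n - Z0) < e / 2 by rewrite mulrC -ltr_pdivlMr.
  lra.
Qed.

End spectral_limit.

(** * Finite rank *)

Section finite_dimension.
Context {R : realType} {k : scalar_kind}.
Local Notation K := (scalar_field R k).

Section span.
Context {X : normedModType K}.

Definition spanned n (e : 'I_n -> X) : set X :=
  [set \sum_(i < n) c i *: e i | c in [set: 'I_n -> K]].

Lemma spannedP n (e : 'I_n -> X) (c : 'I_n -> K) : spanned e (\sum_(i < n) c i *: e i).
Proof. by exists c. Qed.

Lemma spanned_subspace n (e : 'I_n -> X) : subspace (spanned e).
Proof.
split; first by exists (fun=> 0) => //; rewrite big1// => i _; rewrite scale0r.
move=> a _ _ [c _ <-] [d _ <-]; exists (fun i => a * c i + d i) => //.
by rewrite scaler_sumr -big_split /=; apply: eq_bigr => i _; rewrite scalerDl scalerA.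
Qed.

Lemma subspaceB (L : set X) u v : subspace L -> L u -> L v -> L (u - v).
Proof. by move=> sL Lu Lv; rewrite -scaleN1r addrC; exact: sL.2. Qed.

(** By induction [W'] is closed, so some bounded [F] is 1 at [w0] and 0 on [W']. On [W] it is the
    coordinate along [w0], and [w - F w *: w0] is a continuous projection to [W']. *)
Lemma spanned_closed n (e : 'I_n -> X) (W : set X) (u : X) :
  subspace W -> W `<=` spanned e -> adherent W u -> W u.
Proof.
elim: n e W u => [|n IH] e W u sW We aW.
  suff -> : u = 0 by case: sW.
  apply/nrm_eq0/norm_small0 => d d0; rewrite ger0_norm ?nrm_ge0//.
  have [w /We[c _ <-]] := aW d d0; rewrite big_ord0 subr0; exact: ltW.
pose e' i := e (widen_ord (leqnSn n) i).
have split_span c : \sum_(i < n.+1) c i *: e i =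
    \sum_(i < n) c (widen_ord (leqnSn n) i) *: e' i + c ord_max *: e ord_max.
  by rewrite big_ord_recr.
have [We'|nWe'] := pselect (W `<=` spanned e'); first exact: (IH e' W).
have [w0 Ww0 nw0] : exists2 w, W w & ~ spanned e' w.
  apply: contrapT => h; apply: nWe' => w Ww; apply: contrapT => nw.
  by apply: h; exists w.
have [c _ w0E] := We _ Ww0; rewrite split_span in w0E.
have c0 : c ord_max != 0.
  apply/eqP => c0; apply: nw0; rewrite -w0E c0 scale0r addr0; exact: spannedP.
pose W' := W `&` spanned e'.
have sW' : subspace W'.
  have [se0 se] := spanned_subspace e'.
  split; first by split=> //; case: sW.
  by move=> a v w [Wv ev] [Ww ew]; split; [exact: sW.2|exact: se].
have dec w : W w -> exists2 b, W' (w - b *: w0) & True.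
  move=> Ww; have [d _ dE] := We _ Ww; rewrite split_span in dE.
  exists (d ord_max / c ord_max) => //; split.
    by apply: subspaceB => //; exact: subspaceZ.
  rewrite -dE -w0E scalerDr scalerA divfK// opprD addrACA subrr addr0.
  apply: subspaceB (spanned_subspace e') (spannedP _ _) _.
  exact: subspaceZ (spanned_subspace e') (spannedP _ _).
have nw' : ~ adherent W' w0.
  by move=> /(IH e' W' w0 sW' (fun w h => h.2))[_].
have [F F1 F0] := subspace_separation sW' nw'.
have Fw w : W w -> W' (w - F w *: w0).
  move=> /dec[b Wb _]; suff <- : b = F w by [].
  have := F0 _ Wb; have -> : F (w - b *: w0) = F w - b * F w0.
    by rewrite linearB linearZ.
  by rewrite F1 mulr1 => /subr0_eq.
have : W' (u - F u *: w0).
  apply: (IH e' W') => // [w []//|d d0].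
  pose M := 1 + nrm F * nrm w0.
  have M0 : 0 < M by rewrite ltr_wpDr// mulr_ge0// nrm_ge0.
  have [w Ww lt] := aW _ (divr_gt0 d0 M0).
  exists (w - F w *: w0); first exact: Fw.
  have -> : u - F u *: w0 - (w - F w *: w0) = (u - w) - F (u - w) *: w0.
    have -> : F (u - w) = (F u : K) - (F w : K) by exact: linearB.
    by rewrite scalerBl opprD addrACA -opprD.
  apply: le_lt_trans (nrmD _ _) _; rewrite nrmN nrmZ.
  apply: (@le_lt_trans _ _ (M * nrm (u - w))).
    rewrite mulrDl mul1r lerD2l mulrAC ler_wpM2r ?nrm_ge0//; exact: nrm_op_app.
  by rewrite mulrC -ltr_pdivlMr.
move=> [Wu _]; rewrite -(subrK (F u *: w0) u).
by apply: subspaceD => //; exact: subspaceZ.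
Qed.

(* Riesz's lemma, for the span of a [1/2]-net of the unit ball of the eigenspace *)
Lemma eigenspace_finite_dimensional (T : bounded_op X X) (l : R) :
  1 <= l -> ess_lt T 1 ->
  exists n (e : 'I_n -> X), forall x, T x = rc l *: x -> spanned e x.
Proof.
move=> l1 [C cC TC]; pose kap : R := 1 - nrm (T - C).
have kap0 : 0 < kap by rewrite subr_gt0.
pose L := [set x | T x = rc l *: x].
have sL : subspace L.
  split; first by rewrite /L /= linear0 scaler0.
  move=> a u v; rewrite /L /= => Tu Tv.
  have -> : T (a *: u + v) = a *: T u + T v by exact: linearP.
  by rewrite Tu Tv scalerDr !scalerA mulrC.
(* [C] is bounded below on the eigenspace, so a fine colouring for [C] is fine for the norm
   there. *)
have LC u : L u -> kap * nrm u <= nrm (C u).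
  move=> Lu; have : nrm u <= l * nrm u by rewrite ler_peMl ?nrm_ge0.
  have -> : l * nrm u = nrm (rc l *: u) by rewrite nrmZrc ger0_norm// (le_trans ler01).
  have -> : rc l *: u = C u + (T - C) u.
    by rewrite -Lu -[(T - C) u]/(T u - C u) addrC subrK.
  have := nrmD (C u) ((T - C) u); have := nrm_op_app (T - C) u.
  rewrite /kap mulrBl mul1r; lra.
have k2 : 0 < kap / 2 by rewrite divr_gt0.
have [I [h hC]] := cC _ k2.
pose e0 i := xget 0 [set x | [/\ L x, nrm x <= 1 & h x = i]].
have Le0 i : L (e0 i) by rewrite /e0; case: xgetP => [x _ []//|_]; case: sL.
have e0P u : L u -> nrm u <= 1 -> nrm (u - e0 (h u)) < 2^-1.
  move=> Lu u1; rewrite /e0; case: xgetP => [x _ [Lx x1 hx]|/(_ u)[]//].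
  rewrite -(ltr_pM2l kap0); apply: le_lt_trans (LC _ (subspaceB sL Lu Lx)) _.
  by rewrite (linearB C) hC.
pose e (j : 'I_#|I|) := e0 (enum_val j).
exists #|I|, e => u Lu.
apply: (spanned_closed (spanned_subspace e) (@subset_refl _ _)).
apply: contrapT => nadh; have [d d0 hd] := adherent_separated nadh.
pose D := [set nrm (u - w) | w in spanned e].
have hD : has_inf D.
  split; first by exists (nrm (u - 0)), 0 => //; exact: (spanned_subspace e).1.
  by exists 0 => _ [w _ <-]; exact: nrm_ge0.
have di : d <= inf D.
  by apply: lb_le_inf => [|_ [w Sw <-]]; [case: hD|exact: hd].
have i0 : 0 < inf D by exact: lt_le_trans di.
have i2 : 0 < inf D / 2 by rewrite divr_gt0.
have [_ [w Sw <-] lt] := inf_adherent i2 hD.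
have Lw : L w.
  move: Sw => [c _ <-]; apply: (big_ind (fun v => L v)).
  - by case: sL.
  - by move=> *; exact: subspaceD.
  - by move=> j _; exact: subspaceZ (Le0 _).
pose v := u - w; have Lv : L v by exact: subspaceB.
have v0 : 0 < nrm v by apply: lt_le_trans d0 _; exact: hd.
have vi : 0 < (nrm v)^-1 by rewrite invr_gt0.
pose v1 := rc (nrm v)^-1 *: v.
have v11 : nrm v1 <= 1 by rewrite nrmZrc gtr0_norm// mulVf// gt_eqF.
have := e0P v1 (subspaceZ _ sL Lv) v11; set i := h v1 => hi.
have : inf D <= nrm (u - (w + rc (nrm v) *: e0 i)).
  apply: ge_inf; first by case: hD.
  exists (w + rc (nrm v) *: e0 i) => //.
  apply: subspaceD (spanned_subspace e) Sw _.
  apply: subspaceZ (spanned_subspace e) _.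
  exists (fun j => (j == enum_rank i)%:R) => //.
  rewrite (bigD1 (enum_rank i))//= eqxx scale1r /e enum_rankK big1 ?addr0// => j.
  by move=> /negbTE ->; rewrite scale0r.
have -> : u - (w + rc (nrm v) *: e0 i) = rc (nrm v) *: (v1 - e0 i).
  by rewrite scalerBr scalerA -rcM divff ?gt_eqF// rc1 scale1r opprD addrA.
rewrite nrmZrc gtr0_norm//.
have : nrm v * nrm (v1 - e0 i) <= nrm v * 2^-1 by rewrite ler_wpM2l// ltW.
rewrite -/v in lt; lra.
Qed.

(** Modulo the kernel of [L], the vector [e i0] is a combination of the others. This is what lowers
    the rank in both minimality arguments. *)
Lemma spanned_drop n (e : 'I_n.+1 -> X) (L : bounded_op X X) (c : 'I_n.+1 -> K) i0 :
  c i0 != 0 -> L (\sum_i c i *: e i) = 0 ->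
  forall x, spanned e x -> spanned (fun j => L (e (lift i0 j))) (L x).
Proof.
move=> ci0 Lc _ [d _ <-].
exists (fun j => d (lift i0 j) - d i0 / c i0 * c (lift i0 j)) => //.
have lift_sum (F : 'I_n.+1 -> X) : \sum_i F i = F i0 + \sum_(j < n) F (lift i0 j).
  by rewrite (bigD1_ord i0).
have Lsum (f : 'I_n.+1 -> K) : L (\sum_i f i *: e i) =
    f i0 *: L (e i0) + \sum_(j < n) f (lift i0 j) *: L (e (lift i0 j)).
  rewrite linear_sum lift_sum /= linearZ; congr (_ + _).
  by apply: eq_bigr => j _; rewrite linearZ.
have : L (\sum_i d i *: e i) - (d i0 / c i0) *: L (\sum_i c i *: e i) =
    L (\sum_i d i *: e i) by rewrite Lc scaler0 subr0.
move=> <-; rewrite !Lsum scalerDr scalerA divfK// opprD addrACA subrr add0r.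
rewrite scaler_sumr -sumrB; apply: eq_bigr => j _.
by rewrite scalerBl scalerA.
Qed.

End span.

(** * An idempotent of least rank *)

Section minimal_idempotent.
Context {X : normedModType K} (A : set (bounded_op X X)).
Hypothesis Aalg : subalgebra A.
Hypothesis nres : ~ exists (x : dual (dual X)) (y : dual X),
  [/\ x != 0, y != 0 & resolving A x y].

(** Let [U] have least rank and [U v != 0]. The space [U A U v] is finite dimensional, hence closed,
    and contains [U v] by density of the orbit of [U v]: say [U S U v = U v]. Then [P = U S] fixes
    [U v], so [(P - 1) P] has smaller rank and vanishes. *)
Lemma minimal_idempotent (Z : bounded_op X X) n (e : 'I_n -> X) :
  A Z -> Z != 0 -> (forall x, spanned e (Z x)) ->
  exists m (f : 'I_m.+1 -> X) (P : bounded_op X X),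
    [/\ A P, P != 0, P * P = P, forall x, spanned f (P x) &
      forall (U : bounded_op X X) (g : 'I_m -> X),
        A U -> (forall x, spanned g (U x)) -> U = 0].
Proof.
move=> AZ Z0 Ze.
pose p m := `[< exists (U : bounded_op X X) (g : 'I_m -> X),
  [/\ A U, U != 0 & forall x, spanned g (U x)] >].
have ex : exists m, p m by exists n; apply/asboolP; exists Z, e.
case: (ex_minnP ex) => m /asboolP[U [f [AU U0 Uf]]] min {Z n e AZ Z0 Ze ex}.
case: m f Uf min => [|m] f Uf min.
  exfalso; move/eqP: U0; apply; apply: bounded_op_ext => x.
  by have [c _ <-] := Uf x; rewrite big_ord0.
have small (V : bounded_op X X) (g : 'I_m -> X) :
    A V -> (forall x, spanned g (V x)) -> V = 0.
  move=> AV Vg; apply: contrapT => /eqP V0.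
  have : (m.+1 <= m)%N by apply: min; apply/asboolP; exists V, g.
  by rewrite ltnn.
have [v Uv0] : exists v, U v != 0.
  apply: contrapT => h; move/eqP: U0; apply; apply: bounded_op_ext => x.
  by apply: contrapT => /eqP Ux; apply: h; exists x.
pose W := [set U (S (U v)) | S in A].
have sW : subspace W.
  split; first by exists 0; [case: Aalg|exact: linear0].
  move=> a _ _ [S AS <-] [T AT <-]; exists (a *: S + T).
    by case: Aalg => _ + _; apply.
  by rewrite -[(a *: S + T) (U v)]/(a *: S (U v) + T (U v)) linearP.
have Wf : W `<=` spanned f by move=> _ [S _ <-]; exact: Uf.
have [S AS SE] : W (U v).
  apply: (spanned_closed sW Wf) => d d0.
  have U1 : 0 < nrm U + 1 by rewrite ltr_wpDl// nrm_ge0.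
  have [_ [S AS <-] lt] := dense_orbit Aalg nres Uv0 v (divr_gt0 d0 U1).
  exists (U (S (U v))); first by exists S.
  rewrite -linearB; apply: le_lt_trans (nrm_op_app _ _) _.
  rewrite ltr_pdivlMr// mulrC in lt; apply: le_lt_trans lt.
  by rewrite ler_wpM2r ?nrm_ge0// lerDl.
pose P : bounded_op X X := U * S.
have AP : A P by exact: algM.
have Pf x : spanned f (P x) by exact: Uf.
have Pv : P (U v) = U v by [].
exists m, f, P; split=> //.
  by apply/eqP => P0; move: Uv0; rewrite -Pv P0 eqxx.
apply/eqP; rewrite -subr_eq0; apply/eqP.
have [c _ cE] := Uf v.
have [i0 ci0] : exists i, c i != 0.
  apply: contrapT => h; move/eqP: Uv0; apply; rewrite -cE big1// => i _.
  suff -> : c i = 0 by rewrite scale0r.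
  by apply: contrapT => /eqP ci; apply: h; exists i.
apply: (small _ (fun j => (P - 1) (f (lift i0 j)))).
  by apply: algB => //; exact: algM.
move=> x; have -> : (P * P - P) x = (P - 1) (P x) by [].
apply: (spanned_drop ci0) => //.
by rewrite cE -[LHS]/(P (U v) - U v) Pv subrr.
Qed.

Lemma idempotent_finite_rank (P : bounded_op X X) n (e : 'I_n -> X) :
  P * P = P -> (forall x, spanned e (P x)) -> finite_rank P.
Proof.
move=> PP Pe; exists n, (P \o e).
have Psum c : P (\sum_i c i *: e i) = \sum_i c i *: (P \o e) i.
  by rewrite linear_sum; apply: eq_bigr => i _; rewrite linearZ.
apply/seteqP; split=> [_ [x _ <-]|_ [c _ <-]].
  have [c _ cE] := Pe x; exists c => //.
  by rewrite -Psum cE -[LHS]/((P * P) x) PP.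
by exists (\sum_i c i *: e i); rewrite // Psum.
Qed.

End minimal_idempotent.
End finite_dimension.

(** * Density *)

Lemma closed_eigenvector (F : closedFieldType) n (a : 'M[F]_n.+1) :
  exists (l : F) (v : 'I_n.+1 -> F), (exists i, v i != 0) /\
    forall i, \sum_j v j * a j i = l * v i.
Proof.
have /closed_rootP[l] : size (char_poly a) != 1%N by rewrite size_char_poly.
rewrite -eigenvalue_root_char => /eigenvalueP[v vE v0].
exists l, (v 0); split.
  apply: contrapT => h; move/eqP: v0; apply; apply/rowP => i; rewrite mxE.
  by apply: contrapT => /eqP vi; apply: h; exists i.
by move=> i; have /rowP/(_ i) := vE; rewrite !mxE.
Qed.

Section weak_operator_topology.
Context {R : realType} {k : scalar_kind}.
Local Notation K := (scalar_field R k).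
Context {X : normedModType K} (A : set (bounded_op X X)).

(** A basic neighbourhood tests finitely many matrix coefficients, which depend only on the values
    at finitely many vectors. *)
Lemma wot_dense : (forall (T0 : bounded_op X X) (s : seq X),
    exists2 T, A T & forall x, x \in s -> T x = T0 x) -> dense (A : set (wot X)).
Proof.
move=> h O [T0 OT0] [B oB BO].
pose F : set_system (bounded_op X X) := filter_from setT
  (fun s : seq X => [set T | A T /\ forall x, x \in s -> T x = T0 x]).
have FF : ProperFilter F.
  apply: filter_from_proper; last by move=> s _; have [T AT Ts] := h T0 s; exists T.
  apply: filter_from_filter; first by exists [::].
  move=> s t _ _; exists (s ++ t) => // T [AT Ts]; split; split=> // x xs;
  by apply: Ts; rewrite mem_cat xs ?orbT.
have cF : {ptws, (@matrix_coefs R k X @ F) --> @matrix_coefs R k X T0}.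
  apply/pointwise_cvgP => -[x g] N /= N0; exists [:: x] => // T [_ Tx].
  rewrite /= /matrix_coefs /= Tx ?inE//; exact: nbhs_singleton N0.
have : nbhs (@matrix_coefs R k X T0) B.
  apply: open_nbhs_nbhs; split=> //.
  by have : (@matrix_coefs R k X @^-1` B) T0 by rewrite BO.
move=> /cF[s _ sB]; have [T AT Ts] := h T0 s; exists T; split=> //.
by rewrite -BO; exact: sB.
Qed.

End weak_operator_topology.

Section norm_topology.
Context {R : realType} {k : scalar_kind}.
Local Notation K := (scalar_field R k).

Lemma closed_adherent (V : normedModType K) (S : set V) v :
  closed S -> adherent S v -> S v.
Proof.
move=> clS aS; apply: clS => B /nbhs_ballP[e /= e0 eB].
have [r r0 er] := scalar_gt0P e0; have [w Sw vw] := aS r r0.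
exists w; split=> //; apply: eB; rewrite -ball_normE /ball_ /= er.
by rewrite -rc_nrm lt_rc.
Qed.

Lemma complete_seq_complete (V : completeNormedModType K) : seq_complete V.
Proof.
move=> u cu; have /cvg_ex[l ul] : cvg (u @ \oo).
  apply: cauchy_cvg; apply: cauchy_exP => e e0.
  have [r r0 ->] := scalar_gt0P e0; have [N hN] := cu r r0.
  exists (u N); exists N => // n /= Nn; rewrite -ball_normE /ball_ /=.
  by rewrite -rc_nrm lt_rc; exact: hN.
exists l => e e0; have re0 : 0 < rc e :> K by rewrite -(@rc0 R k) lt_rc.
move/cvgrPdist_lt : ul => /(_ _ re0)[N _ hN]; exists N => n Nn.
by have := hN n Nn; rewrite /= -rc_nrm lt_rc nrmB.
Qed.

End norm_topology.

(** * From a minimal idempotent to all operators of rank one *)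

Section rank_one.
Context {R : realType} {k : scalar_kind}.
Local Notation K := (scalar_field R k).
Context {X : normedModType K} (A : set (bounded_op X X)).
Hypothesis Aalg : subalgebra A.
Hypothesis Acl : forall T, adherent A T -> A T.
Hypothesis nres : ~ exists (x : dual (dual X)) (y : dual X),
  [/\ x != 0, y != 0 & resolving A x y].
Local Notation D := (bounded_op X K^o).

(** [P S P] acts on the span of [f] through a matrix, which has an eigenvalue [l] over the complex
    numbers. Subtracting [l] kills a combination of the [f i], so [P S P - l P] has smaller rank and
    vanishes by minimality. *)
Lemma corner_scalar (P : bounded_op X X) m (f : 'I_m.+1 -> X) :
  k = complex_scalars -> A P -> P * P = P -> (forall x, spanned f (P x)) ->
  (forall (U : bounded_op X X) (g : 'I_m -> X),
    A U -> (forall x, spanned g (U x)) -> U = 0) ->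
  forall S, A S -> exists l : K, P * S * P = l *: P.
Proof.
move=> kc AP PP Pf small S AS.
have AM V W : A V -> A W -> A (V * W) by exact: algM.
pose V := P * S * P; have AV : A V by exact: (AM _ _ (AM _ _ AP AS) AP).
have Vf x : spanned f (V x) by exact: Pf.
have /choice[a aP] : forall j, exists c, \sum_i c i *: f i = V (f j).
  by move=> j; have [c _] := Vf (f j); exists c.
have [l [v [[i0 vi0] vl]]] : exists (l : K) (v : 'I_m.+1 -> K), (exists i, v i != 0) /\
    forall i, \sum_j v j * a j i = l * v i.
  clear -kc; move: a; rewrite kc => a.
  have [l [v [v0 vE]]] := @closed_eigenvector R[i]%C _ (\matrix_(i, j) a i j).
  exists l, v; split=> // i; rewrite -vE; apply: eq_bigr => j _.
  by rewrite mxE.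
exists l; apply/eqP; rewrite -subr_eq0; apply/eqP.
(* [L] need not lie in [A], but [L * P = V - l *: P] does. *)
pose L : bounded_op X X := V - l *: id_op X.
apply: (small _ (fun j => L (f (lift i0 j)))).

  by apply: algB => //; exact: algZ.
move=> x; have -> : (V - l *: P) x = L (P x).
  by rewrite -[RHS]/((V * P) x - l *: P x) /V -!mulrA PP.
apply: (spanned_drop vi0) => //.
rewrite -[LHS]/(V (\sum_i v i *: f i) - l *: \sum_i v i *: f i).
have -> : V (\sum_i v i *: f i) = \sum_i v i *: V (f i).
  by rewrite linear_sum; apply: eq_bigr => i _; exact: linearZ.
under eq_bigr do rewrite -aP scaler_sumr.
rewrite exchange_big scaler_sumr /= -sumrB big1// => i _.
under eq_bigr do rewrite scalerA.
by rewrite -scaler_suml vl scalerA subrr.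
Qed.

(** Scalar corners and density of the orbit of [v] make [P] of rank one, [P u = f u *: v]. With
    [S v] near [w] and [op_comp f S'] near [h], the products [S P S'] approach [h (-) *: w], which
    thus lies in [A]; such operators correct [T] one vector at a time. *)
Lemma interpolation (P : bounded_op X X) : A P -> P != 0 -> P * P = P ->
  (forall S, A S -> exists l : K, P * S * P = l *: P) ->
  forall (T0 : bounded_op X X) (s : seq X), exists2 T, A T & forall x, x \in s -> T x = T0 x.
Proof.
move=> AP P0 PP Pl.
have [x0 Px0] : exists x, P x != 0.
  apply: contrapT => h; move/eqP: P0; apply; apply: bounded_op_ext => x.
  by apply: contrapT => /eqP Px; apply: h; exists x.
pose v := P x0; have Pv : P v = v by rewrite -[LHS]/((P * P) x0) PP.
have Pline u : spanned (fun _ : 'I_1 => v) (P u).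
  have sv := spanned_subspace (fun _ : 'I_1 => v).
  apply: (spanned_closed sv (@subset_refl _ _)) => e e0.
  have P1 : 0 < nrm P + 1 by rewrite ltr_wpDl// nrm_ge0.
  have [_ [S AS <-] lt] := dense_orbit Aalg nres Px0 u (divr_gt0 e0 P1).
  exists (P (S v)).
    have [l lE] := Pl S AS; exists (fun=> l) => //.
    rewrite big_ord1 -[in LHS]Pv -[LHS]/((l *: P) v) -lE.
    by rewrite -[LHS]/(P (S (P v))) Pv.
  rewrite -linearB; apply: le_lt_trans (nrm_op_app _ _) _.
  rewrite ltr_pdivlMr// mulrC in lt; apply: le_lt_trans lt.
  by rewrite ler_wpM2r ?nrm_ge0// lerDl.
have [F Fv] := functional_ex Px0.
pose f : D := op_comp F P.
have PE u : P u = (f u : K) *: v.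
  have [c _] := Pline u; rewrite big_ord1 => cE.
  have : (f u : K) = c ord0 * F v by rewrite -[LHS]/(F (P u)) -cE; exact: linearZ.
  by rewrite Fv mulr1 => ->.
have f0 : f != 0.
  apply/eqP => f0; move: Fv; rewrite -/v -{1}Pv -[LHS]/(f v) f0 => /esym/eqP.
  by rewrite oner_eq0.
have rank1 (w : X) (h : D) : exists2 T, A T & forall x, T x = (h x : K) *: w.
  have [||T TE] := @bounded_op_ex R k X X (fun x => (h x : K) *: w) (nrm h * nrm w).
  - move=> a x y; have -> : (h (a *: x + y) : K) = a * h x + h y by exact: linearP.
    by rewrite scalerDl scalerA.
  - by move=> x; rewrite nrmZ mulrAC ler_wpM2r ?nrm_ge0//; exact: nrm_op_app.
  exists T => //; apply: Acl => e e0.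
  have e2 : 0 < e / 2 by rewrite divr_gt0.
  have h1 : 0 < nrm h + 1 by rewrite ltr_wpDl// nrm_ge0.
  have [_ [S AS <-] Sw] := dense_orbit Aalg nres Px0 w (divr_gt0 e2 h1).
  have w1 : 0 < nrm (S v) + 1 by rewrite ltr_wpDl// nrm_ge0.
  have [_ [S' [AS' _] <-] Sh] :=
    dense_essential_orbit Aalg nres f0 h (divr_gt0 e2 w1).
  exists (op_comp S (op_comp P S')).
    by apply: algM => //; exact: algM.
  rewrite ltr_pdivlMr// in Sw; rewrite ltr_pdivlMr// in Sh.
  have := nrm_ge0 (w - S v); have := nrm_ge0 (h - op_comp f S') => g1 g2.
  apply: (@le_lt_trans _ _ (nrm h * nrm (w - S v) + nrm (h - op_comp f S') * nrm (S v))).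
    apply: nrm_op_le => [|x]; first by rewrite addr_ge0// mulr_ge0// nrm_ge0.
    have -> : (T - op_comp S (op_comp P S')) x =
        (h x : K) *: (w - S v) + ((h - op_comp f S') x : K) *: S v.
      have -> : ((h - op_comp f S') x : K) = (h x : K) - (f (S' x) : K) by [].
      have -> : (T - op_comp S (op_comp P S')) x = T x - S (P (S' x)) by [].
      by rewrite TE PE (linearZ_LR S) scalerBr scalerBl addrA subrK.
    apply: le_trans (nrmD _ _) _; rewrite !nrmZ mulrDl.
    apply: lerD; rewrite mulrAC ler_wpM2r ?nrm_ge0//; exact: nrm_op_app.
  by lra.
move=> T0; elim=> [|x s [T AT Ts]].
  by exists 0 => //; case: Aalg.
have [E EE] : exists E : bounded_op X X, forall u, E u = T0 u - T u by exists (T0 - T).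
(* The kernel of the current error contains the vectors already treated. A rank one correction that
   vanishes on it leaves them untouched, so linear dependence among the vectors is harmless. *)
pose L := [set u | E u = 0].
have Es y : y \in s -> L y.
  by move=> ys; rewrite /L /= EE Ts// subrr.
have [Ex|Ex] := eqVneq (E x) 0.
  exists T => // y; rewrite inE => /orP[/eqP ->|]; last exact: Ts.
  by apply/esym/subr0_eq; rewrite -EE.
have sL : subspace L.
  split; first exact: (linear0 E).
  move=> a u w; rewrite /L /= => u0 w0.
  have -> : E (a *: u + w) = a *: E u + E w by exact: linearP.
  by rewrite u0 w0 scaler0 addr0.
have nL : ~ adherent L x.
  move=> aL; move/eqP: Ex; apply; apply/nrm_eq0/norm_small0 => e e0.
  rewrite ger0_norm ?nrm_ge0//.
  have E1 : 0 < nrm E + 1 by rewrite ltr_wpDl// nrm_ge0.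
  have [w Lw lt] := aL _ (divr_gt0 e0 E1); rewrite ltr_pdivlMr// in lt.
  have Ew : E w = 0 by exact: Lw.
  have Exw : E (x - w) = E x - E w by exact: linearB.
  rewrite -[E x]subr0 -Ew -Exw.
  apply: le_trans (nrm_op_app _ _) _; rewrite mulrC; apply: le_trans (ltW lt).
  by rewrite ler_wpM2l ?nrm_ge0// lerDl.
have [h hx hL] := subspace_separation sL nL.
have [V AV VE] := rank1 (E x) h.
exists (T + V); first exact: algD.
move=> y; rewrite inE => /orP[/eqP ->|ys].
  by rewrite -[LHS]/(T x + V x) VE hx scale1r EE addrC subrK.
by rewrite -[LHS]/(T y + V y) VE hL ?scale0r ?addr0 ?Ts//; exact: Es.
Qed.

End rank_one.

Theorem theorem1p2 (R : realType) (k : scalar_kind)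
    (X : completeNormedModType (scalar_field R k)) (A : set (bounded_op X X)) :
  subalgebra A -> closed A -> ~ dense (A : set (wot X)) ->
  (exists (x : dual (dual X)) (y : dual X),
    [/\ x != 0, y != 0 & resolving A x y])
  \/
  (k = real_scalars /\
   exists P : bounded_op X X,
     [/\ A P, P != 0, op_comp P P = P & finite_rank P]).
Proof.
move=> Aalg clA ndense; apply: contrapT => /not_orP[nres nb].
have Acl T : adherent A T -> A T by exact: closed_adherent.
have cX : seq_complete (bounded_op X X : normedModType _).
  exact/bounded_op_complete/complete_seq_complete.
(* If [X = 0], the only operator is 0 and [A] is dense. *)
have [x0 x00] : exists x : X, x != 0.
  apply: contrapT => h; apply: ndense => O [T0 OT0] _; exists T0; split=> //.
  suff -> : T0 = 0 :> bounded_op X X by case: Aalg.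
  apply: bounded_op_ext => x; rewrite -[RHS]/(0 : X).
  by apply: contrapT => /eqP Tx; apply: h; exists (T0 x).
have [F Fx] := functional_ex x00.
have F0 : 0 < nrm F.
  apply: nrm_gt0; apply/eqP => F0; move: Fx; rewrite F0 => /esym/eqP.
  by rewrite oner_eq0.
have y02 : nrm (rc (2 / nrm F) *: F) = 2.
  by rewrite nrmZrc gtr0_norm ?divr_gt0// divfK// gt_eqF.
have [T [AT T1 nQ]] := no_quasi_inverse Aalg nres y02.
have [l [l1 [Z [AZ Z1 TZ]]]] := eigenoperator Aalg Acl cX AT T1 nQ.
have [n [e eP]] := eigenspace_finite_dimensional l1 T1.
have Z0 : Z != 0.
  by apply/eqP => Z0; move: Z1; rewrite Z0 nrm0 => /eqP; rewrite eq_sym oner_eq0.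
have Ze x : spanned e (Z x).
  by apply: eP; rewrite -[LHS]/((T * Z) x) TZ.
have [m [f [P [AP P0 PP Pf small]]]] := minimal_idempotent Aalg nres AZ Z0 Ze.
have [kr|kc] : k = real_scalars \/ k = complex_scalars by case: (k); [left|right].
  apply: nb; split=> //; exists P; split=> //.
  exact: idempotent_finite_rank PP Pf.
apply: ndense; apply: wot_dense; apply: (interpolation Aalg Acl nres AP P0 PP).
exact: corner_scalar kc AP PP Pf small.
Qed.
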